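(* Let $v\in\mathbb R^p$ be a unit vector and let $\alpha\ge0$ be a fixed real number. Assume the setting described in the context (standing regularity conditions and Gaussian design) with $\Sigma^{(1)}=\Sigma^{(2)}=I+\alpha vv^\top$. Then, with high probability over the randomness of $(Z^{(1)},Z^{(2)})$, $$V(\hat\beta;\beta^{(2)})=\sigma^2\frac{n}{p-n}+O(p^{-1/12}),$$ $$B_1(\hat\beta;\beta^{(2)})=\langle v,\beta^{(2)}\rangle^2\Big(\frac{\gamma(\gamma-1)(1+\alpha)}{(\gamma+\alpha)^2}-\frac{p-n}{p}\Big)+\frac{p-n}{p}\|\beta^{(2)}\|_2^2+O(p^{-1/12}\|\beta^{(2)}\|_2^2),$$ $$B_2(\hat\beta;\beta^{(2)})=\langle v,\tilde\beta\rangle^2\left(\Big(\frac{n_1}{n}\Big)^2\left(\frac{(1+\alpha)\big(1+\frac{(1+\alpha)^2}{\gamma-1}\big)}{(\gamma-1)\big(1+\frac{1+\alpha}{\gamma-1}\big)^2}-\frac1\gamma\right)+\frac{n_1}{n}\Big(1-\frac{n_1}{n}\Big)\frac{\alpha}{\gamma-1}\right)+\frac{n_1(p-n_1)}{p(p-n)}\|\tilde\beta\|_2^2+O(p^{-1/12}\|\tilde\beta\|_2^2),$$ $$B_3(\hat\beta;\beta^{(2)})=-\frac{2n_1}{n}\langle v,\beta^{(2)}\rangle\langle v,\tilde\beta\rangle\frac{(\gamma-1)(1+\alpha)\alpha}{(\gamma+\alpha)^2}+O(p^{-1/12}\|\beta^{(2)}\|_2\|\tilde\beta\|_2).$$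
   Context: Model. For $k=1$ (source) and $k=2$ (target), $y^{(k)}=X^{(k)}\beta^{(k)}+\epsilon^{(k)}$ with $X^{(k)}=Z^{(k)}(\Sigma^{(k)})^{1/2}\in\mathbb R^{n_k\times p}$, $\Sigma^{(k)}$ deterministic positive definite, $\beta^{(k)}\in\mathbb R^p$ independent of designs and noises (possibly arbitrary deterministic; statements are conditional on them). $n=n_1+n_2$, $\gamma=p/n$, $\tilde\beta=\beta^{(1)}-\beta^{(2)}$. All sizes and vectors may depend on $p$. Standing regularity conditions. $Z^{(1)},Z^{(2)},\epsilon^{(1)},\epsilon^{(2)}$ are mutually independent, and for a fixed $\tau\in(0,1)$: (a) all eigenvalues of $\Sigma^{(1)},\Sigma^{(2)}$ lie in $[\tau,\tau^{-1}]$; (b) entries of $\epsilon^{(k)}$ are independent, mean zero, variance $\sigma^2<\infty$; (c) $p/n_1,\ p/n_2,\ p/n\in[1+\tau,\tau^{-1}]$. Gaussian design: entries of $Z^{(1)},Z^{(2)}$ are independent $\mathcal N(0,1)$. Estimator and risk terms. $\hat\beta=(X^{(1)\top}X^{(1)}+X^{(2)\top}X^{(2)})^\dagger(X^{(1)\top}y^{(1)}+X^{(2)\top}y^{(2)})$ is the pooled min-$\ell_2$-norm interpolator. With $X=(X^{(1)\top},X^{(2)\top})^\top$, $\hat\Sigma=X^\top X/n$, $S_1=X^{(1)\top}X^{(1)}/n$, its risk $\mathbb E[\|\hat\beta-\beta^{(2)}\|_{\Sigma^{(2)}}^2\mid X]$ (with $\|x\|_A^2=x^\top Ax$) equals $V+B_1+B_2+B_3$,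 where $V=\frac{\sigma^2}{n}\mathrm{Tr}(\hat\Sigma^\dagger\Sigma^{(2)})$, $B_1=\beta^{(2)\top}(\hat\Sigma^\dagger\hat\Sigma-I)\Sigma^{(2)}(\hat\Sigma^\dagger\hat\Sigma-I)\beta^{(2)}$, $B_2=\tilde\beta^\top S_1\hat\Sigma^\dagger\Sigma^{(2)}\hat\Sigma^\dagger S_1\tilde\beta$, $B_3=2\beta^{(2)\top}(\hat\Sigma^\dagger\hat\Sigma-I)\Sigma^{(2)}\hat\Sigma^\dagger S_1\tilde\beta$. Conventions. ''With high probability'' means with probability tending to $1$ as $p\to\infty$; constants in $O(\cdot)$ depend only on fixed constants (such as $\tau,\sigma^2,\alpha$). *)

(* Defs.v *)
From HB Require Import structures.
From mathcomp Require Import all_boot all_order all_algebra.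
From mathcomp Require Import all_classical all_reals all_analysis.
From mathcomp Require Import ring lra.
Set Implicit Arguments.
Unset Strict Implicit.
Unset Printing Implicit Defensive.
Import Order.TTheory GRing.Theory Num.Theory.
Import numFieldTopology.Exports numFieldNormedType.Exports.
Local Open Scope classical_set_scope.
Local Open Scope ring_scope.

Definition dotv (R : rcfType) (p : nat) (u w : 'cV[R]_p) : R :=
  (u^T *m w) 0 0.

Definition l2norm (R : rcfType) (p : nat) (u : 'cV[R]_p) : R :=
  Num.sqrt (dotv u u).

Definition psd_mx (R : rcfType) (p : nat) (A : 'M[R]_p) : Prop :=
  A^T = A /\ forall u : 'cV[R]_p, 0 <= dotv u (A *m u).

Definition posdef_mx (R : rcfType) (p : nat) (A : 'M[R]_p) : Prop :=
  A^T = A /\ forall u : 'cV[R]_p, u != 0 -> 0 < dotv u (A *m u).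

Definition is_sqrt_mx (R : rcfType) (p : nat) (A S : 'M[R]_p) : Prop :=
  psd_mx S /\ S *m S = A.

(* The default value 0 is only taken when [A] is not positive semidefinite. *)
Definition sqrt_mx (R : rcfType) (p : nat) (A : 'M[R]_p) : 'M[R]_p :=
  xget 0 [set S | is_sqrt_mx A S].

Definition is_pinv (R : rcfType) (m p : nat)
    (A : 'M[R]_(m, p)) (G : 'M[R]_(p, m)) : Prop :=
  [/\ A *m G *m A = A, G *m A *m G = G,
      (A *m G)^T = A *m G & (G *m A)^T = G *m A].

(* Moore-Penrose inverse, by the four Penrose equations; MathComp's [pinvmx] is a one-sided partial inverse
   that does not satisfy the symmetry equations. The default value is never
   taken, see [pinvP]. *)
Definition pinv (R : rcfType) (m p : nat) (A : 'M[R]_(m, p)) : 'M[R]_(p, m) :=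
  xget 0 [set G | is_pinv A G].

Lemma dotvvE (R : rcfType) (p : nat) (u : 'cV[R]_p) :
  dotv u u = \sum_i u i 0 ^+ 2.
Proof. by rewrite /dotv mxE; apply: eq_bigr => i _; rewrite mxE expr2. Qed.

Lemma dotvv_eq0 (R : rcfType) (p : nat) (u : 'cV[R]_p) :
  dotv u u = 0 -> u = 0.
Proof.
rewrite dotvvE => /eqP.
rewrite psumr_eq0 => [/allP h|i _]; last exact: sqr_ge0.
apply/matrixP => i j; rewrite ord1 mxE.
by apply/eqP; rewrite -sqrf_eq0; apply: h; rewrite mem_index_enum.
Qed.

Lemma is_pinv_uniq (R : rcfType) (m p : nat)
    (A : 'M[R]_(m, p)) (G H : 'M[R]_(p, m)) :
  is_pinv A G -> is_pinv A H -> G = H.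
Proof.
move=> [a1 a2 a3 a4] [b1 b2 b3 b4].
have eAG : A *m H = A *m G.
  have e : A *m H = (A *m G) *m (A *m H) by rewrite mulmxA a1.
  rewrite -b3 e trmx_mul a3 b3.
  by rewrite mulmxA b1.
have eGA : G *m A = H *m A.
  have e : G *m A = (G *m A) *m (H *m A) by rewrite -mulmxA [A *m _]mulmxA b1.
  rewrite -a4 e trmx_mul a4 b4.
  by rewrite -mulmxA [A *m _]mulmxA a1.
by rewrite -a2 eGA -mulmxA -eAG mulmxA b2.
Qed.

Lemma gram_unitmx (R : rcfType) (m p : nat) (A : 'M[R]_(m, p)) :
  row_free A -> A *m A^T \in unitmx.
Proof.
move=> fA; rewrite -row_free_unit; apply/inj_row_free => w h.
have h1 : (A^T *m w^T) = 0.
  apply: dotvv_eq0; rewrite /dotv trmx_mul !trmxK mulmxA.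
  by rewrite -[w *m A *m _]mulmxA h mul0mx mxE.
move/(congr1 trmx): h1; rewrite trmx_mul !trmxK trmx0 => h1.
by apply: (row_free_inj fA); rewrite h1 mul0mx.
Qed.

Lemma is_pinv_full_rank (R : rcfType) (m r p : nat)
    (C : 'M[R]_(m, r)) (B : 'M[R]_(r, p)) :
  B *m B^T \in unitmx -> C^T *m C \in unitmx ->
  is_pinv (C *m B) (B^T *m invmx (B *m B^T) *m (invmx (C^T *m C) *m C^T)).
Proof.
move=> uB uC; set G := _ *m (_ *m _).
have AG : C *m B *m G = C *m invmx (C^T *m C) *m C^T.
  by rewrite /G -!mulmxA [B *m (B^T *m _)]mulmxA (mulKVmx uB).
have GA : G *m (C *m B) = B^T *m invmx (B *m B^T) *m B.
  by rewrite /G -!mulmxA [C^T *m (C *m _)]mulmxA (mulKmx uC).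
split.
- by rewrite AG -!mulmxA [C^T *m (C *m _)]mulmxA (mulKmx uC).
- by rewrite GA /G -!mulmxA [B *m (B^T *m _)]mulmxA (mulKVmx uB).
- by rewrite AG !trmx_mul trmx_inv trmx_mul !trmxK mulmxA.
- by rewrite GA !trmx_mul trmx_inv trmx_mul !trmxK mulmxA.
Qed.

Lemma is_pinv_exists (R : rcfType) (m p : nat) (A : 'M[R]_(m, p)) :
  exists G, is_pinv A G.
Proof.
rewrite -(mulmx_base A); eexists; apply: is_pinv_full_rank.
  by apply: gram_unitmx; exact: row_base_free.
rewrite -{2}[col_base A]trmxK; apply: gram_unitmx.
by rewrite /row_free mxrank_tr; exact: col_base_full.
Qed.

Lemma pinvP (R : rcfType) (m p : nat) (A : 'M[R]_(m, p)) :
  is_pinv A (pinv A).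
Proof.
by have [G hG] := is_pinv_exists A; exact: (xgetI 0 (hG : [set G | is_pinv A G] G)).
Qed.

Lemma pinv_eq (R : rcfType) (m p : nat) (A : 'M[R]_(m, p)) (G : 'M[R]_(p, m)) :
  is_pinv A G -> pinv A = G.
Proof. exact/is_pinv_uniq/pinvP. Qed.

Lemma dotvDl (R : rcfType) (p : nat) (u w x : 'cV[R]_p) :
  dotv (u + w) x = dotv u x + dotv w x.
Proof. by rewrite /dotv linearD mulmxDl mxE. Qed.

Lemma dotvDr (R : rcfType) (p : nat) (u w x : 'cV[R]_p) :
  dotv x (u + w) = dotv x u + dotv x w.
Proof. by rewrite /dotv mulmxDr mxE. Qed.

Lemma dotvZl (R : rcfType) (p : nat) (a : R) (u x : 'cV[R]_p) :
  dotv (a *: u) x = a * dotv u x.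
Proof. by rewrite /dotv linearZ/= -scalemxAl mxE. Qed.

Lemma dotvZr (R : rcfType) (p : nat) (a : R) (u x : 'cV[R]_p) :
  dotv x (a *: u) = a * dotv x u.
Proof. by rewrite /dotv -scalemxAr mxE. Qed.

Lemma psd_form_eq0 (R : rcfType) (p : nat) (A : 'M[R]_p) (x : 'cV[R]_p) :
  psd_mx A -> dotv x (A *m x) = 0 -> A *m x = 0.
Proof.
move=> [At hA] x0; apply: dotvv_eq0.
set y := A *m x; set a := dotv y y; set b := dotv y (A *m y).
have a0 : 0 <= a by rewrite /a dotvvE sumr_ge0 // => i _; exact: sqr_ge0.
have b0 : 0 <= b by exact: hA.
have ht t : 0 <= t * a *+ 2 + t ^+ 2 * b.
  have := hA (x + t *: y); suff -> : dotv (x + t *: y) (A *m (x + t *: y)) =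
    dotv x (A *m x) + (t * a *+ 2 + t ^+ 2 * b) by rewrite x0 add0r.
  have e1 : dotv x (A *m y) = a.
    by rewrite /a {2}/y /dotv [in RHS]trmx_mul At mulmxA.
  rewrite mulmxDr -scalemxAr -/y !(dotvDl, dotvDr, dotvZl, dotvZr) e1.
  by rewrite -/a -/b; ring.
have b1 : 0 < b + 1 by lra.
have := ht (- (a / (b + 1))).
have -> : - (a / (b + 1)) * a *+ 2 + (- (a / (b + 1))) ^+ 2 * b =
  - (a ^+ 2 * (b + 2%:R)) / (b + 1) ^+ 2 by field; exact: lt0r_neq0.
have d0 : 0 < (b + 1) ^+ 2 by rewrite exprn_gt0.
have b2 : 0 < b + 2%:R by rewrite ltr_wpDl.
rewrite (pmulr_lge0 _ (_ : 0 < _^-1)) ?invr_gt0// oppr_ge0 (pmulr_lle0 _ b2) => h.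
by apply/eqP; rewrite -sqrf_eq0 eq_le h sqr_ge0.
Qed.

Lemma is_sqrt_mx_uniq (R : rcfType) (p : nat) (A S U : 'M[R]_p) :
  is_sqrt_mx A S -> is_sqrt_mx A U -> S = U.
Proof.
move=> [pS sS] [pU sU]; pose D := S - U.
have Dt : D^T = D by rewrite /D linearB/= (proj1 pS) (proj1 pU).
pose q (M : 'M[R]_p) i := dotv (col i D) (M *m col i D).
have qE M : \sum_i q M i = \tr (D *m M *m D).
  apply: eq_bigr => i _.
  rewrite /q /dotv tr_col Dt colE rowE !mulmxA -!(mulmxA (delta_mx 0 i)).
  by rewrite -rowE -colE mxE [in LHS]mxE.
have tr0 : \tr (D *m S *m D) + \tr (D *m U *m D) = 0.
  rewrite -linearD/= -mulmxDl -mulmxDr.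
  have -> : D *m (S + U) = S *m U - U *m S.
    rewrite /D mulmxDr !mulmxBl sS sU.
    by apply/matrixP => i j; rewrite !mxE; ring.
  have e1 : \tr (S *m U *m S) = \tr (A *m U) by rewrite mxtrace_mulC mulmxA sS.
  have e2 : \tr (U *m S *m S) = \tr (A *m U) by rewrite -mulmxA sS mxtrace_mulC.
  have e3 : \tr (U *m S *m U) = \tr (A *m S) by rewrite mxtrace_mulC mulmxA sU.
  have e4 : \tr (S *m U *m U) = \tr (A *m S) by rewrite -mulmxA sU mxtrace_mulC.
  by rewrite /D mulmxBr !mulmxBl !linearB/= e1 e2 e3 e4; ring.
have q0 M i : psd_mx M -> 0 <= q M i by move=> [_ h]; exact: h.
have qS i : q S i = 0 /\ q U i = 0.
  move/eqP: tr0; rewrite -!qE -big_split/= psumr_eq0; last first.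
    by move=> j _; rewrite addr_ge0 ?q0.
  move/allP/(_ i (mem_index_enum i)).
  by rewrite /= paddr_eq0 ?q0// => /andP[/eqP-> /eqP->].
have col0 i : col i D = 0.
  have [/(psd_form_eq0 pS) h1 /(psd_form_eq0 pU) h2] := qS i.
  apply: dotvv_eq0.
  have : D *m col i D = 0 by rewrite mulmxBl h1 h2 subrr.
  move/(congr1 (fun M : 'cV[R]_p => M i 0)).
  rewrite /dotv tr_col Dt !mxE => h.
  by rewrite -[RHS]h; apply: eq_bigr => j _; rewrite !mxE.
apply/eqP; rewrite -subr_eq0 -/D; apply/eqP/matrixP => i j.
by have /matrixP/(_ i 0) := col0 j; rewrite !mxE.
Qed.

Lemma sqrt_mx_eq (R : rcfType) (p : nat) (A S : 'M[R]_p) :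
  is_sqrt_mx A S -> sqrt_mx A = S.
Proof.
move=> h; apply: (is_sqrt_mx_uniq _ h).
exact: (xgetI 0 (h : [set S | is_sqrt_mx A S] S)).
Qed.

(* Mutual independence of a finite family of set systems, meant to be
   sigma-algebras: product rule over every subfamily. *)
Definition mutually_independent (d : measure_display) (T : measurableType d)
    (R : realType) (P : probability T R) (I : finType)
    (F : I -> set (set T)) : Prop :=
  forall (J : {set I}) (E : I -> set T),
    (forall j, j \in J -> F j (E j)) ->
    P (\bigcap_(j in [set` J]) E j) = (\prod_(j in J) P (E j))%E.

Definition sigma_family (T : Type) (R : realType) (I : Type)
    (X : I -> T -> R) : set (set T) :=
  <<s \bigcup_i preimage_set_system setT (X i) measurable >>.

Definition independent_vars (d : measure_display) (T : measurableType d)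
    (R : realType) (P : probability T R) (I : finType)
    (X : I -> {RV P >-> R}) : Prop :=
  mutually_independent P (fun i => preimage_set_system setT (X i) measurable).

Definition standard_normal (d : measure_display) (T : measurableType d)
    (R : realType) (P : probability T R) (X : {RV P >-> R}) : Prop :=
  forall A : set R, measurable A -> distribution P X A = normal_prob 0 1 A.

(* The events need not be assumed measurable: [A p] is only required to contain
   a measurable event whose probability tends to 1. *)
Definition with_high_probability (R : realType) (d : nat -> measure_display)
    (T : forall p, measurableType (d p)) (P : forall p, probability (T p) R)
    (A : forall p, set (T p)) : Prop :=
  exists2 E : forall p, set (T p),
    forall p, measurable (E p) /\ E p `<=` A p &
    (fun p => P p (E p)) @ \oo --> 1%E.

(* [beta1], [beta2] are deterministic: statements are conditional on them. *)
Record transfer_model (R : realType) (p : nat) := TransferModel {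
  n1 : nat;
  n2 : nat;
  disp : measure_display;
  Omega : measurableType disp;
  Pr : probability Omega R;
  Z1 : 'I_n1 -> 'I_p -> {RV Pr >-> R};
  Z2 : 'I_n2 -> 'I_p -> {RV Pr >-> R};
  eps1 : 'I_n1 -> {RV Pr >-> R};
  eps2 : 'I_n2 -> {RV Pr >-> R};
  Sigma1 : 'M[R]_p;
  Sigma2 : 'M[R]_p;
  beta1 : 'cV[R]_p;
  beta2 : 'cV[R]_p
}.

Arguments Z1 [R p] t _ _.
Arguments Z2 [R p] t _ _.
Arguments eps1 [R p] t _.
Arguments eps2 [R p] t _.

Definition ntot (R : realType) (p : nat) (M : transfer_model R p) : nat :=
  (n1 M + n2 M)%N.

Definition aspect_ratio (R : realType) (p : nat) (M : transfer_model R p) : R :=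
  p%:R / (ntot M)%:R.

Definition betatilde (R : realType) (p : nat) (M : transfer_model R p) :
    'cV[R]_p :=
  beta1 M - beta2 M.

Definition X1 (R : realType) (p : nat) (M : transfer_model R p)
    (w : Omega M) : 'M[R]_(n1 M, p) :=
  (\matrix_(i, j) Z1 M i j w) *m sqrt_mx (Sigma1 M).

Definition X2 (R : realType) (p : nat) (M : transfer_model R p)
    (w : Omega M) : 'M[R]_(n2 M, p) :=
  (\matrix_(i, j) Z2 M i j w) *m sqrt_mx (Sigma2 M).

Definition y1 (R : realType) (p : nat) (M : transfer_model R p)
    (w : Omega M) : 'cV[R]_(n1 M) :=
  X1 w *m beta1 M + \col_i eps1 M i w.

Definition y2 (R : realType) (p : nat) (M : transfer_model R p)
    (w : Omega M) : 'cV[R]_(n2 M) :=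
  X2 w *m beta2 M + \col_i eps2 M i w.

Definition independent_blocks (R : realType) (p : nat)
    (M : transfer_model R p) : Prop :=
  mutually_independent (Pr M)
    (tnth [tuple sigma_family (fun ij : 'I_(n1 M) * 'I_p => Z1 M ij.1 ij.2);
                 sigma_family (fun ij : 'I_(n2 M) * 'I_p => Z2 M ij.1 ij.2);
                 sigma_family (eps1 M);
                 sigma_family (eps2 M)]).

Definition noise_ok (R : realType) (sigma : R) (d : measure_display)
    (T : measurableType d) (P : probability T R) (I : finType)
    (eps : I -> {RV P >-> R}) : Prop :=
  independent_vars eps /\
  forall i, ('E_P[eps i] = 0)%E /\ ('V_P[eps i] = (sigma ^+ 2)%:E)%E.

Definition covariance_ok (R : realType) (tau : R) (p : nat)
    (S : 'M[R]_p) : Prop :=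
  posdef_mx S /\ forall a, eigenvalue S a -> tau <= a <= tau^-1.

Definition standing_conditions (R : realType) (tau sigma : R) (p : nat)
    (M : transfer_model R p) : Prop :=
  [/\ independent_blocks M,
      covariance_ok tau (Sigma1 M) /\ covariance_ok tau (Sigma2 M),
      noise_ok sigma (eps1 M) /\ noise_ok sigma (eps2 M) &
      [/\ 1 + tau <= p%:R / (n1 M)%:R <= tau^-1,
          1 + tau <= p%:R / (n2 M)%:R <= tau^-1 &
          1 + tau <= p%:R / (ntot M)%:R <= tau^-1]].

Definition all_design_entries (R : realType) (p : nat)
    (M : transfer_model R p)
    (a : 'I_(n1 M) * 'I_p + 'I_(n2 M) * 'I_p) : {RV (Pr M) >-> R} :=
  match a with
  | inl ij => Z1 M ij.1 ij.2
  | inr ij => Z2 M ij.1 ij.2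
  end.

Definition gaussian_design (R : realType) (p : nat)
    (M : transfer_model R p) : Prop :=
  independent_vars (@all_design_entries R p M) /\
  forall a, standard_normal (@all_design_entries R p M a).

Definition beta_hat (R : realType) (p : nat) (M : transfer_model R p)
    (w : Omega M) : 'cV[R]_p :=
  pinv ((X1 w)^T *m X1 w + (X2 w)^T *m X2 w) *m
    ((X1 w)^T *m y1 w + (X2 w)^T *m y2 w).

Definition Sigma_hat (R : realType) (p : nat) (M : transfer_model R p)
    (w : Omega M) : 'M[R]_p :=
  (ntot M)%:R^-1 *: ((col_mx (X1 w) (X2 w))^T *m col_mx (X1 w) (X2 w)).

Definition S1 (R : realType) (p : nat) (M : transfer_model R p)
    (w : Omega M) : 'M[R]_p :=
  (ntot M)%:R^-1 *: ((X1 w)^T *m X1 w).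

(* The risk of [beta_hat] on the target, conditionally on the designs, is
   [risk_V + risk_B1 + risk_B2 + risk_B3]: the noise enters only through its
   variance [sigma ^+ 2]. *)
Definition risk_V (R : realType) (sigma : R) (p : nat)
    (M : transfer_model R p) (w : Omega M) : R :=
  sigma ^+ 2 / (ntot M)%:R * \tr (pinv (Sigma_hat w) *m Sigma2 M).

Definition risk_B1 (R : realType) (p : nat) (M : transfer_model R p)
    (w : Omega M) : R :=
  ((beta2 M)^T *m (pinv (Sigma_hat w) *m Sigma_hat w - 1%:M) *m Sigma2 M *m
     (pinv (Sigma_hat w) *m Sigma_hat w - 1%:M) *m beta2 M) 0 0.

Definition risk_B2 (R : realType) (p : nat) (M : transfer_model R p)
    (w : Omega M) : R :=
  ((betatilde M)^T *m S1 w *m pinv (Sigma_hat w) *m Sigma2 M *m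
     pinv (Sigma_hat w) *m S1 w *m betatilde M) 0 0.

Definition risk_B3 (R : realType) (p : nat) (M : transfer_model R p)
    (w : Omega M) : R :=
  2%:R * ((beta2 M)^T *m (pinv (Sigma_hat w) *m Sigma_hat w - 1%:M) *m
     Sigma2 M *m pinv (Sigma_hat w) *m S1 w *m betatilde M) 0 0.

(* Main.v *)
Require Import Defs.
From HB Require Import structures.
From mathcomp Require Import all_boot all_order all_algebra.
From mathcomp Require Import all_classical all_reals all_analysis.
From mathcomp Require Import measurable_realfun.
From mathcomp Require Import ring lra.
Set Implicit Arguments.
Unset Strict Implicit.
Unset Printing Implicit Defensive.
Import Order.TTheory GRing.Theory Num.Theory.
Import numFieldTopology.Exports numFieldNormedType.Exports.
Local Open Scope classical_set_scope.
Local Open Scope ring_scope.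

(** Write the pooled design as [X = Z *m Rt], with [Z] a Gaussian matrix and [Rt] the square
    root of [1 + alpha v v^T]. Since [X *m X^T = Z *m Z^T + alpha (Z v) (Z v)^T] is a rank-one
    perturbation of the isotropic Gram matrix, the Sherman-Morrison formula turns [V], [B1],
    [B2] and [B3] into explicit rational functions of a few isotropic quantities
    ([spiked_var], [spiked_bias1], [spiked_bias2], [spiked_bias3]): the quadratic forms of the
    projection [Pi] on the kernel of [Z], the trace of [(Z Z^T)^-1], the form of its square at
    [Z v], and the inner products and norm of the ridgeless solution
    [y = Z^T (Z Z^T)^-1 L Z t], where [L] keeps the source rows. The denominators of these
    functions are at least 1, so that they are Lipschitz ([agree]), and it remains to
    see that the isotropic quantities are within [O(r)], [r = p ^ (-1/12)], of their limits
    ([gaussian_concentration]).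

    That is proved by revealing the rows one at a time. After [k] rows, [Pi] is the projection
    on their orthogonal complement, [G] the pseudo-inverse of the sum [S] of the [x x^T], and
    [y = G S1 t], where [S1] is the part of [S] due to the source rows. A new row [z] changes
    the three by rank-one updates in which the only nonlinearity is a division by
    [d = z^T Pi z], a variable of mean [D = p - k]. Replacing [d] by [D], and every quadratic
    form in [z] by its mean, gives recursions with closed solutions ([traj_dot], [traj_norm],
    [traj_trace]). Let [energy] be the sum of the squared deviations from these solutions and
    of the form [u^T G u], whose limit is 0. As long as [|d - D| <= dl D], one step multiplies
    the conditional mean of the energy by at most [1 + C / p] and adds at most [C dl^2 / p]
    ([energy_step_mean]): this needs only that a Gaussian quadratic form has variance of the
    order of the squared Frobenius norm. There are at most [p] steps, so that the mean energy
    stays of order [dl^2]. The condition on [d] fails at some step with probability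
    [O(dl^-4 p^-1)], by the fourth moment of [d - D]. For [dl = r^2] both quantities are
    [O(r^4)], and Markov's inequality concludes ([run_concentrates]).

    Conditioning on the earlier rows is Tonelli's theorem for an independent copy of the new
    row ([integral_independent_copy]), and the moments of quadratic forms come from adding the
    coordinates of [z] one at a time, with the same tool. *)

(** * Polynomial moments of the standard normal law *)

Section density.
Context d (T : measurableType d) (R : realType).
Variables (mu nu : {measure set T -> \bar R}) (g : T -> R).
Hypotheses (mg : measurable_fun setT g) (g0 : forall x, 0 <= g x).
Hypothesis nuE : forall A, measurable A -> nu A = (\int[mu]_(x in A) (g x)%:E)%E.
Import HBNNSimple.
Local Open Scope ereal_scope.

(** The usual approximation scheme: nonnegative simple functions, then monotone limits. *)
Let int_nnsfun (f : {nnsfun T >-> R}) :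
  \int[nu]_x (f x)%:E = \int[mu]_x ((f x)%:E * (g x)%:E).
Proof.
under [LHS]eq_integral do rewrite fimfunE -fsumEFin//.
rewrite [LHS]ge0_integral_fsum//; last 2 first.
  - by move=> r; exact/measurable_EFinP/measurableT_comp.
  - by move=> n x _; rewrite EFinM nnfun_muleindic_ge0.
under [RHS]eq_integral.
  move=> x xD; rewrite muleC fimfunE -fsumEFin// ge0_mule_fsumr; last first.
    by move=> r; rewrite EFinM nnfun_muleindic_ge0.
  over.
rewrite [RHS]ge0_integral_fsum//; last 2 first.
  - move=> r; apply/measurable_EFinP/measurable_funM => //.
    by apply: measurable_funM => //; exact: measurable_indic.
  - move=> n x _; rewrite EFinM mule_ge0//; last by rewrite nnfun_muleindic_ge0.
    by rewrite lee_fin.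
apply: eq_fsbigr => r rf.
have [->|r0] := eqVneq r 0%R.
  by rewrite !integral0_eq// => x _; rewrite ?mul0r// mule0.
have [rneg|r0'] := ltrP r 0%R.
  have f0 : f @^-1` [set r] = set0.
    by rewrite preimage_nnfun0.
  by rewrite f0 indic0 !integral0_eq// => x _; rewrite /= mulr0 ?mule0.
rewrite integralZl_indic_nnsfun//=.
rewrite integral_indic// setIT nuE//.
rewrite [X in _ * X]integral_mkcond/=.
rewrite -ge0_integralZl//=.
- apply: eq_integral => x _; rewrite patchE indicE.
  by case: ifPn => _; rewrite ?mulr1 ?mulr0 ?mule0// muleC.
- exact/(measurable_restrictT _ _).1/measurable_funTS/measurable_EFinP.
- by move=> x _; rewrite patchE; case: ifPn => _; rewrite ?lee_fin.
Qed.

Lemma ge0_integral_density (f : T -> \bar R) :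
  measurable_fun setT f -> (forall x, 0 <= f x) ->
  \int[nu]_x f x = \int[mu]_x (f x * (g x)%:E).
Proof.
move=> mf f0; pose f_ := nnsfun_approx measurableT mf.
transitivity (lim (\int[nu]_x (f_ n x)%:E @[n --> \oo])).
  rewrite -monotone_convergence//=.
  - apply: eq_integral => ? /[!inE] xD; apply/esym/cvg_lim => //=.
    exact: cvg_nnsfun_approx.
  - by move=> n; exact/measurable_EFinP/measurable_funTS.
  - by move=> n ? _; rewrite lee_fin.
  - by move=> ? _ ? ? mn; rewrite lee_fin; exact/lefP/nd_nnsfun_approx.
transitivity (lim (\int[mu]_x ((f_ n x)%:E * (g x)%:E) @[n --> \oo])).
  by apply: congr_lim; apply/funext => n; exact: int_nnsfun.
rewrite -monotone_convergence//=.
- apply: eq_integral => x /[!inE] xD; apply/cvg_lim => //=.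
  apply: cvgeZr => //; exact: cvg_nnsfun_approx.
- by move=> n; apply/measurable_EFinP/measurable_funM => //; exact: measurable_funTS.
- by move=> n ? _; rewrite lee_fin mulr_ge0.
- by move=> ? _ ? ? mn; rewrite lee_fin ler_wpM2r//; exact/lefP/nd_nnsfun_approx.
Qed.

End density.

Section normal_moments.
Variable R : realType.
Local Notation mu := (@lebesgue_measure R).
Local Notation nu := (@normal_prob R 0 1).
Local Notation phi := (@normal_pdf R 0 1).

Lemma normal_integralE (f : R -> \bar R) :
  measurable_fun setT f -> (forall x, 0 <= f x)%E ->
  (\int[nu]_x f x = \int[mu]_x (f x * (phi x)%:E))%E.
Proof.
apply: (@ge0_integral_density _ (measurableTypeR R) R mu nu phi) => //.
- exact: measurable_normal_pdf.
- by move=> x; exact: normal_pdf_ge0.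
Qed.

(** Domination by a normal density with other parameters replaces the explicit computation
    of an integral: that density has integral 1. *)
Lemma normal_le_integral m s (f : R -> R) (K : R) :
  0 <= K -> measurable_fun setT f -> (forall x, 0 <= f x) ->
  (forall x, f x * phi x <= K * normal_pdf m s x) ->
  (\int[nu]_x (f x)%:E <= K%:E)%E.
Proof.
move=> K0 mf f0 fK; rewrite normal_integralE//; last exact/measurable_EFinP.
have mp := @measurable_normal_pdf R.
rewrite -[leRHS]mule1 -(integral_normal_pdf m s) -ge0_integralZl//; first last.
- by move=> x _; rewrite lee_fin normal_pdf_ge0.
- by apply/measurable_EFinP; exact: mp.
- apply: ge0_le_integral => //.
  + by move=> x _; rewrite mule_ge0 ?lee_fin ?normal_pdf_ge0.
  + by apply/measurable_EFinP/measurable_funM => //; exact: mp.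
  + by apply/measurable_EFinP/measurable_funM => //; exact: mp.
  + by move=> x _; rewrite -!EFinM lee_fin.
Qed.

Lemma normal_pdf01E m s x : 0 < s ->
  s * normal_pdf m s x = phi x * expR (x ^+ 2 / 2 - (x - m) ^+ 2 / (s ^+ 2 * 2)).
Proof.
move=> s0; rewrite !normal_pdfE ?oner_eq0 ?gt_eqF//.
rewrite /normal_fun -mulrA -expRD mulrA; congr (_ * expR _).
  rewrite /normal_peak -mulrnAr sqrtrM ?sqr_ge0// sqrtr_sqr gtr0_norm//.
  by rewrite invfM mulrA divff ?gt_eqF// mul1r expr1n mul1r.
by rewrite subr0 -[1 ^+ 2 *+ 2]mulr_natr -[s ^+ 2 *+ 2]mulr_natr; field; rewrite gt_eqF.
Qed.

(** The density of variance 4 dominates [x ^+ 8] times the standard one, since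
    [expR (3 x^2 / 8)] exceeds its term of degree 4. *)
Lemma normal_moment8 : exists2 K : R, 0 <= K &
  (\int[nu]_x ((x : R) ^+ 8)%:E <= K%:E)%E.
Proof.
have : exists2 K : R, 0 <= K & K = 24 * (8 / 3) ^+ 4 :> R.
  by exists (24 * (8 / 3) ^+ 4); rewrite // mulr_ge0 ?exprn_ge0 ?divr_ge0.
move=> [K K0 KE]; exists (2 * K); first by rewrite mulr_ge0.
apply: (@normal_le_integral 0 2) => //.
    by rewrite mulr_ge0.
  by move=> x; rewrite exprn_even_ge0.
move=> x; have -> : 2 * K * normal_pdf 0 2 x = K * (2 * normal_pdf 0 2 x).
  by rewrite mulrCA mulrA.
rewrite normal_pdf01E// [leLHS]mulrC [leRHS]mulrCA. rewrite ler_wpM2l ?normal_pdf_ge0//.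
have -> : x ^+ 2 / 2 - (x - 0) ^+ 2 / (2 ^+ 2 * 2) = 3 / 8 * x ^+ 2 by field.
have u0 : 0 <= 3 / 8 * x ^+ 2 by rewrite mulr_ge0// sqr_ge0.
have := expR_ge1Dxn 3 u0; rewrite exprMn -exprM /= => h.
have -> : x ^+ 8 = K * ((3 / 8) ^+ 4 * x ^+ 8 / 4`!%:R) :> R.
  by rewrite KE [4`!%:R](_ : _ = 24)//; field.
by rewrite ler_wpM2l// (le_trans _ h)// lerDr.
Qed.
End normal_moments.

Section normal_expectation.
Variable R : realType.
Local Notation mu := (@lebesgue_measure R).
Local Notation nu := (@normal_prob R 0 1).
Local Notation phi := (@normal_pdf R 0 1).

Lemma normal_integrable (f : R -> R) (K : R) : measurable_fun setT f ->
  (forall x, `|f x| <= K * (1 + x ^+ 8)) ->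
  nu.-integrable setT (EFin \o f).
Proof.
move=> mf fK; have [C C0 hC] := normal_moment8 R.
have mX : measurable_fun setT (fun x : R => x ^+ 8) by exact: measurable_funX.
have i8 : nu.-integrable setT (EFin \o (fun x : R => x ^+ 8)).
  apply/integrableP; split; first exact/measurable_EFinP.
  under eq_integral do rewrite /= ger0_norm ?exprn_even_ge0//.
  by rewrite (le_lt_trans hC)// ltry.
have i1 : nu.-integrable setT (EFin \o (cst 1 : R -> R)).
  exact: finite_measure_integrable_cst.
have i2 := integrableZl measurableT K (integrableD measurableT i1 i8).
apply: (le_integrable measurableT _ _ i2); first exact/measurable_EFinP.
move=> x _; rewrite -[X in (_ <= `|X|)%E]/((K * (1 + x ^+ 8))%:E) lee_fin.
by rewrite (le_trans (fK x))// ler_norm.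
Qed.

(* The first two moments are found below by comparing densities. *)
Let e1 : R := (\int[nu]_x (x : R))%R.
Let e2 : R := (\int[nu]_x ((x : R) ^+ 2))%R.

Let pow8 (x : R) k : (k <= 8)%N -> `|x| ^+ k <= 1 + x ^+ 8.
Proof.
move=> k8; rewrite -[x ^+ 8]ger0_norm ?exprn_even_ge0// normrX.
have [x1|x1] := lerP `|x| 1.
  by rewrite (@le_trans _ _ 1)// ?exprn_ile1// lerDl exprn_ge0.
by rewrite (@le_trans _ _ (`|x| ^+ 8))// ?lerDr// ler_weXn2l// ltW.
Qed.

Lemma normal_integrableX k : (k <= 8)%N ->
  nu.-integrable setT (EFin \o (fun x : R => x ^+ k)).
Proof.
move=> k8; apply: (@normal_integrable _ 1); first exact: measurable_funX.
by move=> x; rewrite normrX mul1r pow8.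
Qed.

Lemma normal_integral_quad (a b c : R) :
  (\int[nu]_x (a + b * x + c * x ^+ 2)%:E = (a + b * e1 + c * e2)%:E)%E.
Proof.
have i1 : nu.-integrable setT (EFin \o (cst a : R -> R)).
  exact: finite_measure_integrable_cst.
have i2 : nu.-integrable setT (EFin \o (fun x : R => x)).
  exact: (@normal_integrableX 1).
have i3 := @normal_integrableX 2 isT.
under eq_integral do rewrite !EFinD EFinM [(c * _)%:E]EFinM.
rewrite integralD//=; last 2 first.
- by apply: integrableD => //; exact: integrableZl.
- exact: integrableZl.
rewrite integralD//=; last exact: integrableZl.
have -> : (\int[nu]__ a%:E = a%:E)%E.
  by rewrite integral_cst//= [X in (_ * X)%E](integral_normal_pdf 0 1) mule1.
rewrite !integralZl//.
by rewrite !EFinD !EFinM /e1 /e2 /Rintegral !fineK// integrable_fin_num.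
Qed.

Let quad (a b c x : R) : R := a + b * x + c * x ^+ 2.

Let measurable_quad a b c : measurable_fun setT (quad a b c).
Proof.
apply: measurable_funD.
  by apply: measurable_funD => //; apply: measurable_funM.
by apply: measurable_funM => //; exact: measurable_funX.
Qed.

(** Integrating a pointwise inequality whose right-hand side involves the density of mean [m]
    and deviation [s] yields a relation between the first two moments. *)
Let normal_compare m s K a b c a' b' c' : 0 <= K ->
  (forall x, 0 <= quad a b c x) -> (forall x, 0 <= quad a' b' c' x) ->
  (forall x, quad a b c x * phi x <=
     K * normal_pdf m s x + quad a' b' c' x * phi x) ->
  a + b * e1 + c * e2 <= K + (a' + b' * e1 + c' * e2).
Proof.
move=> K0 q0 q0' le_q; have mp := @measurable_normal_pdf R.
have mq := measurable_quad.
have mqp a1 b1 c1 : measurable_fun [set: measurableTypeR R]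
    (fun x => (quad a1 b1 c1 x)%:E * (phi x)%:E)%E.
  by apply/measurable_EFinP/measurable_funM; [exact: mq|exact: mp].
rewrite -lee_fin [leRHS]EFinD -!normal_integral_quad !normal_integralE//.
- rewrite -[K%:E]mule1 -(integral_normal_pdf m s) -ge0_integralZl//; first last.
  + by move=> x _; rewrite lee_fin normal_pdf_ge0.
  + by apply/measurable_EFinP; exact: mp.
  have mKp : measurable_fun [set: measurableTypeR R]
      (fun x => K%:E * (normal_pdf m s x)%:E)%E.
    by apply/measurable_EFinP/measurable_funM => //; exact: mp.
  rewrite -ge0_integralD//; first last.
  + exact: mqp.
  + by move=> x _; rewrite mule_ge0 ?lee_fin ?normal_pdf_ge0 ?q0'.
  + by move=> x _; rewrite mule_ge0 ?lee_fin ?normal_pdf_ge0.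
  apply: ge0_le_integral => //.
  + by move=> x _; rewrite mule_ge0 ?lee_fin ?normal_pdf_ge0 ?q0.
  + exact: mqp.
  + by apply: emeasurable_funD; [exact: mKp|exact: mqp].
  + by move=> x _; rewrite -!EFinM -EFinD lee_fin le_q.
- by apply/measurable_EFinP; exact: mq.
- by apply/measurable_EFinP; exact: mq.
Qed.

(** From [1 + u <= expR u], where [expR u] is the ratio of the densities of mean [m] and 0. *)
Let e1_le m : m * e1 <= m ^+ 2 / 2.
Proof.
have := @normal_compare m 1 1 (1 + m ^+ 2 / 2) m 1 (m ^+ 2) 0 1 ler01.
have h1 x : 0 <= quad (1 + m ^+ 2 / 2) m 1 x.
  rewrite /quad [leRHS](_ : _ = 1 + (m + x) ^+ 2 / 2 + x ^+ 2 / 2); last by field.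
  by rewrite !addr_ge0// divr_ge0// sqr_ge0.
have h2 x : 0 <= quad (m ^+ 2) 0 1 x.
  by rewrite /quad mul0r addr0 mul1r addr_ge0// sqr_ge0.
move=> /(_ h1 h2) h; suff: 1 + m ^+ 2 / 2 + m * e1 + 1 * e2 <=
  1 + (m ^+ 2 + 0 * e1 + 1 * e2) by lra.
apply: h => x; rewrite normal_pdf01E// -lerBlDr -mulrBl mulrC ler_wpM2l//.
  exact: normal_pdf_ge0.
set u := _ - _ / _; have := expR_ge1Dx u; apply: le_trans.
by rewrite le_eqVlt; apply/orP; left; apply/eqP; rewrite /u /quad; field.
Qed.

Let e1E : e1 = 0.
Proof.
have h1 := e1_le e1; have h2 : 0 <= e1 ^+ 2 by exact: sqr_ge0.
by apply/eqP; rewrite -sqrf_eq0; apply/eqP; lra.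
Qed.

(** The same comparison for a change of scale; letting [s] tend to 1 from both sides gives
    [e2 = 1]. *)
Let e2_le s : 0 < s -> 1 + e2 / 2 <= s + e2 / (s ^+ 2 * 2).
Proof.
move=> s0.
have s20 : 0 < s ^+ 2 by rewrite exprn_gt0.
have := @normal_compare 0 s s 1 0 2^-1 0 0 (s ^+ 2 * 2)^-1 (ltW s0).
have h1 x : 0 <= quad 1 0 2^-1 x.
  by rewrite /quad mul0r addr0 addr_ge0// mulr_ge0// sqr_ge0.
have h2 x : 0 <= quad 0 0 (s ^+ 2 * 2)^-1 x.
  by rewrite /quad mul0r !add0r mulr_ge0 ?sqr_ge0// invr_ge0 mulr_ge0// ltW.
move=> /(_ h1 h2) h; suff: 1 + 0 * e1 + 2^-1 * e2 <=
  s + (0 + 0 * e1 + (s ^+ 2 * 2)^-1 * e2) by lra.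
apply: h => x; rewrite normal_pdf01E// -lerBlDr -mulrBl mulrC ler_wpM2l//.
  exact: normal_pdf_ge0.
set u := _ - _ / _; have := expR_ge1Dx u; apply: le_trans.
rewrite le_eqVlt; apply/orP; left; apply/eqP; rewrite /u /quad; field.
by rewrite gt_eqF.
Qed.

Let e2E : e2 = 1.
Proof.
apply/eqP; rewrite eq_le; apply/andP; split; rewrite leNgt; apply/negP => h.
- have s0 : 0 < (1 + e2) / 2 by lra.
  have := e2_le s0; set s := (1 + e2) / 2 in s0 *.
  rewrite -subr_ge0 => /(mulr_ge0 (ltW (exprn_gt0 2 s0))).
  have -> : s ^+ 2 * (s + e2 / (s ^+ 2 * 2) - (1 + e2 / 2)) =
     (s - 1) * (s ^+ 2 - e2 * (s + 1) / 2).
    by field; rewrite gt_eqF.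
  rewrite /s; nra.
- have s0 : 0 < (1 + e2) / 2.
    by rewrite divr_gt0// ltr_wpDr// /e2 Rintegral_ge0// => x _; exact: sqr_ge0.
  have := e2_le s0; set s := (1 + e2) / 2 in s0 *.
  rewrite -subr_ge0 => /(mulr_ge0 (ltW (exprn_gt0 2 s0))).
  have -> : s ^+ 2 * (s + e2 / (s ^+ 2 * 2) - (1 + e2 / 2)) =
     (s - 1) * (s ^+ 2 - e2 * (s + 1) / 2).
    by field; rewrite gt_eqF.
  rewrite /s; nra.
Qed.

(** By Cauchy-Schwarz this controls every [(b x + c (x^2 - 1))^2], see [sum_sq_le]. *)
Let hump (x : R) : R := x ^+ 2 + (x ^+ 2 - 1) ^+ 2.

Let hump_ge0 x : 0 <= hump x. Proof. by rewrite addr_ge0 ?sqr_ge0. Qed.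

Let measurable_hump : measurable_fun setT hump.
Proof.
have m2 : measurable_fun setT (fun x : R => x ^+ 2) by exact: measurable_funX.
by apply: measurable_funD => //; apply: measurable_funX; exact: measurable_funB.
Qed.

Let hump_le x : hump x <= 1 + x ^+ 4.
Proof. by rewrite /hump; have := sqr_ge0 x; rewrite -[4%N]/(2 * 2)%N exprM; nra. Qed.

Let hump_sqr_le x : hump x ^+ 2 <= 2 * (1 + x ^+ 8).
Proof.
have h0 := hump_ge0 x; have h1 := hump_le x.
have : hump x ^+ 2 <= (1 + x ^+ 4) ^+ 2 by rewrite lerXn2r ?nnegrE// (le_trans h0).
by rewrite -[8%N]/(4 * 2)%N exprM; have := sqr_ge0 (1 - x ^+ 4); nra.
Qed.

Let hump_le8 x : hump x <= 2 * (1 + x ^+ 8).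
Proof.
apply: (le_trans (hump_le x)).
by rewrite -[8%N]/(4 * 2)%N exprM; have := sqr_ge0 (1 - x ^+ 4); nra.
Qed.

Let quad_hump_le (f : R -> R) a b c d e : measurable_fun setT f ->
  (forall x, 0 <= f x) -> 0 <= d -> 0 <= e ->
  (forall x, f x <= a + b * x + c * (x ^+ 2 - 1) + d * hump x + e * hump x ^+ 2) ->
  (\int[nu]_x (f x)%:E <=
   (a + d * (\int[nu]_x hump x) + e * (\int[nu]_x hump x ^+ 2))%R%:E)%E.
Proof.
move=> mf f0 d0 e0 fle.
have ih : nu.-integrable setT (EFin \o hump).
  apply: (@normal_integrable _ 2); first exact: measurable_hump.
  by move=> x; rewrite ger0_norm ?hump_ge0// hump_le8.
have ih2 : nu.-integrable setT (EFin \o (fun x => hump x ^+ 2)).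
  apply: (@normal_integrable _ 2).
    by apply: measurable_funX; exact: measurable_hump.
  by move=> x; rewrite ger0_norm ?sqr_ge0// hump_sqr_le.
have iq : nu.-integrable setT (EFin \o quad (a - c) b c).
  apply: (@normal_integrable _ (`|a - c| + `|b| + `|c|)); first exact: measurable_quad.
  move=> x; rewrite /quad (le_trans (ler_normD _ _))//.
  have x8 : 0 <= x ^+ 8 by rewrite exprn_even_ge0.
  rewrite !mulrDl lerD// ?(le_trans (ler_normD _ _))// ?lerD// ?normrM.
  - by rewrite ler_peMr// lerDl.
  - by rewrite ler_wpM2l// -[`|x|]expr1 pow8.
  - by apply: ler_wpM2l => //; exact: (@pow8 x 2 isT).
have -> : a = a - c + b * e1 + c * e2 by rewrite e1E e2E; ring.
rewrite 2!EFinD -normal_integral_quad EFinM [X in (_ + X)%E]EFinM.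
rewrite /Rintegral !fineK ?integrable_fin_num//.
rewrite -!integralZl// -integralD//; last exact: integrableZl.
have iqh := integrableD measurableT iq (integrableZl measurableT d ih).
rewrite -integralD//; last exact: integrableZl.
have mqh : measurable_fun [set: measurableTypeR R]
    (fun x => (quad (a - c) b c x + d * hump x + e * hump x ^+ 2)%:E).
  apply/measurable_EFinP; apply: measurable_funD; last first.
    by apply: measurable_funM => //; apply: measurable_funX; exact: measurable_hump.
  apply: measurable_funD; first exact: measurable_quad.
  by apply: measurable_funM => //; exact: measurable_hump.
apply: ge0_le_integral => //.
- by move=> x _; rewrite lee_fin.
- exact/measurable_EFinP.
- move=> x _; rewrite -!EFinM -!EFinD lee_fin (le_trans (fle x))//.
  by rewrite /quad le_eqVlt; apply/orP; left; apply/eqP; ring.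
Qed.

Let sum_sq_le b c x : (b * x + c * (x ^+ 2 - 1)) ^+ 2 <= (b ^+ 2 + c ^+ 2) * hump x.
Proof. by rewrite /hump; have := sqr_ge0 (b * (x ^+ 2 - 1) - c * x); nra. Qed.

(** Only the centering of [X] and of [X^2 - 1] and the finiteness of the eighth moment matter:
    in the fourth power the term of odd degree [4 a^3 (b X + c (X^2 - 1))] has mean 0, and the
    cubic one is split by [2 a y^3 <= a^2 y^2 + y^4]. The constant is uniform over probability
    spaces. *)
Lemma std_normal_poly_bounds : exists2 C : R, 0 <= C &
  forall d (T : measurableType d) (P : probability T R) (X : {RV P >-> R}),
  standard_normal X -> forall a b c : R,
  (\int[P]_w ((a + b * X w + c * (X w ^+ 2 - 1)) ^+ 2)%:E <=
     (a ^+ 2 + C * (b ^+ 2 + c ^+ 2))%:E)%E /\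
  (\int[P]_w ((a + b * X w + c * (X w ^+ 2 - 1)) ^+ 4)%:E <=
     (a ^+ 4 + C * a ^+ 2 * (b ^+ 2 + c ^+ 2) + C * (b ^+ 2 + c ^+ 2) ^+ 2)%:E)%E.
Proof.
set k1 := (\int[nu]_x hump x)%R; set k2 := (\int[nu]_x hump x ^+ 2)%R.
have k10 : 0 <= k1 by exact: Rintegral_ge0.
have k20 : 0 <= k2 by apply: Rintegral_ge0 => x _; exact: sqr_ge0.
exists (8 * k1 + 3 * k2); first by rewrite addr_ge0 ?mulr_ge0.
move=> d T P X sX a b c.
have transfer (f : R -> R) : measurable_fun setT f -> (forall x, 0 <= f x) ->
    (\int[P]_w (f (X w))%:E = \int[nu]_x (f x)%:E)%E.
  move=> mf f0.
  have mX : measurable_fun setT (X : T -> measurableTypeR R).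
    by have mX0 : measurable_fun setT X by []; move=> mT A mA; exact: (mX0 mT A mA).
  have mfE : measurable_fun [set: measurableTypeR R] (EFin \o f).
    exact/measurable_EFinP.
  have <- := @ge0_integral_pushforward _ _ T (measurableTypeR R) R X mX P setT _
    measurableT mfE (fun x _ => f0 x).
  by apply: eq_measure_integral => A mA _; exact: sX.
set s := b ^+ 2 + c ^+ 2.
have s0 : 0 <= s by rewrite addr_ge0// sqr_ge0.
have mf k : measurable_fun setT (fun x : R => (a + b * x + c * (x ^+ 2 - 1)) ^+ k).
  apply: measurable_funX; apply: measurable_funD.
    by apply: measurable_funD => //; exact: measurable_funM.
  apply: measurable_funM => //; apply: measurable_funB => //.
split.
- rewrite (transfer (fun x => (a + b * x + c * (x ^+ 2 - 1)) ^+ 2))//; last first.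
    by move=> x; exact: sqr_ge0.
  apply: (le_trans (@quad_hump_le _ (a ^+ 2) (2 * a * b) (2 * a * c) s 0
    (mf 2%N) _ s0 (lexx 0) _)).
  + by move=> x; exact: sqr_ge0.
  + by move=> x; have := sum_sq_le b c x; rewrite -/s; lra.
  + have p1 : 0 <= s * k1 by rewrite mulr_ge0.
    have p2 : 0 <= s * k2 by rewrite mulr_ge0.
    rewrite -/k1 -/k2 lee_fin; nra.
- rewrite (transfer (fun x => (a + b * x + c * (x ^+ 2 - 1)) ^+ 4))//; last first.
    by move=> x; rewrite exprn_even_ge0.
  apply: (le_trans (@quad_hump_le _ (a ^+ 4) (4 * a ^+ 3 * b) (4 * a ^+ 3 * c)
    (8 * a ^+ 2 * s) (3 * s ^+ 2) (mf 4%N) _ _ _ _)).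
  + by move=> x; rewrite exprn_even_ge0.
  + by rewrite mulr_ge0// mulr_ge0// sqr_ge0.
  + by rewrite mulr_ge0// sqr_ge0.
  + move=> x; have := sum_sq_le b c x; rewrite -/s.
    rewrite -addrA; set y := b * x + _; set h := s * _ => yh.
    have h0 : 0 <= h by rewrite mulr_ge0.
    have y2 : 0 <= y ^+ 2 by exact: sqr_ge0.
    have y4 : y ^+ 4 <= h ^+ 2 by rewrite -[4%N]/(2 * 2)%N exprM lerXn2r ?nnegrE.
    have a2 : 0 <= a ^+ 2 by exact: sqr_ge0.
    have -> : a ^+ 4 + 4 * a ^+ 3 * b * x + 4 * a ^+ 3 * c * (x ^+ 2 - 1) +
        8 * a ^+ 2 * s * hump x + 3 * s ^+ 2 * hump x ^+ 2 =
        a ^+ 4 + 4 * a ^+ 3 * y + 8 * a ^+ 2 * h + 3 * h ^+ 2.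
      by rewrite /y /h; ring.
    have : a ^+ 2 * y ^+ 2 <= a ^+ 2 * h by rewrite ler_wpM2l.
    have := sqr_ge0 (a * y - y ^+ 2).
    have -> : (a + y) ^+ 4 = a ^+ 4 + 4 * a ^+ 3 * y + 6 * (a ^+ 2 * y ^+ 2) +
       4 * (a * y ^+ 3) + y ^+ 4 by ring.
    have -> : (a * y - y ^+ 2) ^+ 2 = a ^+ 2 * y ^+ 2 - 2 * (a * y ^+ 3) + y ^+ 4 by ring.
    lra.
  + have p1 : 0 <= a ^+ 2 * s * k2 by rewrite mulr_ge0// mulr_ge0// sqr_ge0.
    have p2 : 0 <= s ^+ 2 * k1 by rewrite mulr_ge0// sqr_ge0.
    rewrite -/k1 -/k2 lee_fin; nra.
Qed.
End normal_expectation.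

(** * Integration over an independent copy *)

Section independence_product.
Context d (T : measurableType d) (R : realType) (P : probability T R).

(** Both sides are finite measures in [A] which agree on a pi-system. *)
Lemma independence_extension (G : set (set T)) (B : set T) :
  G `<=` measurable -> setI_closed G -> G setT -> measurable B ->
  (forall A, G A -> P (A `&` B) = (P A * P B)%E) ->
  forall A, <<s G >> A -> P (A `&` B) = (P A * P B)%E.
Proof.
move=> Gm GI GT mB GB A GA.
have PBfin : P B \is a fin_num by exact: fin_num_measure.
have PB0 : 0 <= fine (P B) by exact: fine_ge0.
pose m2 := mscale (NngNum PB0) P.
have E C : m2 C = (P C * P B)%E by rewrite /m2 /mscale/= fineK// muleC.
rewrite -E.
apply: (@g_sigma_algebra_measure_unique _ R T G Gm (fun=> setT) _ _
  (mrestr P mB) (mscale (NngNum PB0) P)) => //.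
- by apply/seteqP; split => // w _; exists 0%N.
- by move=> C GC; rewrite [RHS](E C) -GB.
- by move=> _; rewrite /= /mrestr setTI ltey_eq PBfin.
Qed.

Variables (I : finType) (X : I -> {RV P >-> R}).

Definition gen_of (J : {set I}) : set (set T) :=
  \bigcup_(j in [set` J]) preimage_set_system setT (X j) measurable.

Definition pi_of (J : {set I}) : set (set T) :=
  [set A | exists2 E : I -> set T,
    (forall j, j \in J -> preimage_set_system setT (X j) measurable (E j)) &
    A = \bigcap_(j in [set` J]) E j].

Lemma preimage_measurable j A :
  preimage_set_system setT (X j) measurable A -> measurable A.
Proof.
by move=> [B mB <-]; have mX : measurable_fun setT (X j) by []; exact: mX.
Qed.

Lemma gen_of_measurable J : gen_of J `<=` measurable.
Proof. by move=> A [j _]; exact: preimage_measurable. Qed.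

Lemma pi_of_measurable J : pi_of J `<=` measurable.
Proof.
move=> A [E mE ->]; apply: fin_bigcap_measurable => // j /= jJ.
exact: (preimage_measurable (mE _ jJ)).
Qed.

Lemma preimageT_system j : preimage_set_system setT (X j) measurable setT.
Proof. by exists setT => //; rewrite preimage_setT setTI. Qed.

Lemma pi_ofT J : pi_of J setT.
Proof.
by exists (fun=> setT); [move=> j _; exact: preimageT_system|rewrite bigcapT].
Qed.

Lemma pi_ofI J : setI_closed (pi_of J).
Proof.
move=> A B [E mE ->] [F mF ->]; exists (fun j => E j `&` F j).
  move=> j jJ; have [C mC <-] := mE j jJ; have [D mD <-] := mF j jJ.
  exists (C `&` D); first exact: measurableI.
  by rewrite preimage_setI setIACA setIid.
by rewrite bigcapI.
Qed.

Lemma gen_of_sub_pi J : gen_of J `<=` pi_of J.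
Proof.
move=> A [j /= jJ jA]; exists (fun i => if i == j then A else setT).
  by move=> i iJ; case: eqVneq => [->//|_]; exact: preimageT_system.
apply/seteqP; split => [w Aw i _ /=|w /(_ j jJ)/=]; last by rewrite eqxx.
by case: ifP.
Qed.

(** The hypothesis speaks of single variables; finite intersections of events on the
    variables of [J1], respectively [J2], are pi-systems generating the two sigma-algebras, and
    the extension is made on one side at a time. *)
Lemma independent_sigma (J1 J2 : {set I}) (A B : set T) :
  independent_vars X -> J1 :&: J2 = finset.set0 ->
  <<s gen_of J1 >> A -> <<s gen_of J2 >> B -> P (A `&` B) = (P A * P B)%E.
Proof.
move=> iX dJ /(sub_sigma_algebra2 (@gen_of_sub_pi J1)) sA.
move=> /(sub_sigma_algebra2 (@gen_of_sub_pi J2)) sB.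
have mpi J C : <<s pi_of J >> C -> measurable C.
  by apply: smallest_sub; [exact: sigma_algebra_measurable|exact: pi_of_measurable].
have pp C D : pi_of J1 C -> pi_of J2 D -> P (C `&` D) = (P C * P D)%E.
  move=> [E mE ->] [F mF ->].
  pose G i := if i \in J1 then E i else F i.
  have GJ1 i : i \in J1 -> G i = E i by rewrite /G => ->.
  have GJ2 i : i \in J2 -> G i = F i.
    move=> iJ2; rewrite /G; case: ifP => // i1.
    by have := finset.in_set0 i; rewrite -dJ finset.in_setI i1 iJ2.
  have -> : \bigcap_(j in [set` J1]) E j = \bigcap_(j in [set` J1]) G j.
    by apply: eq_bigcapr => i /= iJ; rewrite GJ1.
  have -> : \bigcap_(j in [set` J2]) F j = \bigcap_(j in [set` J2]) G j.
    by apply: eq_bigcapr => i /= iJ; rewrite GJ2.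
  rewrite -bigcap_setU (_ : [set` J1] `|` [set` J2] = [set` J1 :|: J2]); last first.
    by apply/seteqP; split => i /=; rewrite inE => /orP.
  have mG i : i \in J1 :|: J2 -> preimage_set_system setT (X i) measurable (G i).
    by rewrite inE => /orP[i1|i2]; [rewrite GJ1//; exact: mE|rewrite GJ2//; exact: mF].
  rewrite (iX _ _ mG) (iX J1 G) ?(iX J2 G).
  - rewrite (eq_bigl [predU J1 & J2]) ?bigU//.
    + by rewrite -setI_eq0 dJ.
    + by move=> i; rewrite !inE.
  - by move=> i i2; apply: mG; rewrite inE i2 orbT.
  - by move=> i i1; apply: mG; rewrite inE i1.
have sAB C : pi_of J2 C -> P (A `&` C) = (P A * P C)%E.
  move=> pC; apply: (@independence_extension (pi_of J1)) => //.
  - exact: pi_of_measurable.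
  - exact: pi_ofI.
  - exact: pi_ofT.
  - exact: pi_of_measurable pC.
  - by move=> D pD; exact: pp.
rewrite setIC muleC; apply: (@independence_extension (pi_of J2)) => //.
- exact: pi_of_measurable.
- exact: pi_ofI.
- exact: pi_ofT.
- exact: mpi sA.
- by move=> C pC; rewrite setIC muleC; exact: sAB.
Qed.

(** The carrier stays [T]; only the sigma-algebra is coarser. Two independent groups of
    variables are then two maps from [T] to such spaces, and the joint law is a product
    measure on the square of [T]. *)
Definition sub_space (J : {set I}) := g_sigma_algebraType (gen_of J).

Let measurable_sub_id J : measurable_fun setT (idfun : T -> sub_space J).
Proof.
move=> _ A sA; rewrite setTI preimage_id.
by apply: smallest_sub sA; [exact: sigma_algebra_measurable|exact: gen_of_measurable].
Qed.

Let sub_id J : {mfun T >-> sub_space J} :=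
  HB.pack (idfun : T -> sub_space J)
    (isMeasurableFun.Build _ _ _ _ _ (@measurable_sub_id J)).

Lemma measurable_integral_copy (J1 J2 : {set I}) (F : T -> T -> \bar R) :
  measurable_fun setT (fun z : sub_space J1 * sub_space J2 => F z.1 z.2) ->
  (forall w w', 0 <= F w w')%E ->
  measurable_fun setT (fun w => \int[P]_w' F w w')%E.
Proof.
move=> mF F0.
pose P2 : probability (sub_space J2) R := distribution P (sub_id J2).
pose G (z : sub_space J1 * sub_space J2) := F z.1 z.2.
have G0 z : (0 <= G z)%E by exact: F0.
have mGF := @measurable_fun_fubini_tonelli_F _ _ _ _ _ P2 G mF G0.
apply: (eq_measurable_fun (fubini_F P2 G \o (idfun : T -> sub_space J1))); last first.
  exact: (measurableT_comp mGF (@measurable_sub_id J1)).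
move=> w _; rewrite /= /fubini_F; apply/esym.
rewrite (@ge0_integral_distribution _ _ _ _ _ P (sub_id J2) (fun y => G (w, y)))//.
by apply: (measurableT_comp mF); exact: measurable_fun_pair.
Qed.

(** The diagonal map sends [P] to the product measure, by independence; then Tonelli. *)
Lemma integral_independent_copy (J1 J2 : {set I}) (F : T -> T -> \bar R) :
  independent_vars X -> J1 :&: J2 = finset.set0 ->
  measurable_fun setT (fun z : sub_space J1 * sub_space J2 => F z.1 z.2) ->
  (forall w w', 0 <= F w w')%E ->
  (\int[P]_w F w w = \int[P]_w \int[P]_w' F w w')%E.
Proof.
move=> iX dJ mF F0.
pose P1 : probability (sub_space J1) R := distribution P (sub_id J1).
pose P2 : probability (sub_space J2) R := distribution P (sub_id J2).
have mdg : measurable_fun setT (fun w : T => ((w, w) : sub_space J1 * sub_space J2)).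
  by apply: measurable_fun_pair; exact: measurable_sub_id.
pose dg : {mfun T >-> (sub_space J1 * sub_space J2)%type} :=
  HB.pack (fun w : T => ((w, w) : sub_space J1 * sub_space J2))
    (isMeasurableFun.Build _ _ _ _ _ mdg).
have prodE : forall A, measurable A -> (P1 \x P2)%E A = distribution P dg A.
  apply: product_measure_unique => A B mA mB.
  transitivity (P (A `&` B)); last exact: (independent_sigma iX dJ mA mB).
  by congr (P _); apply/seteqP; split => w.
pose G (z : sub_space J1 * sub_space J2) := F z.1 z.2.
have G0 z : (0 <= G z)%E by exact: F0.
transitivity (\int[distribution P dg]_z G z)%E.
  by rewrite ge0_integral_distribution.
transitivity (\int[P1 \x P2]_z G z)%E.
  by apply: eq_measure_integral => A mA _; exact/esym/prodE.
rewrite fubini_tonelli1//.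
have mGF := @measurable_fun_fubini_tonelli_F _ _ _ _ _ P2 G mF G0.
rewrite (ge0_integral_distribution (sub_id J1) mGF); last first.
  by move=> w; exact: integral_ge0.
apply: eq_integral => w _; rewrite /= /fubini_F.
rewrite (@ge0_integral_distribution _ _ _ _ _ P (sub_id J2) (fun y => G (w, y)))//.
by apply: (measurableT_comp mF); exact: measurable_fun_pair.
Qed.
End independence_product.

Section mean_le.
Context d (T : measurableType d) (R : realType) (P : probability T R).
Implicit Types (f g : T -> R) (a b c : R).

(** Measurability and sign are part of the predicate, so that upper bounds on means can be
    added and scaled without side conditions. *)
Definition mean_le f c :=
  [/\ measurable_fun setT f, forall w, 0 <= f w &
      (\int[P]_w (f w)%:E <= c%:E)%E].

Lemma mean_le_weak f a b : a <= b -> mean_le f a -> mean_le f b.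
Proof. by move=> ab [mf f0 fa]; split => //; rewrite (le_trans fa)// lee_fin. Qed.

Lemma mean_le_mono f g c : measurable_fun setT f -> (forall w, 0 <= f w) ->
  (forall w, f w <= g w) -> mean_le g c -> mean_le f c.
Proof.
move=> mf f0 fg [mg g0 gc]; split => //; rewrite (le_trans _ gc)//.
apply: ge0_le_integral => //.
- by move=> w _; rewrite lee_fin.
- exact/measurable_EFinP.
- exact/measurable_EFinP.
- by move=> w _; rewrite lee_fin.
Qed.

Lemma mean_leD f g a b : mean_le f a -> mean_le g b ->
  mean_le (fun w => f w + g w) (a + b).
Proof.
move=> [mf f0 fa] [mg g0 gb]; split; first exact: measurable_funD.
  by move=> w; rewrite addr_ge0.
under eq_integral do rewrite EFinD.
rewrite ge0_integralD//; first by rewrite EFinD leeD.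
- by move=> w _; rewrite lee_fin.
- exact/measurable_EFinP.
- by move=> w _; rewrite lee_fin.
- exact/measurable_EFinP.
Qed.

Lemma mean_leZ f a c : 0 <= a -> mean_le f c -> mean_le (fun w => a * f w) (a * c).
Proof.
move=> a0 [mf f0 fc]; split; first exact: measurable_funM.
  by move=> w; rewrite mulr_ge0.
under eq_integral do rewrite EFinM.
rewrite ge0_integralZl//; first by rewrite EFinM lee_wpmul2l.
- exact/measurable_EFinP.
- by move=> w _; rewrite lee_fin.
Qed.

Lemma mean_le_cst c : 0 <= c -> mean_le (cst c) c.
Proof. move=> c0; split=> //.
by rewrite (integral_cst P measurableT c%:E) [X in (_ * X)%E]probability_setT mule1. Qed.

Lemma mean_le_sum (I : Type) (r : seq I) (Q : pred I) (F : I -> T -> R)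
    (c : I -> R) : (forall i, Q i -> mean_le (F i) (c i)) ->
  mean_le (fun w => \sum_(i <- r | Q i) F i w) (\sum_(i <- r | Q i) c i).
Proof.
move=> Fc; elim: r => [|i r ih].
  rewrite big_nil [X in mean_le X](_ : _ = cst 0); first exact: mean_le_cst.
  by apply/funext => w; rewrite big_nil.
rewrite big_cons.
have -> : (fun w => \sum_(j <- i :: r | Q j) F j w) =
    (fun w => if Q i then F i w + \sum_(j <- r | Q j) F j w
              else \sum_(j <- r | Q j) F j w).
  by apply/funext => w; rewrite big_cons.
by case: ifPn => // Qi; apply: mean_leD => //; exact: Fc.
Qed.

End mean_le.

Section independent_copy.
Context d (T : measurableType d) (R : realType) (P : probability T R).
Variables (I : finType) (X : I -> {RV P >-> R}).
Implicit Types J : {set I}.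

Definition meas_on J (f : T -> R) := measurable_fun setT (f : sub_space X J -> R).

Lemma meas_onX J j : j \in J -> meas_on J (X j).
Proof.
move=> jJ mT A mA; apply: sub_sigma_algebra; exists j => //; exists A => //.
Qed.

Lemma meas_on_measurable J f : meas_on J f -> measurable_fun setT f.
Proof.
move=> mf mT A mA; have := mf measurableT A mA.
by apply: smallest_sub; [exact: sigma_algebra_measurable|exact: gen_of_measurable].
Qed.

Definition meas_on2 J J' (F : T -> T -> R) :=
  measurable_fun setT (fun z : sub_space X J * sub_space X J' => F z.1 z.2).

Lemma meas_on2_l J J' f : meas_on J f -> meas_on2 J J' (fun w _ => f w).
Proof. by move=> mf; exact: (measurableT_comp mf measurable_fst). Qed.

Lemma meas_on2_r J J' f : meas_on J' f -> meas_on2 J J' (fun _ w' => f w').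
Proof. by move=> mf; exact: (measurableT_comp mf measurable_snd). Qed.

Lemma meas_on2_diag J J' F : meas_on2 J J' F -> measurable_fun setT (fun w => F w w).
Proof.
move=> mF; pose h w := ((w, w) : sub_space X J * sub_space X J').
have mh : measurable_fun [set: T] h.
  apply: measurable_fun_pair => _ A mA; rewrite setTI preimage_id.
    by apply: smallest_sub mA; [exact: sigma_algebra_measurable|exact: gen_of_measurable].
  by apply: smallest_sub mA; [exact: sigma_algebra_measurable|exact: gen_of_measurable].
exact: (measurableT_comp mF mh).
Qed.

(** The form in which conditioning is used: to bound the mean of [F w w], it is enough to
    bound the mean over the second argument, a fresh copy of the variables of [J'], with the
    first one frozen. *)
Lemma mean_le_copy J J' F h c : independent_vars X -> J :&: J' = finset.set0 ->
  meas_on2 J J' F -> (forall w w', 0 <= F w w') ->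
  (forall w, (\int[P]_w' (F w w')%:E <= (h w)%:E)%E) ->
  mean_le P h c -> mean_le P (fun w => F w w) c.
Proof.
move=> iX JJ' mF F0 Fh [mh h0 hc]; split => //; first exact: meas_on2_diag mF.
pose FE w w' := (F w w')%:E.
have FE0 w w' : (0 <= FE w w')%E by rewrite lee_fin.
have mFE : measurable_fun setT (fun z : sub_space X J * sub_space X J' => FE z.1 z.2).
  exact/measurable_EFinP.
rewrite (integral_independent_copy iX JJ' mFE FE0).
rewrite (le_trans _ hc)//; apply: ge0_le_integral => //.
- by move=> w _; apply: integral_ge0.
- exact: measurable_integral_copy mFE FE0.
- exact/measurable_EFinP.
- by move=> w _; exact: Fh.
Qed.

Variable C : R.
Hypothesis C0 : 0 <= C.
Hypothesis iX : independent_vars X.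
Hypothesis X2 : forall j (a b c : R),
  (\int[P]_w ((a + b * X j w + c * (X j w ^+ 2 - 1)) ^+ 2)%:E <=
     (a ^+ 2 + C * (b ^+ 2 + c ^+ 2))%:E)%E.
Hypothesis X4 : forall j (a b c : R),
  (\int[P]_w ((a + b * X j w + c * (X j w ^+ 2 - 1)) ^+ 4)%:E <=
     (a ^+ 4 + C * a ^+ 2 * (b ^+ 2 + c ^+ 2) + C * (b ^+ 2 + c ^+ 2) ^+ 2)%:E)%E.

Lemma meas_poly J j (D L : T -> R) q k : meas_on J D -> meas_on J L ->
  meas_on2 J [set j]%SET
    (fun w w' => (D w + L w * X j w' + q * (X j w' ^+ 2 - 1)) ^+ k).
Proof.
move=> mD mL.
have mX : meas_on [set j]%SET (X j) by apply: meas_onX; rewrite finset.inE.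
have := @meas_on2_l _ [set j]%SET _ mD; have := @meas_on2_l _ [set j]%SET _ mL.
have := @meas_on2_r J _ _ mX; rewrite /meas_on2 => m1 m2 m3.
apply: measurable_funX; apply: measurable_funD.
  by apply: measurable_funD => //; exact: measurable_funM.
apply: measurable_funM => //; apply: measurable_funB => //.
exact: measurable_funX.
Qed.

Lemma disjoint_set1 J j : j \notin J -> J :&: [set j]%SET = finset.set0.
Proof.
move=> jJ; apply/eqP; rewrite finset.setI_eq0 disjoint_sym.
by rewrite (eq_disjoint1 (x := j))// => i; rewrite !inE.
Qed.

(** One more coordinate [X j], independent of [D] and [L]. *)
Lemma mean_step2 J j D L q (a b : R) : j \notin J -> meas_on J D -> meas_on J L ->
  mean_le P (fun w => D w ^+ 2) a -> mean_le P (fun w => L w ^+ 2) b ->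
  mean_le P (fun w => (D w + L w * X j w + q * (X j w ^+ 2 - 1)) ^+ 2)
    (a + C * (b + q ^+ 2)).
Proof.
move=> jJ mD mL Da Lb.
pose F w w' := (D w + L w * X j w' + q * (X j w' ^+ 2 - 1)) ^+ 2.
have mF : meas_on2 J [set j]%SET F by exact: meas_poly.
apply: (@mean_le_copy J [set j]%SET F (fun w => D w ^+ 2 + C * (L w ^+ 2 + q ^+ 2)) _ iX
  (disjoint_set1 jJ) mF).
- by move=> w w'; exact: sqr_ge0.
- by move=> w; exact: X2.
- apply: mean_leD => //; apply: mean_leZ => //; apply: mean_leD => //.
  by apply: mean_le_cst; exact: sqr_ge0.
Qed.

(** The parameter [e] splits the mixed term [D^2 L^2]: the factor [1 + e] on the fourth moment
    is harmless if the product of these factors over the steps is bounded. *)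
Lemma mean_step4 J j D L q (a b e : R) : j \notin J -> meas_on J D -> meas_on J L ->
  0 < e ->
  mean_le P (fun w => D w ^+ 4) a -> mean_le P (fun w => (L w ^+ 2 + q ^+ 2) ^+ 2) b ->
  mean_le P (fun w => (D w + L w * X j w + q * (X j w ^+ 2 - 1)) ^+ 4)
    ((1 + e) * a + (C ^+ 2 / (4 * e) + C) * b).
Proof.
move=> jJ mD mL e0 Da Lb.
pose F w w' := (D w + L w * X j w' + q * (X j w' ^+ 2 - 1)) ^+ 4.
have mF : meas_on2 J [set j]%SET F by exact: meas_poly.
apply: (@mean_le_copy J [set j]%SET F (fun w => (1 + e) * D w ^+ 4 +
     (C ^+ 2 / (4 * e) + C) * (L w ^+ 2 + q ^+ 2) ^+ 2) _ iX
  (disjoint_set1 jJ) mF).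
- by move=> w w'; rewrite exprn_even_ge0.
- move=> w; apply: (le_trans (X4 _ _ _ _)); rewrite lee_fin.
  set r := _ + q ^+ 2; set x := D w.
  have -> : x ^+ 4 = (x ^+ 2) ^+ 2 by rewrite -exprM.
  have : 0 <= e * (x ^+ 2 - C / (2 * e) * r) ^+ 2 by rewrite mulr_ge0 ?sqr_ge0// ltW.
  have -> : e * (x ^+ 2 - C / (2 * e) * r) ^+ 2 =
    e * (x ^+ 2) ^+ 2 - C * x ^+ 2 * r + C ^+ 2 / (4 * e) * r ^+ 2.
    by field; rewrite gt_eqF.
  lra.
- apply: mean_leD; apply: mean_leZ => //; first by rewrite addr_ge0// ltW.
  by rewrite addr_ge0// divr_ge0 ?sqr_ge0// mulr_ge0// ltW.
Qed.

End independent_copy.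

(** * Moments of Gaussian quadratic forms *)

Lemma measurable_sum_cond d (T : measurableType d) (R : realType) (I : Type)
    (r : seq I) (Q : pred I) (F : I -> T -> R) :
  (forall i, Q i -> measurable_fun setT (F i)) ->
  measurable_fun setT (fun w => \sum_(i <- r | Q i) F i w).
Proof.
move=> mF; elim: r => [|i r ih].
  by under eq_fun do rewrite big_nil; exact: measurable_cst.
have -> : (fun w => \sum_(j <- i :: r | Q j) F j w) =
    (fun w => if Q i then F i w + \sum_(j <- r | Q j) F j w
              else \sum_(j <- r | Q j) F j w).
  by apply/funext => w; rewrite big_cons.
by case Qi : (Q i) => //; apply: measurable_funD => //; exact: mF.
Qed.

Section quadratic_forms.
Context d (T : measurableType d) (R : realType) (P : probability T R).
Variables (I : finType) (X : I -> {RV P >-> R}).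
Variables (p : nat) (idx : 'I_p -> I).
Hypothesis idx_inj : injective idx.
Variable C : R.
Hypothesis C0 : 0 <= C.
Hypothesis iX : independent_vars X.
Hypothesis X2 : forall j (a b c : R),
  (\int[P]_w ((a + b * X j w + c * (X j w ^+ 2 - 1)) ^+ 2)%:E <=
     (a ^+ 2 + C * (b ^+ 2 + c ^+ 2))%:E)%E.
Hypothesis X4 : forall j (a b c : R),
  (\int[P]_w ((a + b * X j w + c * (X j w ^+ 2 - 1)) ^+ 4)%:E <=
     (a ^+ 4 + C * a ^+ 2 * (b ^+ 2 + c ^+ 2) + C * (b ^+ 2 + c ^+ 2) ^+ 2)%:E)%E.

Let z i w := X (idx i) w.
Let J m : {set I} := [set idx i | i : 'I_p & (i < m)%N]%SET.

Let JP (o : 'I_p) m : (idx o \in J m) = (o < m)%N.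
Proof.
apply/imsetP/idP => [[i]|om]; first by rewrite inE => im /idx_inj ->.
by exists o; rewrite ?inE.
Qed.

Let meas_z (o : 'I_p) m : (o < m)%N -> meas_on X (J m) (z o).
Proof. by move=> om; apply: meas_onX; rewrite JP. Qed.

(* Sums over a prefix of the coordinates, on which the induction runs. *)
Let sum_ltS (V : nmodType) (F : 'I_p -> V) (o : 'I_p) :
  \sum_(i < p | (i < o.+1)%N) F i = \sum_(i < p | (i < o)%N) F i + F o.
Proof.
rewrite (bigD1 o) ?ltnS//= addrC; congr (_ + _); apply: eq_bigl => i.
by rewrite ltnS -(inj_eq val_inj) andbC -ltn_neqAle.
Qed.

Let Lin (a : 'I_p -> R) m w := \sum_(i < p | (i < m)%N) a i * z i w.
Let sqn (a : 'I_p -> R) m := \sum_(i < p | (i < m)%N) a i ^+ 2.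

Let sqn_ge0 a m : 0 <= sqn a m.
Proof. by apply: sumr_ge0 => i _; exact: sqr_ge0. Qed.

Let meas_Lin a m : meas_on X (J m) (Lin a m).
Proof.
by apply: measurable_sum_cond => i im; apply: measurable_funM => //; exact: meas_z.
Qed.

Let Lin_step a (o : 'I_p) w : Lin a o.+1 w = Lin a o w + a o * z o w + 0 * (z o w ^+ 2 - 1).
Proof. by rewrite /Lin sum_ltS mul0r addr0. Qed.

Let Lin0 a w : Lin a 0 w = 0.
Proof. by rewrite /Lin big_pred0. Qed.

Let sqn0 a : sqn a 0 = 0. Proof. by rewrite /sqn big_pred0. Qed.

Let sqnS a (o : 'I_p) : sqn a o.+1 = sqn a o + a o ^+ 2.
Proof. exact: sum_ltS. Qed.

Let notinJ (o : 'I_p) : idx o \notin J o. Proof. by rewrite JP ltnn. Qed.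

Let mean_Lin2 a m : (m <= p)%N -> mean_le P (fun w => Lin a m w ^+ 2) (C * sqn a m).
Proof.
elim: m => [_|m ih mp].
  rewrite sqn0 mulr0; under [X in mean_le _ X]eq_fun do rewrite Lin0 expr0n.
  exact: mean_le_cst.
pose o : 'I_p := Ordinal mp; rewrite -[m.+1]/(o.+1) sqnS mulrDr.
under [X in mean_le _ X]eq_fun do rewrite Lin_step.
have mc : mean_le P (fun=> a o ^+ 2) (a o ^+ 2) by apply: mean_le_cst; exact: sqr_ge0.
apply: (@mean_le_weak _ _ _ _ _ (C * sqn a o + C * (a o ^+ 2 + 0 ^+ 2))).
  by rewrite expr0n addr0.
by apply: (@mean_step2 _ _ _ P _ X C C0 iX X2 (J o) (idx o) (Lin a o) (fun=> a o));
  [exact: notinJ|exact: meas_Lin|exact: measurable_cst|exact: ih (ltnW mp)|].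
Qed.

Let K4 := C ^+ 2 + C.

Let mean_Lin4 a m : (m <= p)%N ->
  mean_le P (fun w => Lin a m w ^+ 4) (K4 * sqn a m ^+ 2).
Proof.
elim: m => [_|m ih mp].
  rewrite sqn0 expr0n mulr0; under [X in mean_le _ X]eq_fun do rewrite Lin0 expr0n.
  exact: mean_le_cst.
pose o : 'I_p := Ordinal mp; rewrite -[m.+1]/(o.+1) sqnS.
under [X in mean_le _ X]eq_fun do rewrite Lin_step.
pose F w w' := (Lin a o w + a o * X (idx o) w' + 0 * (X (idx o) w' ^+ 2 - 1)) ^+ 4.
have mF : meas_on2 X (J o) [set idx o]%SET F.
  apply: (@meas_poly _ _ _ P _ X (J o) (idx o) (Lin a o) (fun=> a o) 0 4%N).
    exact: meas_Lin.
  exact: measurable_cst.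
apply: (@mean_le_copy _ _ _ P _ X (J o) [set idx o]%SET F
  (fun w => Lin a o w ^+ 4 + C * a o ^+ 2 * Lin a o w ^+ 2 + C * a o ^+ 4) _ iX
  (disjoint_set1 (notinJ o)) mF).
- by move=> w w'; rewrite exprn_even_ge0.
- move=> w; apply: (le_trans (X4 _ _ _ _)); rewrite lee_fin expr0n addr0 -exprM.
  by rewrite le_eqVlt; apply/orP; left; apply/eqP; ring.
- have a0 := sqr_ge0 (a o).
  have mo := ltnW mp.
  apply: (@mean_le_weak _ _ _ _ _ (K4 * sqn a o ^+ 2 + C * a o ^+ 2 * (C * sqn a o) + C * a o ^+ 4)).
    have s0 := sqn_ge0 a o.
    have -> : a o ^+ 4 = (a o ^+ 2) ^+ 2 by rewrite -exprM.
    have h1 : 0 <= C * (sqn a o * a o ^+ 2) by rewrite mulr_ge0// mulr_ge0.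
    have h2 : 0 <= C ^+ 2 * (sqn a o * a o ^+ 2) by rewrite mulr_ge0 ?sqr_ge0// mulr_ge0.
    have h3 : 0 <= C ^+ 2 * (a o ^+ 2) ^+ 2 by rewrite mulr_ge0 ?sqr_ge0.
    have h4 : 0 <= C * (a o ^+ 2) ^+ 2 by rewrite mulr_ge0 ?sqr_ge0.
    rewrite /K4; lra.
  apply: mean_leD; last first.
    by apply: mean_le_cst; rewrite mulr_ge0// exprn_even_ge0.
  by apply: mean_leD; [exact: ih|apply: mean_leZ; [rewrite mulr_ge0|exact: mean_Lin2]].
Qed.

Variable M : 'M[R]_p.

Let S m w := \sum_(i < p | (i < m)%N) \sum_(j < p | (j < m)%N) M i j * z i w * z j w -
  \sum_(i < p | (i < m)%N) M i i.
Let Fr m := \sum_(i < p | (i < m)%N) \sum_(j < p | (j < m)%N) M i j ^+ 2.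
Let bd (o i : 'I_p) := M i o + M o i.

Let S0 w : S 0 w = 0. Proof. by rewrite /S !big_pred0// subr0. Qed.
Let Fr0 : Fr 0 = 0. Proof. by rewrite /Fr !big_pred0. Qed.

(** The new coordinate enters with a linear coefficient depending on the earlier ones and
    with the diagonal coefficient, as in [mean_step2] and [mean_step4]. *)
Let S_step (o : 'I_p) w :
  S o.+1 w = S o w + Lin (bd o) o w * z o w + M o o * (z o w ^+ 2 - 1).
Proof.
rewrite /S !sum_ltS; under eq_bigr do rewrite sum_ltS; rewrite big_split/=.
have -> : Lin (bd o) o w * z o w = \sum_(i < p | (i < o)%N) M i o * z i w * z o w +
    \sum_(i < p | (i < o)%N) M o i * z o w * z i w.
  rewrite /Lin mulr_suml -big_split/=; apply: eq_bigr => i _; rewrite /bd; ring.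
rewrite expr2; ring.
Qed.

Let Fr_step (o : 'I_p) : Fr o + (sqn (bd o) o + M o o ^+ 2) / 2 <= Fr o.+1.
Proof.
have -> : Fr o.+1 = Fr o + (\sum_(i < p | (i < o)%N) M i o ^+ 2) +
    (\sum_(i < p | (i < o)%N) M o i ^+ 2 + M o o ^+ 2).
  rewrite [LHS]/Fr !sum_ltS; under eq_bigr do rewrite sum_ltS.
  by rewrite big_split.
have : sqn (bd o) o / 2 <= \sum_(i < p | (i < o)%N) M i o ^+ 2 +
    \sum_(i < p | (i < o)%N) M o i ^+ 2.
  rewrite /sqn mulr_suml -big_split/=; apply: ler_sum => i _; rewrite /bd.
  by have := sqr_ge0 (M i o - M o i); nra.
have := sqr_ge0 (M o o); lra.
Qed.

Let meas_S m : meas_on X (J m) (S m).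
Proof.
apply: measurable_funB => //; apply: measurable_sum_cond => i im.
apply: measurable_sum_cond => j jm; apply: measurable_funM; last exact: meas_z.
by apply: measurable_funM => //; exact: meas_z.
Qed.

Let mean_S2 a m : (m <= p)%N ->
  mean_le P (fun w => (a + S m w) ^+ 2) (a ^+ 2 + 2 * K4 * Fr m + 2 * C * Fr m).
Proof.
elim: m => [_|m ih mp].
  rewrite Fr0 !mulr0 !addr0; under [X in mean_le _ X]eq_fun do rewrite S0 addr0.
  apply: mean_le_cst; exact: sqr_ge0.
pose o : 'I_p := Ordinal mp; rewrite -[m.+1]/(o.+1).
under [X in mean_le _ X]eq_fun do rewrite S_step 2!addrA.
have mD : meas_on X (J o) (fun w => a + S o w) by apply: measurable_funD => //; exact: meas_S.
have := @mean_step2 _ _ _ P _ X C C0 iX X2 (J o) (idx o) (fun w => a + S o w)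
  (Lin (bd o) o) (M o o) _ _ (notinJ o) mD (@meas_Lin (bd o) o) (ih (ltnW mp))
  (mean_Lin2 (bd o) (ltnW mp)).
apply: mean_le_weak; have := Fr_step o.
have := sqn_ge0 (bd o) o; have := sqr_ge0 (M o o); rewrite /K4 -[m]/(nat_of_ord o).
move=> m0 s0; set s := sqn _ _ in s0 *; set mm := M o o ^+ 2 in m0 *.
set f := Fr o; set f' := Fr o.+1 => ff.
have h1 : 0 <= C * (f' - f - (s + mm) / 2) by rewrite mulr_ge0//; lra.
have h2 : 0 <= C ^+ 2 * (f' - f - (s + mm) / 2) by rewrite mulr_ge0 ?sqr_ge0//; lra.
have h3 : 0 <= C ^+ 2 * mm by rewrite mulr_ge0 ?sqr_ge0.
have h4 : 0 <= C * s by rewrite mulr_ge0.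
have h5 : 0 <= C * mm by rewrite mulr_ge0.
lra.
Qed.

Let K1 := 8 * (K4 + 1).
Let K5 := K4 * K1.

Let K4_ge0 : 0 <= K4. Proof. by rewrite addr_ge0 ?sqr_ge0. Qed.
Let K1_ge0 : 0 <= K1. Proof. by rewrite mulr_ge0// addr_ge0. Qed.

Let Fr_ge0 m : 0 <= Fr m.
Proof. by apply: sumr_ge0 => i _; apply: sumr_ge0 => j _; exact: sqr_ge0. Qed.

(** With [f] the current bound and [g] its increment, the choice [g / f] for the splitting
    parameter turns the recursion, up to constants, into [f^2 + f g + g^2 <= (f + g)^2].
    Adding [e] per step keeps [f] positive. *)
Let mean_S4 e m : 0 < e -> (m <= p)%N ->
  mean_le P (fun w => S m w ^+ 4) (K5 * (Fr m + m.+1%:R * e) ^+ 2).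
Proof.
move=> e0; elim: m => [_|m ih mp].
  under [X in mean_le _ X]eq_fun do rewrite S0 expr0n.
  apply: mean_le_weak (mean_le_cst P (lexx 0)).
  by rewrite mulr_ge0 ?sqr_ge0// /K5 mulr_ge0.
pose o : 'I_p := Ordinal mp; rewrite -[m.+1]/(o.+1).
under [X in mean_le _ X]eq_fun do rewrite S_step.
pose f := Fr o + m.+1%:R * e; pose g := Fr o.+1 - Fr o + e.
have Fo := Fr_step o; have m0 := sqr_ge0 (M o o); have s0 := sqn_ge0 (bd o) o.
have f0 : 0 < f by rewrite ltr_wpDl// mulr_gt0.
have g0 : 0 < g by rewrite /g ltr_wpDl// subr_ge0 (le_trans _ Fo)// lerDl divr_ge0// addr_ge0.
have fg : Fr o.+1 + o.+2%:R * e = f + g.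
  by rewrite /f /g -natr1 /=; ring.
have Lr : mean_le P (fun w => (Lin (bd o) o w ^+ 2 + M o o ^+ 2) ^+ 2) (K1 * g ^+ 2).
  apply: (@mean_le_mono _ _ _ _ _ (fun w => 2 * Lin (bd o) o w ^+ 4 + 2 * M o o ^+ 4)).
  - apply: measurable_funX; apply: measurable_funD => //; apply: measurable_funX.
    exact: meas_on_measurable (@meas_Lin (bd o) o).
  - by move=> w; exact: sqr_ge0.
  - move=> w; have -> (x : R) : x ^+ 4 = (x ^+ 2) ^+ 2 by rewrite -exprM.
    by have := sqr_ge0 (Lin (bd o) o w ^+ 2 - M o o ^+ 2); lra.
  apply: (@mean_le_weak _ _ _ _ _ (2 * (K4 * sqn (bd o) o ^+ 2) + 2 * M o o ^+ 4)).
    have -> (x : R) : x ^+ 4 = (x ^+ 2) ^+ 2 by rewrite -exprM.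
    set s := sqn (bd o) o in s0 Fo *; set mm := M o o ^+ 2 in m0 Fo *.
    have sg : s + mm <= 2 * g by rewrite /g; lra.
    have h : (s + mm) ^+ 2 <= (2 * g) ^+ 2.
      by rewrite lerXn2r ?nnegrE ?addr_ge0// (le_trans _ sg)// addr_ge0.
    have sm : 0 <= s * mm by rewrite mulr_ge0.
    have h1 : 0 <= K4 * ((2 * g) ^+ 2 - (s + mm) ^+ 2) by rewrite mulr_ge0// subr_ge0.
    have h2 : 0 <= K4 * (s * mm) by rewrite mulr_ge0.
    have h3 : 0 <= K4 * mm ^+ 2 by rewrite mulr_ge0 ?sqr_ge0.
    have h4 : 0 <= s ^+ 2 by exact: sqr_ge0.
    by rewrite /K1; lra.
  apply: mean_leD; first by apply: mean_leZ => //; apply: mean_Lin4; exact: ltnW.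
  by apply: mean_le_cst; rewrite mulr_ge0// exprn_even_ge0.
have e'0 : 0 < g / f by rewrite divr_gt0.
have := @mean_step4 _ _ _ P _ X C C0 iX X4 (J o) (idx o) (S o)
  (Lin (bd o) o) (M o o) _ _ _ (notinJ o) (@meas_S o) (@meas_Lin (bd o) o) e'0
  (ih (ltnW mp)) Lr.
apply: mean_le_weak; rewrite fg -/f.
have -> : (1 + g / f) * (K5 * f ^+ 2) + (C ^+ 2 / (4 * (g / f)) + C) * (K1 * g ^+ 2) =
  K5 * (f ^+ 2 + f * g) + K1 * (C ^+ 2 / 4 * (f * g) + C * g ^+ 2).
  by field; rewrite !gt_eqF.
have fg0 : 0 <= f * g by rewrite ltW// mulr_gt0.
have h1 : 0 <= K1 * (C ^+ 2 * (f * g)) by rewrite mulr_ge0// mulr_ge0 ?sqr_ge0.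
have h2 : 0 <= K1 * (C * (f * g)) by rewrite mulr_ge0// mulr_ge0.
have h3 : 0 <= K1 * (C ^+ 2 * g ^+ 2) by rewrite mulr_ge0// mulr_ge0 ?sqr_ge0.
have h4 : 0 <= K1 * (C * g ^+ 2) by rewrite mulr_ge0// mulr_ge0 ?sqr_ge0.
rewrite /K5 /K4; lra.
Qed.

Definition row_vec (w : T) : 'cV[R]_p := \col_i X (idx i) w.

Let SE w : S p w = dotv (row_vec w) (M *m row_vec w) - \tr M.
Proof.
rewrite /S /dotv /mxtrace; congr (_ - _); last by apply: eq_bigl => i; rewrite ltn_ord.
rewrite mxE; under [RHS]eq_bigr do rewrite !mxE big_distrr/=.
apply: eq_big => [i|i _]; first by rewrite ltn_ord.
apply: eq_big => [j|j _]; first by rewrite ltn_ord.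
by rewrite !mxE /z; ring.
Qed.

Definition frob2 (A : 'M[R]_p) : R := \sum_i \sum_j A i j ^+ 2.

Let FrE : Fr p = frob2 M.
Proof.
apply: eq_big => [i|i _]; first by rewrite ltn_ord.
by apply: eq_bigl => j; rewrite ltn_ord.
Qed.

Definition Kquad := 2 * K4 + 2 * C + 4 * K5.

Lemma Kquad_ge0 : 0 <= Kquad.
Proof. by rewrite /Kquad !addr_ge0// mulr_ge0// /K5 mulr_ge0. Qed.

Lemma quad_form_mean2 a :
  mean_le P (fun w => (a + (dotv (row_vec w) (M *m row_vec w) - \tr M)) ^+ 2)
    (a ^+ 2 + Kquad * frob2 M).
Proof.
under [X in mean_le _ X]eq_fun do rewrite -SE.
apply: mean_le_weak (mean_S2 a (leqnn p)); rewrite FrE /Kquad.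
have f0 : 0 <= frob2 M by rewrite -FrE.
have : 0 <= K5 * frob2 M by rewrite mulr_ge0// /K5 mulr_ge0.
lra.
Qed.

(** The term 1 makes up for the increments that keep the inductive bound positive; the lemma is
    applied to projections of large rank. *)
Lemma quad_form_mean4 :
  mean_le P (fun w => (dotv (row_vec w) (M *m row_vec w) - \tr M) ^+ 4)
    (Kquad * (frob2 M + 1) ^+ 2).
Proof.
under [X in mean_le _ X]eq_fun do rewrite -SE.
have e0 : 0 < p.+1%:R^-1 :> R by rewrite invr_gt0.
apply: mean_le_weak (mean_S4 e0 (leqnn p)); rewrite FrE /Kquad divff ?pnatr_eq0//.
have : 0 <= (frob2 M + 1) ^+ 2 by exact: sqr_ge0.
set x := _ ^+ 2 => x0.
have h1 : 0 <= K4 * x by rewrite mulr_ge0.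
have h2 : 0 <= C * x by rewrite mulr_ge0.
have h3 : 0 <= K5 * x by rewrite mulr_ge0// /K5 mulr_ge0.
lra.
Qed.

End quadratic_forms.

(** * Rank-one updates of the kernel projection *)

Section dot_products.
Context (R : rcfType).

Lemma dotvC p (u w : 'cV[R]_p) : dotv u w = dotv w u.
Proof. by rewrite /dotv -[LHS]trace_mx11 -mxtrace_tr trmx_mul trmxK trace_mx11. Qed.

Lemma dotv_ge0 p (u : 'cV[R]_p) : 0 <= dotv u u.
Proof. by rewrite dotvvE sumr_ge0// => i _; exact: sqr_ge0. Qed.

Lemma dotvNl p (u w : 'cV[R]_p) : dotv (- u) w = - dotv u w.
Proof. by rewrite -scaleN1r dotvZl mulN1r. Qed.

Lemma dotvNr p (u w : 'cV[R]_p) : dotv u (- w) = - dotv u w.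
Proof. by rewrite -scaleN1r dotvZr mulN1r. Qed.

Lemma dotvBl p (u w x : 'cV[R]_p) : dotv (u - w) x = dotv u x - dotv w x.
Proof. by rewrite dotvDl dotvNl. Qed.

Lemma dotvBr p (u w x : 'cV[R]_p) : dotv x (u - w) = dotv x u - dotv x w.
Proof. by rewrite dotvDr dotvNr. Qed.

Lemma dotv0r p (u : 'cV[R]_p) : dotv u 0 = 0.
Proof. by rewrite /dotv mulmx0 mxE. Qed.

Lemma dotv0l p (u : 'cV[R]_p) : dotv 0 u = 0.
Proof. by rewrite dotvC dotv0r. Qed.

Definition dotvE := (dotvDl, dotvDr, dotvBl, dotvBr, dotvNl, dotvNr, dotvZl, dotvZr).

Lemma dotv_mull m p (A : 'M[R]_(m, p)) (u : 'cV[R]_m) w :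
  dotv u (A *m w) = dotv (A^T *m u) w.
Proof. by rewrite /dotv trmx_mul trmxK mulmxA. Qed.

Lemma dotv_CS p (u w : 'cV[R]_p) : dotv u w ^+ 2 <= dotv u u * dotv w w.
Proof.
have [w0|w0] := eqVneq (dotv w w) 0.
  by rewrite (dotvv_eq0 w0) !dotv0r expr0n mulr0.
have wp : 0 < dotv w w by rewrite lt_def w0 dotv_ge0.
have := dotv_ge0 (dotv w w *: u - dotv u w *: w).
have -> : dotv (dotv w w *: u - dotv u w *: w) (dotv w w *: u - dotv u w *: w) =
    dotv w w * (dotv u u * dotv w w - dotv u w ^+ 2).
  by rewrite !dotvE (dotvC w u); ring.
by rewrite pmulr_rge0// subr_ge0.
Qed.

Lemma dotv_gram m p (Q : 'M[R]_(m, p)) x : dotv x (Q^T *m Q *m x) = dotv (Q *m x) (Q *m x).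
Proof. by rewrite -mulmxA dotv_mull trmxK. Qed.

(** The cross term is absorbed with a weight [e], later [1 / p]: a factor [1 + 1 / p] per
    step stays bounded over [p] steps. *)
Lemma dotv_Cauchy p (a b : 'cV[R]_p) (e : R) : 0 < e ->
  dotv (a + b) (a + b) <= (1 + e) * dotv a a + (1 + e^-1) * dotv b b.
Proof.
move=> e0; have := dotv_ge0 (e *: a - b); rewrite !dotvE (dotvC b a) => h.
have : 0 <= e^-1 * (e * (e * dotv a a - dotv a b) - (e * dotv a b - dotv b b)).
  by rewrite mulr_ge0// ?invr_ge0 1?ltW//; lra.
have -> : e^-1 * (e * (e * dotv a a - dotv a b) - (e * dotv a b - dotv b b)) =
  e * dotv a a - 2 * dotv a b + e^-1 * dotv b b by field; rewrite gt_eqF.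
lra.
Qed.

Lemma sqr_Cauchy (a b e : R) : 0 < e ->
  (a + b) ^+ 2 <= (1 + e) * a ^+ 2 + (1 + e^-1) * b ^+ 2.
Proof.
move=> e0; have : 0 <= e^-1 * (e * a - b) ^+ 2.
  by rewrite mulr_ge0 ?sqr_ge0// invr_ge0 ltW.
have -> : e^-1 * (e * a - b) ^+ 2 = e * a ^+ 2 - 2 * a * b + e^-1 * b ^+ 2.
  by field; rewrite gt_eqF.
lra.
Qed.

Definition outer m p (a : 'cV[R]_m) (b : 'cV[R]_p) : 'M[R]_(m, p) := a *m b^T.

Lemma outerMl m p q (M : 'M[R]_(q, m)) (a : 'cV[R]_m) (b : 'cV[R]_p) :
  M *m outer a b = outer (M *m a) b.
Proof. by rewrite /outer mulmxA. Qed.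

Lemma outerMr m p q (M : 'M[R]_(p, q)) (a : 'cV[R]_m) (b : 'cV[R]_p) :
  outer a b *m M = outer a (M^T *m b).
Proof. by rewrite /outer trmx_mul trmxK mulmxA. Qed.

Lemma outerv m p (a : 'cV[R]_m) (b x : 'cV[R]_p) : outer a b *m x = dotv b x *: a.
Proof. by rewrite /outer -mulmxA [b^T *m x]mx11_scalar mul_mx_scalar. Qed.

Lemma outer_outer m p q (a : 'cV[R]_m) (b c : 'cV[R]_p) (e : 'cV[R]_q) :
  outer a b *m outer c e = dotv b c *: outer a e.
Proof. by rewrite outerMl outerv /outer scalemxAl. Qed.

Lemma outerT m p (a : 'cV[R]_m) (b : 'cV[R]_p) : (outer a b)^T = outer b a.
Proof. by rewrite /outer trmx_mul trmxK. Qed.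

Lemma outer0l m p (b : 'cV[R]_p) : outer (0 : 'cV[R]_m) b = 0.
Proof. by rewrite /outer mul0mx. Qed.

Lemma outer0r m p (a : 'cV[R]_m) : outer a (0 : 'cV[R]_p) = 0.
Proof. by rewrite /outer trmx0 mulmx0. Qed.

Lemma mxtrace_outer p (a b : 'cV[R]_p) : \tr (outer a b) = dotv b a.
Proof. by rewrite /outer mxtrace_mulC trace_mx11. Qed.

Lemma outerE m p (a : 'cV[R]_m) (b : 'cV[R]_p) i j : outer a b i j = a i 0 * b j 0.
Proof. by rewrite /outer mxE big_ord1 mxE. Qed.

End dot_products.

Section rank_one_update.
Context (R : rcfType) (p : nat).
Implicit Types (S Pi G : 'M[R]_p) (y z t : 'cV[R]_p).

(** How the projection on the kernel of the rows, the pseudo-inverse of their Gram matrix, and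
    the solution of minimal norm change with one more row [z] of response [l]. *)
Definition upd_Pi Pi z : 'M[R]_p :=
  let c := Pi *m z in Pi - (dotv z c)^-1 *: outer c c.

Definition upd_G Pi G z : 'M[R]_p :=
  let c := Pi *m z in let m := G *m z in let d := dotv z c in
  G - d^-1 *: (outer m c + outer c m) + ((1 + dotv z m) / d ^+ 2) *: outer c c.

Definition upd_y Pi y z (l : R) : 'cV[R]_p :=
  let c := Pi *m z in y + ((l - dotv z y) / dotv z c) *: c.

(** [G] is the pseudo-inverse of [S], and [Pi] the projection on the kernel of [S]; the
    factorization of [G] is the usable form of its positivity. *)
Record projection_state S Pi G : Prop := ProjectionState {
  Pi_sym : Pi^T = Pi;
  Pi_idem : Pi *m Pi = Pi;
  S_sym : S^T = S;
  S_Pi : S *m Pi = 0;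
  G_Pi : G *m Pi = 0;
  S_G : S *m G = 1%:M - Pi;
  G_gram : exists m (Q : 'M[R]_(m, p)), G = Q^T *m Q }.

Lemma G_sym S Pi G : projection_state S Pi G -> G^T = G.
Proof. by case=> _ _ _ _ _ _ [m [Q ->]]; rewrite trmx_mul trmxK. Qed.

Lemma projection_state0 : projection_state 0 1%:M 0.
Proof.
split; rewrite ?trmx1 ?trmx0 ?mulmx1 ?mul0mx ?subrr//.
by exists 0%N, 0; rewrite mulmx0.
Qed.

Section step.
Variables (S Pi G : 'M[R]_p) (z : 'cV[R]_p).
Hypothesis PS : projection_state S Pi G.
Let c := Pi *m z.
Let m := G *m z.
Let d := dotv z c.
Hypothesis d0 : d != 0.

Let Pic : Pi *m c = c. Proof. by rewrite /c mulmxA (Pi_idem PS). Qed.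
Let Gc : G *m c = 0. Proof. by rewrite /c mulmxA (G_Pi PS) mul0mx. Qed.
Let Pim : Pi *m m = 0.
Proof.
rewrite /m mulmxA -(Pi_sym PS) -(G_sym PS) -trmx_mul (G_Pi PS).
by rewrite trmx0 mul0mx.
Qed.
Let Sc : S *m c = 0. Proof. by rewrite /c mulmxA (S_Pi PS) mul0mx. Qed.
Let Sm : S *m m = z - c. Proof. by rewrite /m mulmxA (S_G PS) mulmxBl mul1mx. Qed.
Let cc : dotv c c = d.
Proof. by rewrite /d {2}/c dotv_mull (Pi_sym PS) Pic dotvC. Qed.
Let cm : dotv c m = 0.
Proof. by rewrite dotvC /c dotv_mull (Pi_sym PS) Pim dotv0l. Qed.

(** With [c = Pi z] and [m = G z], the new Gram matrix [S + z z^T] sends [c] to [d z] and [m] to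
    [z - c + (z^T G z) z]; the update of [G] is the one that solves these relations and kills
    [c]. *)
Lemma projection_state_step :
  projection_state (S + outer z z) (upd_Pi Pi z) (upd_G Pi G z).
Proof.
have PiT := Pi_sym PS; have GT := G_sym PS.
have mc : dotv m c = 0 by rewrite dotvC.
have GTc : G^T *m c = 0 by rewrite GT.
rewrite /upd_Pi /upd_G -/c -/m -/d.
split.
- by rewrite linearB/= linearZ/= outerT PiT.
- rewrite mulmxBl !mulmxBr -!scalemxAl -!scalemxAr outerMl outerMr outer_outer PiT.
  rewrite (Pi_idem PS) Pic cc; move: (outer c c) => O.
  by apply/matrixP => i j; rewrite !mxE; field.
- by rewrite linearD/= outerT (S_sym PS).
- rewrite mulmxDl !mulmxBr -!scalemxAr !outer_outer !outerMl !outerMr PiT Sc.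
  rewrite (S_Pi PS) outer0l -/c -/d; move: (outer z c) => O.
  by apply/matrixP => i j; rewrite !mxE; field.
- rewrite mulmxDl mulmxBl !mulmxBr -!scalemxAl mulmxDl -!scalemxAr mulmxDl.
  rewrite !outer_outer !outerMl !outerMr PiT Gc (G_Pi PS) Pic Pim cc mc.
  rewrite outer0l outer0r; move: (outer m c) (outer c c) => O1 O2.
  by apply/matrixP => i j; rewrite !mxE; field.
- rewrite mulmxDl mulmxDr !mulmxBr -!scalemxAr mulmxDr !outerMl Sm Sc.
  rewrite (S_G PS) [outer z z *m _]mulmxDr mulmxBr -!scalemxAr mulmxDr.
  rewrite !outer_outer outerMr GT -/m -/d !outer0l.
  have -> : outer (z - c) c = outer z c - outer c c by rewrite /outer mulmxBl.
  move: (outer z c) (outer z m) (outer c c) => O1 O2 O3.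
  by apply/matrixP => i j; rewrite !mxE; field.
have [k [Q GQ]] := G_gram PS.
exists (k + 1)%N, (col_mx (Q - d^-1 *: outer (Q *m z) c) (d^-1 *: c^T)).
have T1 : (Q - d^-1 *: outer (Q *m z) c)^T = Q^T - d^-1 *: outer c (Q *m z).
  by rewrite linearB/= linearZ/= outerT.
have T2 : (d^-1 *: c^T)^T = d^-1 *: c by rewrite linearZ/= trmxK.
rewrite tr_col_mx mul_row_col T1 T2.
rewrite mulmxBl !mulmxBr -!scalemxAl -!scalemxAr outer_outer outerMl outerMr.
rewrite mulmxA -GQ -/m -/(outer c c) -dotv_gram -GQ -/m.
move: (outer m c) (outer c m) (outer c c) => O1 O2 O3.
by apply/matrixP => i j; rewrite !mxE; field.
Qed.

Lemma upd_Pi_trace : \tr (upd_Pi Pi z) = \tr Pi - 1.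
Proof. by rewrite /upd_Pi linearB/= linearZ/= mxtrace_outer cc mulVf. Qed.

Lemma upd_G_trace : \tr (upd_G Pi G z) = \tr G + (1 + dotv z m) / d.
Proof.
rewrite /upd_G linearD linearB/= !linearZ/= linearD/= !mxtrace_outer -/c -/m -/d cc cm.
by rewrite (dotvC m) cm; field.
Qed.

(** The new form is the old one at a shift of [u] along [z], plus a square. *)
Lemma upd_G_form (u : 'cV[R]_p) :
  dotv u (upd_G Pi G z *m u) =
  dotv (u - (dotv c u / d) *: z) (G *m (u - (dotv c u / d) *: z)) + (dotv c u / d) ^+ 2.
Proof.
rewrite /upd_G -/c -/m -/d mulmxDl mulmxBl -!scalemxAl mulmxDl !outerv mulmxBr -scalemxAr -/m.
rewrite !dotvE (dotvC u c) (dotvC m u).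
have -> : dotv z (G *m u) = dotv u m by rewrite dotv_mull (G_sym PS) dotvC.
by field.
Qed.

Section target.
Variables (t y : 'cV[R]_p).
Hypothesis Piy : Pi *m y = 0.

Let cy : dotv c y = 0.
Proof. by rewrite /c dotvC dotv_mull (Pi_sym PS) Piy dotv0l. Qed.

Lemma upd_y_ker l : upd_Pi Pi z *m upd_y Pi y z l = 0.
Proof.
rewrite /upd_Pi /upd_y -/c -/d mulmxBl !mulmxDr -!scalemxAr -!scalemxAl Piy Pic.
rewrite !outerv cy cc; apply/matrixP => i j; rewrite !mxE; by field.
Qed.

Lemma upd_y_dot l u : dotv u (upd_y Pi y z l) = dotv u y + dotv c u * (l - dotv z y) / d.
Proof. by rewrite /upd_y -/c -/d !dotvE (dotvC u c); ring. Qed.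

Lemma upd_y_norm l : dotv (upd_y Pi y z l) (upd_y Pi y z l) =
  dotv y y + (l - dotv z y) ^+ 2 / d.
Proof. by rewrite /upd_y -/c -/d !dotvE (dotvC y c) cy cc; field. Qed.

(** While the responses are those of [t], the solution is the projection of [t] on the row
    space. *)
Lemma upd_y_full : y = t - Pi *m t -> upd_y Pi y z (dotv z t) = t - upd_Pi Pi z *m t.
Proof.
move=> yE; rewrite /upd_y /upd_Pi -/c -/d mulmxBl -scalemxAl outerv.
have -> : dotv z t - dotv z y = dotv c t.
  by rewrite yE dotvBr subKr dotv_mull (Pi_sym PS).
rewrite {1}yE; move: (Pi *m t) => s; apply/matrixP => i j; rewrite !mxE; ring.
Qed.

(** Afterwards the responses are 0 and the right-hand side [S1 t] of the normal equations no
    longer changes. *)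
Lemma upd_y_solve S1 : S1^T = S1 -> S1 *m Pi = 0 -> y = G *m (S1 *m t) ->
  S1 *m upd_Pi Pi z = 0 /\ upd_y Pi y z 0 = upd_G Pi G z *m (S1 *m t).
Proof.
move=> S1T S1Pi yE; have S1c : S1 *m c = 0 by rewrite /c mulmxA S1Pi mul0mx.
split; first by rewrite /upd_Pi -/c mulmxBr -scalemxAr outerMl S1c outer0l S1Pi scaler0 subr0.
rewrite /upd_y /upd_G -/c -/m -/d mulmxDl mulmxBl -!scalemxAl mulmxDl !outerv -yE.
have -> : dotv c (S1 *m t) = 0 by rewrite dotv_mull S1T S1c dotv0l.
have -> : dotv m (S1 *m t) = dotv z y.
  by rewrite yE [RHS]dotv_mull (G_sym PS).
apply/matrixP => i j; rewrite !mxE; by field.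
Qed.

End target.
End step.
End rank_one_update.

(** * Measurability of matrix-valued maps *)

Section measurable_matrices.
Context d (T : measurableType d) (R : realType).

Definition mx_meas m n (F : T -> 'M[R]_(m, n)) :=
  forall i j, measurable_fun setT (fun w => F w i j).

Lemma mx_meas_cst m n (A : 'M[R]_(m, n)) : mx_meas (fun=> A).
Proof. by move=> i j; exact: measurable_cst. Qed.

Lemma mx_measD m n (F G : T -> 'M[R]_(m, n)) : mx_meas F -> mx_meas G ->
  mx_meas (fun w => F w + G w).
Proof.
move=> mF mG i j; under eq_fun do rewrite mxE; exact: measurable_funD.
Qed.

Lemma mx_measB m n (F G : T -> 'M[R]_(m, n)) : mx_meas F -> mx_meas G ->
  mx_meas (fun w => F w - G w).
Proof.
move=> mF mG i j; under eq_fun do rewrite !mxE; exact: measurable_funB.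
Qed.

Lemma mx_measZ m n (a : T -> R) (F : T -> 'M[R]_(m, n)) : measurable_fun setT a ->
  mx_meas F -> mx_meas (fun w => a w *: F w).
Proof.
move=> ma mF i j; under eq_fun do rewrite mxE; exact: measurable_funM.
Qed.

Lemma mx_meas_tr m n (F : T -> 'M[R]_(m, n)) : mx_meas F -> mx_meas (fun w => (F w)^T).
Proof. by move=> mF i j; under eq_fun do rewrite mxE; exact: mF. Qed.

Lemma mx_measM m n q (F : T -> 'M[R]_(m, n)) (G : T -> 'M[R]_(n, q)) :
  mx_meas F -> mx_meas G -> mx_meas (fun w => F w *m G w).
Proof.
move=> mF mG i j; under eq_fun do rewrite mxE.
by apply: measurable_sum_cond => k _; apply: measurable_funM; [exact: mF|exact: mG].
Qed.

Lemma mx_meas_outer m n (F : T -> 'cV[R]_m) (G : T -> 'cV[R]_n) :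
  mx_meas F -> mx_meas G -> mx_meas (fun w => outer (F w) (G w)).
Proof. by move=> mF mG; apply: mx_measM => //; exact: mx_meas_tr. Qed.

Lemma meas_dotv m (F G : T -> 'cV[R]_m) :
  mx_meas F -> mx_meas G -> measurable_fun setT (fun w => dotv (F w) (G w)).
Proof. by move=> mF mG; apply: mx_measM => //; exact: mx_meas_tr. Qed.

Lemma meas_mxtrace m (F : T -> 'M[R]_m) :
  mx_meas F -> measurable_fun setT (fun w => \tr (F w)).
Proof. by move=> mF; apply: measurable_sum_cond => k _; exact: mF. Qed.

(** Through [powR], whose measurability is known; the square avoids a discussion of sign. *)
Lemma meas_inv (f : T -> R) : measurable_fun setT f -> measurable_fun setT (fun w => (f w)^-1).
Proof.
move=> mf; have -> : (fun w => (f w)^-1) = (fun w => f w * (f w ^+ 2) `^ (-1)).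
  apply/funext => w; rewrite powR_inv1 ?sqr_ge0//.
  have [->|f0] := eqVneq (f w) 0; first by rewrite invr0 mul0r.
  by rewrite expr2 invfM mulrA mulfV// mul1r.
apply: measurable_funM => //.
apply: (measurableT_comp (measurable_powR (-1))); exact: measurable_funX.
Qed.

End measurable_matrices.

(** * Conditional means of one step *)

Section frobenius.
Context (R : realType) (p : nat).

Lemma frob2Z a (A : 'M[R]_p) : frob2 (a *: A) = a ^+ 2 * frob2 A.
Proof.
rewrite /frob2 mulr_sumr; apply: eq_bigr => i _; rewrite mulr_sumr.
by apply: eq_bigr => j _; rewrite mxE exprMn.
Qed.

Lemma frob2_outer (a b : 'cV[R]_p) : frob2 (outer a b) = dotv a a * dotv b b.
Proof.
rewrite !dotvvE mulr_suml; apply: eq_bigr => i _; rewrite mulr_sumr.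
by apply: eq_bigr => j _; rewrite outerE exprMn.
Qed.

(** Cauchy-Schwarz between the columns of [Q]. *)
Lemma frob2_gram m (Q : 'M[R]_(m, p)) : frob2 (Q^T *m Q) <= (\tr (Q^T *m Q)) ^+ 2.
Proof.
have E i j : (Q^T *m Q) i j = dotv (col i Q) (col j Q).
  by rewrite /dotv !mxE; apply: eq_bigr => k _; rewrite !mxE.
rewrite expr2 /mxtrace mulr_suml; apply: ler_sum => i _; rewrite mulr_sumr.
by apply: ler_sum => j _; rewrite !E; exact: dotv_CS.
Qed.

Lemma tr_gram_ge0 m (Q : 'M[R]_(m, p)) : 0 <= \tr (Q^T *m Q).
Proof.
apply: sumr_ge0 => i _; rewrite mxE; apply: sumr_ge0 => k _.
by rewrite mxE -expr2 sqr_ge0.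
Qed.

Lemma frob2_proj (A : 'M[R]_p) : A^T = A -> A *m A = A -> frob2 A = \tr A.
Proof.
move=> AT AA; rewrite -[in RHS]AA /mxtrace; apply: eq_bigr => i _.
rewrite mxE; apply: eq_bigr => j _; rewrite expr2 -{2}AT mxE //.
Qed.

End frobenius.

Section energy_step.
Context d (T : measurableType d) (R : realType) (P : probability T R).
Context (p : nat) (z : T -> 'cV[R]_p) (K : R).
Hypothesis K0 : 0 <= K.
Hypothesis mz : mx_meas z.
Hypothesis mean2 : forall (M : 'M[R]_p) (a : R),
  mean_le P (fun w => (a + (dotv (z w) (M *m z w) - \tr M)) ^+ 2)
    (a ^+ 2 + K * frob2 M).

Variables (S Pi G : 'M[R]_p) (u r : 'cV[R]_p).
Hypothesis PS : projection_state S Pi G.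
Hypothesis u1 : dotv u u <= 1.
Variables (e D kap : R).
Hypotheses (e0 : 0 < e) (D0 : 0 < D) (kap0 : 0 <= kap).

Let D2 : 0 <= (D ^+ 2)^-1. Proof. by rewrite invr_ge0 sqr_ge0. Qed.
Let e1 : 0 <= 1 + e. Proof. by rewrite addr_ge0// ltW. Qed.

Let mean2' (M : 'M[R]_p) (a : R) : mean_le P (fun w => (a + dotv (z w) (M *m z w)) ^+ 2)
  ((a + \tr M) ^+ 2 + K * frob2 M).
Proof.
have := mean2 M (a + \tr M); congr (mean_le _ _ _).
by apply/funext => w; congr (_ ^+ 2); ring.
Qed.

Let meanD (M : 'M[R]_p) (a : R) :
  mean_le P (fun w => (a + dotv (z w) (M *m z w) / D) ^+ 2)
  ((a + \tr M / D) ^+ 2 + K * frob2 M / D ^+ 2).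
Proof.
have := mean2' (D^-1 *: M) a; rewrite frob2Z mxtraceZ exprVn.
rewrite mulrCA [_ * (K * _)]mulrC [D^-1 * _]mulrC; congr (mean_le _ _ _).
by apply/funext => w; rewrite -scalemxAl dotvZr [D^-1 * _]mulrC.
Qed.

Let q := Pi *m u.

Let qq : dotv q q = dotv u q.
Proof. by rewrite /q dotv_mull (Pi_sym PS) mulmxA (Pi_idem PS) dotvC. Qed.

Lemma proj_norm_le : dotv q q <= dotv u u.
Proof.
have := dotv_ge0 (u - q); rewrite !dotvE (dotvC q u) qq; lra.
Qed.

Let q1 : dotv q q <= 1. Proof. exact: le_trans proj_norm_le u1. Qed.

Let cu w : dotv (Pi *m z w) u = dotv (z w) q.
Proof. by rewrite /q dotv_mull (Pi_sym PS). Qed.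

(** Squared deviations after one step, once the division by [z^T Pi z] has been replaced by the
    division by [D] at the price of a factor [1 + e] and of a remainder of weight [kap]: for
    [u^T y], [y^T y], [tr G] and the form [u^T G u] respectively. The argument [x] is the
    old value minus the new limit. *)
Definition step_dot x w := (1 + e) * (x + dotv (Pi *m z w) u * dotv (z w) r / D) ^+ 2 +
  kap * (dotv (Pi *m z w) u * dotv (z w) r) ^+ 2.
Definition step_norm x w := (1 + e) * (x + dotv (z w) r ^+ 2 / D) ^+ 2 +
  kap * (dotv (z w) r ^+ 2) ^+ 2.
Definition step_trace x w := (1 + e) * (x + (1 + dotv (z w) (G *m z w)) / D) ^+ 2 +
  kap * (1 + dotv (z w) (G *m z w)) ^+ 2.
Definition step_form w := let x := dotv (Pi *m z w) u in
  let v := u - (x / D) *: z w in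
  (1 + e) * dotv v (G *m v) + kap * (dotv (z w) (G *m z w) * x ^+ 2) + 4 / D ^+ 2 * x ^+ 2.

(** The product [(z^T Pi u) (z^T r)] is the quadratic form of the matrix [(Pi u) r^T]. *)
Lemma mean_step_dot x : mean_le P (step_dot x)
  ((1 + e) * ((x + dotv q r / D) ^+ 2 + K * dotv r r / D ^+ 2) +
   kap * ((1 + K) * dotv r r)).
Proof.
have E w : dotv (z w) (outer q r *m z w) = dotv (Pi *m z w) u * dotv (z w) r.
  by rewrite outerv dotvZr cu (dotvC r) mulrC.
have r0 := dotv_ge0 r.
have f1 : frob2 (outer q r) <= dotv r r.
  by rewrite frob2_outer -[leRHS]mul1r ler_wpM2r.
apply: mean_leD; apply: mean_leZ => //.
- have := meanD (outer q r) x; under [X in mean_le _ X]eq_fun do rewrite E.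
  apply: mean_le_weak; rewrite mxtrace_outer (dotvC r) lerD2l.
  by rewrite ler_wpM2r// ler_wpM2l.
- have := mean2' (outer q r) 0; under [X in mean_le _ X]eq_fun do rewrite E add0r.
  apply: mean_le_weak; rewrite mxtrace_outer add0r mulrDl mul1r lerD ?ler_wpM2l//.
  rewrite (le_trans (dotv_CS _ _))// -[leRHS]mulr1 ler_wpM2l//.
Qed.

Lemma mean_step_norm x : mean_le P (step_norm x)
  ((1 + e) * ((x + dotv r r / D) ^+ 2 + K * dotv r r ^+ 2 / D ^+ 2) +
   kap * ((1 + K) * dotv r r ^+ 2)).
Proof.
have E w : dotv (z w) (outer r r *m z w) = dotv (z w) r ^+ 2.
  by rewrite outerv dotvZr (dotvC r) expr2.
apply: mean_leD; apply: mean_leZ => //.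
- have := meanD (outer r r) x; under [X in mean_le _ X]eq_fun do rewrite E.
  by rewrite mxtrace_outer frob2_outer -expr2.
- have := mean2' (outer r r) 0; under [X in mean_le _ X]eq_fun do rewrite E add0r.
  by rewrite mxtrace_outer frob2_outer -expr2 add0r mulrDl mul1r.
Qed.

Let trG0 : 0 <= \tr G.
Proof. by have [m [Q ->]] := G_gram PS; exact: tr_gram_ge0. Qed.

Let frG : frob2 G <= (\tr G) ^+ 2.
Proof. by have [m [Q ->]] := G_gram PS; exact: frob2_gram. Qed.

Lemma mean_step_trace x : mean_le P (step_trace x)
  ((1 + e) * ((x + (1 + \tr G) / D) ^+ 2 + K * (\tr G) ^+ 2 / D ^+ 2) +
   kap * ((1 + \tr G) ^+ 2 + K * (\tr G) ^+ 2)).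
Proof.
apply: mean_leD; apply: mean_leZ => //.
- have := meanD G (x + D^-1).
  rewrite (_ : (fun w => (x + D^-1 + dotv (z w) (G *m z w) / D) ^+ 2) =
    (fun w => (x + (1 + dotv (z w) (G *m z w)) / D) ^+ 2)); last first.
    by apply/funext => w; rewrite mulrDl mul1r addrA.
  apply: mean_le_weak; rewrite mulrDl mul1r addrA lerD2l.
  by rewrite ler_wpM2r// ler_wpM2l.
- have := mean2' G 1; apply: mean_le_weak.
  by rewrite lerD2l ler_wpM2l.
Qed.

(** Writing [G = Q^T Q], the form at [u - (x / D) z] is the sum over the rows of [Q] of the
    squares of [(Q u)_j] plus a quadratic form in [z], of mean 0 because [Q Pi = 0]. *)
Lemma mean_step_form : mean_le P step_form
  ((1 + e) * (dotv u (G *m u) + K * \tr G / D ^+ 2) +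
   kap * ((1 + K) * (1 + (\tr G) ^+ 2)) + 4 / D ^+ 2 * (2 + K)).
Proof.
have x4 : mean_le P (fun w => (dotv (Pi *m z w) u ^+ 2) ^+ 2) (1 + K).
  have := mean2' (outer q q) 0; rewrite mxtrace_outer frob2_outer add0r.
  rewrite (_ : (fun w => (0 + _) ^+ 2) = (fun w => (dotv (Pi *m z w) u ^+ 2) ^+ 2)).
    apply: mean_le_weak; rewrite -expr2 -[X in _ <= X + _]mulr1 -[X in X * 1 + _]mulr1.
    have q0 := dotv_ge0 q.
    have : dotv q q ^+ 2 <= 1 by rewrite expr_le1.
    by move=> h; rewrite lerD ?mulr1// -[leRHS]mulr1 ler_wpM2l.
  by apply/funext => w; rewrite add0r outerv dotvZr cu (dotvC q) expr2.
have mx : measurable_fun setT (fun w => dotv (Pi *m z w) u).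
  by apply: meas_dotv; [apply: mx_measM|]; [exact: mx_meas_cst|exact: mz|exact: mx_meas_cst].
have mG : mean_le P (fun w => dotv (z w) (G *m z w) ^+ 2) ((1 + K) * (\tr G) ^+ 2).
  have := mean2' G 0; under [X in mean_le _ X]eq_fun do rewrite add0r.
  by apply: mean_le_weak; rewrite add0r mulrDl mul1r lerD2l ler_wpM2l.
have [m [Q GQ]] := G_gram PS.
have Gv (v : 'cV[R]_p) : dotv v (G *m v) = \sum_j (Q *m v) j 0 ^+ 2.
  by rewrite GQ dotv_gram dotvvE.
have Gv0 (v : 'cV[R]_p) : 0 <= dotv v (G *m v).
  by rewrite Gv; apply: sumr_ge0 => j _; exact: sqr_ge0.
have Qq : Q *m q = 0.
  by apply: dotvv_eq0; rewrite -dotv_gram -GQ /q [G *m _]mulmxA (G_Pi PS) mul0mx dotv0r.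
have mform : measurable_fun setT (fun w => dotv (z w) (G *m z w)).
  by apply: meas_dotv => //; apply: mx_measM => //; exact: mx_meas_cst.
apply: mean_leD; first apply: mean_leD.
- apply: mean_leZ => //.
  pose b j : 'cV[R]_p := - (row j Q)^T.
  have bv j (v : 'cV[R]_p) : dotv (b j) v = - (Q *m v) j 0.
    by rewrite /b dotvNl /dotv trmxK -row_mul mxE.
  have bb : \sum_j dotv (b j) (b j) = \tr G.
    rewrite GQ mxtrace_mulC /mxtrace; apply: eq_bigr => j _.
    by rewrite bv /b mulmxN !mxE opprK; apply: eq_bigr => k _; rewrite !mxE.
  have step j : mean_le P (fun w => ((Q *m u) j 0 +
      dotv (z w) (outer q (b j) *m z w) / D) ^+ 2)
      ((Q *m u) j 0 ^+ 2 + K * dotv (b j) (b j) / D ^+ 2).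
    have := meanD (outer q (b j)) ((Q *m u) j 0); apply: mean_le_weak.
    have bq : dotv (b j) q = 0 by rewrite bv Qq mxE oppr0.
    rewrite mxtrace_outer bq mul0r addr0 lerD2l ler_wpM2r// ler_wpM2l//.
    by rewrite frob2_outer -[leRHS]mul1r ler_wpM2r// dotv_ge0.
  have := mean_le_sum (index_enum _) (Q := predT) (fun j _ => step j).
  rewrite big_split/= -mulr_suml -mulr_sumr bb -Gv.
  congr (mean_le _ _ _); apply/funext => w; rewrite Gv; apply: eq_bigr => j _.
  congr (_ ^+ 2); rewrite outerv dotvZr bv mulmxBr -scalemxAr !mxE cu.
  by ring.
- apply: mean_leZ => //.
  apply: (@mean_le_mono _ _ _ _ _ (fun w => 2^-1 * dotv (z w) (G *m z w) ^+ 2 +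
     2^-1 * (dotv (Pi *m z w) u ^+ 2) ^+ 2)).
  + by apply: measurable_funM => //; exact: measurable_funX.
  + by move=> w; rewrite mulr_ge0 ?sqr_ge0.
  + move=> w; set a := dotv _ _; set c := _ ^+ 2.
    by have := sqr_ge0 (a - c); nra.
  + apply: mean_le_weak (mean_leD (mean_leZ _ mG) (mean_leZ _ x4)) => //.
    rewrite -subr_ge0 (_ : _ - _ = 2^-1 * ((1 + K) * (1 + \tr G ^+ 2))); last by field.
    by rewrite mulr_ge0// mulr_ge0// addr_ge0// sqr_ge0.
- apply: mean_leZ; first by rewrite divr_ge0 ?sqr_ge0.
  apply: (@mean_le_mono _ _ _ _ _ (fun w => 1 + (dotv (Pi *m z w) u ^+ 2) ^+ 2)).
  + exact: measurable_funX.
  + by move=> w; exact: sqr_ge0.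
  + by move=> w; set c := _ ^+ 2; have := sqr_ge0 (c - 1); have := sqr_ge0 c; nra.
  + apply: mean_le_weak (mean_leD (mean_le_cst P (@ler01 R)) x4).
    by rewrite addrA.
Qed.

End energy_step.

Section pointwise.
Context (R : realType) (p : nat).
Variables (e D dl : R).
Hypotheses (e0 : 0 < e) (D0 : 0 < D) (dl0 : 0 <= dl) (dl1 : dl <= 2^-1).

(** The cost of replacing [1 / d] by [1 / D] in a squared sum, see [ratio_Cauchy]. *)
Definition kappa := (1 + e^-1) * (4 * dl ^+ 2 / D ^+ 2).

Lemma inv_gap d : `|d - D| <= dl * D -> [/\ 0 < d, (d^-1 - D^-1) ^+ 2 <= 4 * dl ^+ 2 / D ^+ 2
  & (d ^+ 2)^-1 <= 4 / D ^+ 2].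
Proof.
move=> dD; have h1 : dl * D <= D / 2 by rewrite mulrC ler_wpM2l// ltW.
have /andP[dl' du] : - (dl * D) <= d - D <= dl * D by rewrite -ler_norml.
have d2 : D / 2 <= d by lra.
have d0 : 0 < d by apply: lt_le_trans d2; rewrite divr_gt0.
have i2 : (d ^+ 2)^-1 <= 4 / D ^+ 2.
  have -> : 4 / D ^+ 2 = ((D / 2) ^+ 2)^-1 by field; rewrite gt_eqF.
  by rewrite lef_pV2 ?posrE ?exprn_gt0// ?divr_gt0// lerXn2r ?nnegrE// ltW// divr_gt0.
split=> //.
have -> : (d^-1 - D^-1) ^+ 2 = (D - d) ^+ 2 / D ^+ 2 * (d ^+ 2)^-1.
  by field; rewrite !gt_eqF.
have -> : 4 * dl ^+ 2 / D ^+ 2 = dl ^+ 2 * (4 / D ^+ 2) by ring.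
apply: ler_pM => //.
- by rewrite divr_ge0 ?sqr_ge0.
- by rewrite invr_ge0 sqr_ge0.
- rewrite ler_pdivrMr ?exprn_gt0// -exprMn -sqrrN opprB -real_normK ?num_real//.
  by rewrite lerXn2r ?nnegrE ?mulr_ge0// ltW.
Qed.

Lemma ratio_Cauchy x N d : `|d - D| <= dl * D ->
  (x + N / d) ^+ 2 <= (1 + e) * (x + N / D) ^+ 2 + kappa * N ^+ 2.
Proof.
move=> dD; have [d0 h _] := inv_gap dD.
have -> : x + N / d = (x + N / D) + N * (d^-1 - D^-1) by ring.
apply: (le_trans (sqr_Cauchy _ _ e0)); rewrite lerD2l /kappa -[leRHS]mulrA.
have i0 : 0 <= 1 + e^-1 by rewrite addr_ge0// invr_ge0 ltW.
by rewrite ler_wpM2l// exprMn mulrC ler_wpM2r// sqr_ge0.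
Qed.

Lemma psd_ratio_Cauchy m (Q : 'M[R]_(m, p)) (u z : 'cV[R]_p) x d :
  `|d - D| <= dl * D -> forall G, G = Q^T *m Q ->
  dotv (u - (x / d) *: z) (G *m (u - (x / d) *: z)) + (x / d) ^+ 2 <=
  (1 + e) * dotv (u - (x / D) *: z) (G *m (u - (x / D) *: z)) +
  kappa * (dotv z (G *m z) * x ^+ 2) + 4 / D ^+ 2 * x ^+ 2.
Proof.
move=> dD G ->; have [d0 h h2] := inv_gap dD.
apply: lerD; last first.
  by rewrite exprMn exprVn mulrC ler_wpM2r// sqr_ge0.
rewrite !dotv_gram.
have -> : Q *m (u - (x / d) *: z) = Q *m (u - (x / D) *: z) +
    (x * (D^-1 - d^-1)) *: (Q *m z).
  rewrite !mulmxBr -!scalemxAr; move: (Q *m u) (Q *m z) => a b.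
  by apply/matrixP => i j; rewrite !mxE; ring.
apply: (le_trans (dotv_Cauchy _ _ e0)); rewrite lerD2l.
rewrite dotvZl dotvZr /kappa -[leRHS]mulrA.
have i0 : 0 <= 1 + e^-1 by rewrite addr_ge0// invr_ge0 ltW.
rewrite ler_wpM2l//.
have -> : x * (D^-1 - d^-1) * (x * (D^-1 - d^-1) * dotv (Q *m z) (Q *m z)) =
  (d^-1 - D^-1) ^+ 2 * (dotv (Q *m z) (Q *m z) * x ^+ 2) by ring.
by rewrite ler_wpM2r// mulr_ge0 ?sqr_ge0// dotv_ge0.
Qed.

End pointwise.

(** * Drift of the energy *)

Section energy.
Context (R : realType) (p n1 : nat) (u t : 'cV[R]_p).
Implicit Types (k : nat) (S Pi G : 'M[R]_p) (y z : 'cV[R]_p).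

(** Closed forms of the recursions obtained from the rank-one updates by replacing the new row
    by its average and [z^T Pi z] by [p - k]; the lemmas below on [traj_dot k.+1],
    [traj_norm k.+1] and [traj_trace k.+1] are these recursions. *)
Definition traj_dot k : R := (minn k n1)%:R / p%:R * dotv u t.
Definition traj_norm k : R :=
  (if (k <= n1)%N then k%:R / p%:R
   else n1%:R / p%:R * ((p%:R - n1%:R + 1) / (p%:R - k%:R + 1))) * dotv t t.
Definition traj_trace k : R := k%:R / (p%:R - k%:R + 1).

(** The form [u^T G u] has limit 0, hence enters without a square. *)
Definition energy k G y : R :=
  (dotv u y - traj_dot k) ^+ 2 + (dotv y y - traj_norm k) ^+ 2 +
  (\tr G - traj_trace k) ^+ 2 + dotv u (G *m u).

(** The first [n1] rows carry the response [z^T t], the others the response 0; [residual] is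
    the vector that a row must be paired with to get its response minus the prediction. *)
Definition target k : R := (k < n1)%:R.
Definition residual k y : 'cV[R]_p := target k *: t - y.

Definition state_ok k S Pi G y :=
  [/\ projection_state S Pi G, Pi *m y = 0 & (k <= n1)%N -> y = t - Pi *m t].

(** A vector is fed to the functions of a random row by making it constant on [unit]. *)
Definition energy_bound (e D kap : R) k Pi G y z : R :=
  let w (_ : unit) := z in
  step_dot w Pi u (residual k y) e D kap (dotv u y - traj_dot k.+1) tt +
  step_norm w (residual k y) e D kap (dotv y y - traj_norm k.+1) tt +
  step_trace w G e D kap (\tr G - traj_trace k.+1) tt +
  step_form w Pi G u e D kap tt.

(** Deterministic half of a step: only the size of [z^T Pi z] is used. *)
Lemma energy_step_pointwise k S Pi G y z (e D dl : R) :
  0 < e -> 0 < D -> 0 <= dl -> dl <= 2^-1 ->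
  state_ok k S Pi G y -> `|dotv z (Pi *m z) - D| <= dl * D ->
  energy k.+1 (upd_G Pi G z) (upd_y Pi y z (target k * dotv z t)) <=
  energy_bound e D (kappa e D dl) k Pi G y z.
Proof.
move=> e0 D0 dl0 dl1 [PS Piy _] dD.
have [d0 _ _] := inv_gap D0 dl0 dl1 dD.
have dn0 := lt0r_neq0 d0.
have rE : target k * dotv z t - dotv z y = dotv z (residual k y).
  by rewrite /residual !dotvE.
rewrite /energy /energy_bound upd_y_dot (upd_y_norm PS dn0 Piy) (upd_G_trace PS dn0).
rewrite (upd_G_form PS dn0) rE.
have [m [Q GQ]] := G_gram PS.
rewrite /step_dot /step_norm /step_trace /step_form.
apply: lerD; [apply: lerD; [apply: lerD|]|].
- by rewrite addrAC; exact: ratio_Cauchy.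
- by rewrite addrAC; exact: ratio_Cauchy.
- by rewrite addrAC; exact: ratio_Cauchy.
- exact: psd_ratio_Cauchy GQ.
Qed.

Let D k : R := p%:R - k%:R.

Hypothesis n1p : (n1 < p)%N.

Let p0 : p%:R != 0 :> R.
Proof. by rewrite pnatr_eq0 -lt0n (leq_ltn_trans _ n1p). Qed.

Let Dp k : (k < p)%N -> 0 < D k.
Proof. by move=> kp; rewrite subr_gt0 ltr_nat. Qed.

Lemma traj_dot_lt k : (k < n1)%N ->
  traj_dot k.+1 = traj_dot k + (dotv u t - traj_dot k) / D k.
Proof.
move=> kn; have D0 := Dp (ltn_trans kn n1p).
rewrite /traj_dot (minn_idPl kn) (minn_idPl (ltnW kn)) -natr1 /D.
by field; rewrite p0 -/(D k) gt_eqF.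
Qed.

Lemma traj_dot_ge k : (n1 <= k)%N -> traj_dot k.+1 = traj_dot k.
Proof. by move=> nk; rewrite /traj_dot !(minn_idPr _)// leqW. Qed.

Lemma traj_norm_lt k : (k < n1)%N ->
  traj_norm k.+1 = traj_norm k + (dotv t t - traj_norm k) / D k.
Proof.
move=> kn; have D0 := Dp (ltn_trans kn n1p).
rewrite /traj_norm kn (ltnW kn) -natr1 /D.
by field; rewrite p0 -/(D k) gt_eqF.
Qed.

Lemma traj_norm_ge k : (n1 <= k)%N -> (k < p)%N ->
  traj_norm k.+1 = traj_norm k + traj_norm k / D k.
Proof.
move=> nk kp; have D0 := Dp kp.
have D1 : p%:R - k%:R + 1 != 0 :> R by rewrite gt_eqF// addr_gt0.
have E : traj_norm k = n1%:R / p%:R * ((p%:R - n1%:R + 1) / (p%:R - k%:R + 1)) * dotv t t.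
  rewrite /traj_norm; case: ifP => // kn; have -> : n1 = k by apply/eqP; rewrite eqn_leq nk.
  by field; rewrite D1 p0.
rewrite E /traj_norm ltnNge nk /= -natr1 /D.
have -> : p%:R - (k%:R + 1) + 1 = p%:R - k%:R :> R by ring.
by field; rewrite D1 p0 -/(D k) gt_eqF.
Qed.

Lemma traj_trace_step k : (k < p)%N ->
  traj_trace k.+1 = traj_trace k + (1 + traj_trace k) / D k.
Proof.
move=> kp; have D0 := Dp kp.
have D1 : p%:R - k%:R + 1 != 0 :> R by rewrite gt_eqF// addr_gt0.
rewrite /traj_trace -natr1 /D.
have -> : p%:R - (k%:R + 1) + 1 = p%:R - k%:R :> R by ring.
by field; rewrite D1 -/(D k) gt_eqF.
Qed.

Lemma target_lt k : (k < n1)%N -> target k = 1. Proof. by rewrite /target => ->. Qed.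
Lemma target_ge k : (n1 <= k)%N -> target k = 0.
Proof. by rewrite /target ltnNge => ->. Qed.

(** The mean of the new deviation is the old one times [1 - 1 / D], 1 or [1 + 1 / D]; since [D]
    is of order [p], the growth over all steps is bounded. *)
Lemma drift_dot k S Pi G y : (k < p)%N -> state_ok k S Pi G y ->
  (dotv u y - traj_dot k.+1 + dotv (Pi *m u) (residual k y) / D k) ^+ 2 <=
  (1 + (D k)^-1) ^+ 2 * (dotv u y - traj_dot k) ^+ 2.
Proof.
move=> kp [PS Piy yE]; have D0 := Dp kp.
have i0 : 0 < (D k)^-1 by rewrite invr_gt0.
have E : dotv (Pi *m u) (residual k y) = target k * dotv u (Pi *m t).
  have psym a b : dotv (Pi *m a) b = dotv a (Pi *m b).
    by rewrite [RHS]dotv_mull (Pi_sym PS).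
  by rewrite /residual dotvBr dotvZr !psym Piy dotv0r subr0.
rewrite E; case: (ltnP k n1) => kn.
- rewrite traj_dot_lt// target_lt// mul1r.
  have -> : dotv u (Pi *m t) = dotv u t - dotv u y.
    by rewrite (yE (ltnW kn)) dotvBr subKr.
  set a := dotv u y; set b := dotv u t; set l := traj_dot k.
  have -> : a - (l + (b - l) / D k) + (b - a) / D k = (1 - (D k)^-1) * (a - l).
    by field; rewrite gt_eqF.
  rewrite exprMn ler_wpM2r ?sqr_ge0//; nra.
- rewrite traj_dot_ge// target_ge// mul0r mul0r addr0 ler_peMl ?sqr_ge0//; nra.
Qed.

Lemma drift_norm k S Pi G y : (k < p)%N -> state_ok k S Pi G y ->
  (dotv y y - traj_norm k.+1 + dotv (residual k y) (residual k y) / D k) ^+ 2 <=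
  (1 + (D k)^-1) ^+ 2 * (dotv y y - traj_norm k) ^+ 2 /\
  dotv (residual k y) (residual k y) <= dotv t t + dotv y y.
Proof.
move=> kp [PS Piy yE]; have D0 := Dp kp.
have i0 : 0 < (D k)^-1 by rewrite invr_gt0.
have yy := dotv_ge0 y; have tt := dotv_ge0 t.
case: (ltnP k n1) => kn.
- have y_ := yE (ltnW kn).
  have E : dotv (residual k y) (residual k y) = dotv t t - dotv y y.
    rewrite /residual target_lt// scale1r.
    have -> : t - y = Pi *m t by rewrite y_ subKr.
    have tp : dotv (Pi *m t) (Pi *m t) = dotv t (Pi *m t).
      by rewrite dotv_mull (Pi_sym PS) mulmxA (Pi_idem PS) dotvC.
    by rewrite y_ !dotvE tp (dotvC (Pi *m t) t); ring.
  rewrite E traj_norm_lt//; split; last by lra.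
  set a := dotv y y; set b := dotv t t; set l := traj_norm k.
  have -> : a - (l + (b - l) / D k) + (b - a) / D k = (1 - (D k)^-1) * (a - l).
    by field; rewrite gt_eqF.
  rewrite exprMn ler_wpM2r ?sqr_ge0//; nra.
- have E : dotv (residual k y) (residual k y) = dotv y y.
    by rewrite /residual target_ge// scale0r sub0r dotvNl dotvNr opprK.
  rewrite E traj_norm_ge//; split; last by lra.
  set a := dotv y y; set l := traj_norm k.
  have -> : a - (l + l / D k) + a / D k = (1 + (D k)^-1) * (a - l).
    by field; rewrite gt_eqF.
  by rewrite exprMn.
Qed.

Lemma drift_trace k G : (k < p)%N ->
  (\tr G - traj_trace k.+1 + (1 + \tr G) / D k) ^+ 2 =
  (1 + (D k)^-1) ^+ 2 * (\tr G - traj_trace k) ^+ 2.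
Proof.
move=> kp; have D0 := Dp kp; rewrite traj_trace_step// -exprMn; congr (_ ^+ 2).
by field; rewrite gt_eqF.
Qed.

End energy.

Section energy_mean.
Context d (T : measurableType d) (R : realType) (P : probability T R).
Context (p n1 : nat) (u t : 'cV[R]_p) (z : T -> 'cV[R]_p) (K : R).
Hypothesis K0 : 0 <= K.
Hypothesis mz : mx_meas z.
Hypothesis mean2 : forall (M : 'M[R]_p) (a : R),
  mean_le P (fun w => (a + (dotv (z w) (M *m z w) - \tr M)) ^+ 2)
    (a ^+ 2 + K * frob2 M).
Hypotheses (u1 : dotv u u <= 1) (t1 : dotv t t <= 1) (n1p : (n1 < p)%N).

(** Collects the growth of the deviations, first bracket, and the variances and remainders,
    whose weights are all at most [8 / c^2] times [dl^2 / p]. *)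
Definition step_const (c A : R) : R :=
  (1 + 4 * c^-1 + 2 * c^-1 ^+ 2) + 24 * (8 / c ^+ 2) * (1 + K) * (1 + A ^+ 2).

Let growth (c x y : R) : 0 < c -> 0 <= x -> x <= 1 -> 0 <= y -> y <= c^-1 * x ->
  (1 + x) * (1 + y) ^+ 2 <= 1 + (1 + 4 * c^-1 + 2 * c^-1 ^+ 2) * x.
Proof.
move=> c0; have : 0 < c^-1 by rewrite invr_gt0.
move: c^-1 => b b0 x0 x1 y0 yx.
have bx0 : 0 <= b * x by rewrite mulr_ge0// ltW.
have h : (1 + y) ^+ 2 <= (1 + b * x) ^+ 2.
  by rewrite lerXn2r ?nnegrE ?addr_ge0// lerD2l.
apply: (@le_trans _ _ ((1 + x) * (1 + b * x) ^+ 2)); first by rewrite ler_wpM2l// addr_ge0.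
have -> : (1 + x) * (1 + b * x) ^+ 2 = 1 + x * (1 + 2 * b * (1 + x) + b ^+ 2 * (x + x ^+ 2)) by ring.
rewrite lerD2l mulrC ler_wpM2r//.
have h1 : x ^+ 2 <= 1 by rewrite expr_le1.
have h2 : b * x <= b by rewrite -[leRHS]mulr1 ler_wpM2l// ltW.
have b2 : 0 <= b ^+ 2 by exact: sqr_ge0.
have h3 : b ^+ 2 * (x + x ^+ 2) <= b ^+ 2 * 2 by rewrite ler_wpM2l//; lra.
nra.
Qed.

(** The variances are quadratic in [y^T y] and [tr G], which are bounded by their limits plus
    their deviations, so that they are bounded by a constant plus the energy. *)
Let collect (A a3 a4 s tau Phi : R) : 1 <= A -> 0 <= s -> 0 <= tau ->
  s <= 1 + A + a3 -> tau <= A + a4 -> a3 ^+ 2 + a4 ^+ 2 <= Phi ->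
  K * (s + s ^+ 2 + tau ^+ 2 + tau) + (1 + K) * (s + s ^+ 2) + ((1 + tau) ^+ 2 + K * tau ^+ 2)
    + (1 + K) * (1 + tau ^+ 2) + (2 + K) <= 24 * (1 + K) * (1 + A ^+ 2 + Phi).
Proof.
move=> A1 s0 tau0 sA tA aPhi; have K1 : 0 <= 1 + K by rewrite addr_ge0.
have A0 : 0 <= A by rewrite (le_trans _ A1).
have S2 : s ^+ 2 <= 3 * (1 + A ^+ 2 + a3 ^+ 2).
  have : s ^+ 2 <= (1 + A + a3) ^+ 2 by rewrite lerXn2r ?nnegrE// (le_trans s0).
  by have := sqr_ge0 (1 - A); have := sqr_ge0 (1 - a3); have := sqr_ge0 (A - a3); lra.
have T2 : tau ^+ 2 <= 2 * (A ^+ 2 + a4 ^+ 2).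
  have : tau ^+ 2 <= (A + a4) ^+ 2 by rewrite lerXn2r ?nnegrE// (le_trans tau0).
  by have := sqr_ge0 (A - a4); lra.
have s1 := sqr_ge0 (s - 1); have t1' := sqr_ge0 (tau - 1).
have s2 := sqr_ge0 s; have t2 := sqr_ge0 tau; have A2 := sqr_ge0 A.
have a32 := sqr_ge0 a3; have a42 := sqr_ge0 a4.
set q := 1 + s + s ^+ 2 + tau + tau ^+ 2.
have q0 : 0 <= q by rewrite /q !addr_ge0.
apply: (@le_trans _ _ ((1 + K) * (7 + 3 * s ^+ 2 + 6 * tau ^+ 2))); last first.
  rewrite [24 * _]mulrC -mulrA ler_wpM2l//; lra.
have h1 : 0 <= K * (1 + 2^-1 * s ^+ 2 + 2^-1 * tau ^+ 2 - s - tau).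
  by rewrite mulr_ge0//; lra.
have h2 : 0 <= (1 + K) * (1 + s ^+ 2 - 2 * s) by rewrite mulr_ge0//; lra.
have h3 : 0 <= K * tau ^+ 2 by rewrite mulr_ge0.
have h4 : 0 <= K * s ^+ 2 by rewrite mulr_ge0.
nra.
Qed.

(** One step of the Gronwall recursion. The weight [1 / p] in the Cauchy inequalities makes the
    factor [1 + O(1 / p)], and the remainder [kappa] is [O(dl^2 / p)] since [D] is of order
    [p]. *)
Lemma energy_step_mean (c A dl : R) k S Pi G y :
  0 < c -> 1 <= A -> p%:R^-1 <= dl ^+ 2 -> dl ^+ 2 <= 1 ->
  (k < p)%N -> c * p%:R <= p%:R - k%:R ->
  0 <= traj_norm n1 t k <= A -> 0 <= traj_trace R p k <= A ->
  state_ok n1 t k S Pi G y ->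
  mean_le P (fun w => energy_bound n1 u t p%:R^-1 (p%:R - k%:R)
      (kappa p%:R^-1 (p%:R - k%:R) dl) k Pi G y (z w))
    ((1 + step_const c A / p%:R) * energy n1 u t k G y + step_const c A * dl ^+ 2 / p%:R).
Proof.
move=> c0 A1 pdl dl1 kp cD /andP[ln0 lnA] /andP[lt0 ltA] ok.
have [PS Piy yE] := ok.
have [D DE] : exists D : R, D = p%:R - k%:R by eexists.
have [e eE] : exists e : R, e = p%:R^-1 by eexists.
pose r := residual n1 t k y; rewrite -DE -eE in cD pdl *.
have p0 : 0 < p%:R :> R by rewrite ltr0n (leq_ltn_trans _ n1p).
have e0 : 0 < e by rewrite eE invr_gt0.
have D0 : 0 < D by rewrite DE subr_gt0 ltr_nat.
have e1 : e <= 1 by rewrite eE invf_le1// ler1n -(ltr0n R).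
have kap0 : 0 <= kappa e D dl.
  rewrite /kappa mulr_ge0// ?addr_ge0// ?invr_ge0 ?(ltW e0)//.
  by rewrite divr_ge0 ?sqr_ge0// mulr_ge0// sqr_ge0.
have d2 := drift_dot u n1p kp ok.
have [d3 rs] := drift_norm n1p kp ok.
have d4 := drift_trace G kp.
rewrite /= -DE -/r in d2 d3 d4 rs.
apply: mean_le_weak; last first.
  apply: mean_leD; [apply: mean_leD; [apply: mean_leD|]|].
  - by apply: mean_step_dot; [exact: K0|exact: mean2|exact: PS|exact: u1|exact: e0|exact: kap0].
  - exact: mean_step_norm.
  - by apply: (mean_step_trace K0 mean2 PS).
  - by apply: (mean_step_form K0 mz mean2 PS u1).
have trG0 : 0 <= \tr G by have [m [Q ->]] := G_gram PS; exact: tr_gram_ge0.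
have H0 : 0 <= dotv u (G *m u).
  by have [m [Q ->]] := G_gram PS; rewrite dotv_gram dotv_ge0.
rewrite -/r; set s := dotv r r in rs d3 *; set tau := \tr G in trG0 d4 *.
set V2 := (_ + dotv _ r / D) ^+ 2 in d2 *; set V3 := (_ + s / D) ^+ 2 in d3 *.
set V4 := (_ + (1 + tau) / D) ^+ 2 in d4 *; set H := dotv u (G *m u) in H0 *.

have [i2 iE] : exists i2, i2 = (D ^+ 2)^-1 by eexists.
have i20 : 0 <= i2 by rewrite iE invr_ge0 sqr_ge0.
have [eta etaE] : exists eta : R, eta = dl ^+ 2 * e by eexists.
have eta0 : 0 <= eta by rewrite etaE mulr_ge0 ?sqr_ge0// ltW.
have etae : eta <= e by rewrite etaE -[leRHS]mul1r ler_wpM2r// ltW.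
have ee : e ^+ 2 <= eta by rewrite expr2 etaE ler_wpM2r// ltW.
have [kk kkE] : exists kk : R, kk = 8 / c ^+ 2 by eexists.
have kk0 : 0 <= kk by rewrite kkE divr_ge0 ?sqr_ge0.
have i2e : i2 <= kk / 8 * e ^+ 2.
  have -> : kk / 8 * e ^+ 2 = ((c * p%:R) ^+ 2)^-1.
    by rewrite kkE eE; field; rewrite !gt_eqF.
  rewrite iE lef_pV2 ?posrE ?exprn_gt0// ?mulr_gt0//.
  by rewrite lerXn2r ?nnegrE ?(ltW D0)// mulr_ge0// ltW.
have i2eta : i2 <= kk / 8 * eta.
  by apply: (le_trans i2e); rewrite ler_wpM2l// divr_ge0.
(* [b1], [b2], [b3]: the three weights multiplying second moments are [O(eta)]. *)
have b1 : (1 + e) * i2 <= kk * eta.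
  have : (1 + e) * i2 <= 2 * i2 by rewrite ler_wpM2r//; lra.
  have : 0 <= kk * eta by rewrite mulr_ge0.
  by lra.
have b2 : kappa e D dl <= kk * eta.
  rewrite /kappa -iE.
  have -> : (1 + e^-1) * (4 * dl ^+ 2 * i2) = 4 * dl ^+ 2 * (1 + e) * (e^-1 * i2).
    by field; rewrite gt_eqF.
  have h : e^-1 * i2 <= kk / 8 * e.
    have -> : kk / 8 * e = e^-1 * (kk / 8 * e ^+ 2) by field; rewrite gt_eqF.
    by rewrite ler_wpM2l// invr_ge0 ltW.
  have h' : (1 + e) * (e^-1 * i2) <= 2 * (kk / 8 * e).
    have n0 : 0 <= e^-1 * i2 by rewrite mulr_ge0// invr_ge0 ltW.
    by apply: ler_pM => //; [rewrite addr_ge0// ltW|lra].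
  have -> : kk * eta = 4 * dl ^+ 2 * (2 * (kk / 8 * e)) by rewrite etaE; field.
  by rewrite -mulrA ler_wpM2l// mulr_ge0// sqr_ge0.
have b3 : 4 * i2 <= kk * eta.
  have : 0 <= kk * eta by rewrite mulr_ge0.
  lra.
have L0 : (1 + e) * (1 + D^-1) ^+ 2 <= 1 + (1 + 4 * c^-1 + 2 * c^-1 ^+ 2) * e.
  apply: growth => //; rewrite ?(ltW e0)// ?invr_ge0 ?(ltW D0)//.
  rewrite eE -invfM [c * _]mulrC lef_pV2 ?posrE ?mulr_gt0//.
  by rewrite mulrC.
set a2 := (dotv u y - traj_dot n1 u t k) ^+ 2 in d2.
set a3 := dotv y y - traj_norm n1 t k in d3.
set a4 := tau - traj_trace R p k in d4.
have PhiE : energy n1 u t k G y = a2 + a3 ^+ 2 + a4 ^+ 2 + H by [].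
set Phi := energy n1 u t k G y in PhiE *.
have a20 : 0 <= a2 by exact: sqr_ge0.
have a30 : 0 <= a3 ^+ 2 by exact: sqr_ge0.
have a40 : 0 <= a4 ^+ 2 by exact: sqr_ge0.
have s0 : 0 <= s by exact: dotv_ge0.
have sA : s <= 1 + A + a3.
  (* [A] bounds the trajectory, hence [a3] measures the excess of [y^T y] over it. *)
  have -> : 1 + A + a3 = 1 + dotv y y + (A - traj_norm n1 t k) by rewrite /a3; ring.
  by rewrite (le_trans rs)// -[leLHS]addr0 lerD ?lerD2r ?subr_ge0.
have tA : tau <= A + a4.
  have -> : A + a4 = tau + (A - traj_trace R p k) by rewrite /a4; ring.
  by rewrite lerDl subr_ge0.
have cl := collect A1 s0 trG0 sA tA (_ : a3 ^+ 2 + a4 ^+ 2 <= Phi).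
have {cl} : K * (s + s ^+ 2 + tau ^+ 2 + tau) + (1 + K) * (s + s ^+ 2) +
  ((1 + tau) ^+ 2 + K * tau ^+ 2) + (1 + K) * (1 + tau ^+ 2) +
  (2 + K) <= 24 * (1 + K) * (1 + A ^+ 2 + Phi) by apply: cl; rewrite PhiE; lra.
set q1 := K * _; set q2 := (1 + K) * (s + _); set q3 := (1 + tau) ^+ 2 + _.
set q4 := (1 + K) * (1 + _) => cl.
have q10 : 0 <= q1 by rewrite mulr_ge0// !addr_ge0 ?sqr_ge0.
have K1 : 0 <= 1 + K by rewrite addr_ge0.
have q20 : 0 <= q2 by rewrite mulr_ge0// addr_ge0 ?sqr_ge0.
have q30 : 0 <= q3 by rewrite addr_ge0 ?sqr_ge0// mulr_ge0 ?sqr_ge0.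
have q40 : 0 <= q4 by rewrite mulr_ge0// addr_ge0 ?sqr_ge0.
have c1 := ler_wpM2r q10 b1; have c2 := ler_wpM2r (addr_ge0 (addr_ge0 q20 q30) q40) b2.
have c3 := ler_wpM2r (_ : 0 <= 2 + K) b3.
have {}c3 : 4 * i2 * (2 + K) <= kk * eta * (2 + K) by apply: c3; rewrite addr_ge0.
have ke0 : 0 <= kk * eta by rewrite mulr_ge0.
have c4 := ler_wpM2l ke0 cl.
have Phi0 : 0 <= Phi by rewrite PhiE !addr_ge0.
have c5 := ler_wpM2r Phi0 L0.
have e10 : 0 <= 1 + e by rewrite addr_ge0// ltW.
have c6 : (1 + e) * (V2 + V3 + V4 + H) <= (1 + e) * (1 + D^-1) ^+ 2 * Phi.
  rewrite -mulrA ler_wpM2l// d4 PhiE; set L := (1 + D^-1) ^+ 2 in d2 d3 *.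
  have L1 : 1 <= L by rewrite exprn_ege1// lerDl invr_ge0 ltW.
  have : H <= L * H by rewrite ler_peMl.
  lra.
have c7 : kk * eta * (24 * (1 + K) * (1 + A ^+ 2 + Phi)) <=
    24 * kk * (1 + K) * (1 + A ^+ 2) * eta + 24 * kk * (1 + K) * (1 + A ^+ 2) * e * Phi.
  have M0 : 0 <= 24 * kk * (1 + K) by rewrite mulr_ge0// mulr_ge0.
  have -> : kk * eta * (24 * (1 + K) * (1 + A ^+ 2 + Phi)) =
    24 * kk * (1 + K) * (1 + A ^+ 2) * eta + 24 * kk * (1 + K) * (eta * Phi) by ring.
  have -> : 24 * kk * (1 + K) * (1 + A ^+ 2) * e * Phi =
    24 * kk * (1 + K) * ((1 + A ^+ 2) * (e * Phi)) by ring.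
  rewrite lerD2l.
  rewrite ler_wpM2l//; apply: (@le_trans _ _ (e * Phi)); first by rewrite ler_wpM2r.
  by rewrite ler_peMl ?mulr_ge0// ?(ltW e0)// lerDl sqr_ge0.
have cst : 24 * (8 / c ^+ 2) * (1 + K) * (1 + A ^+ 2) = 24 * kk * (1 + K) * (1 + A ^+ 2).
  by rewrite kkE.
have c8 : 0 <= (1 + 4 * c^-1 + 2 * c^-1 ^+ 2) * eta.
  have c'0 : 0 <= c^-1 by rewrite invr_ge0 ltW.
  by rewrite mulr_ge0// !addr_ge0// mulr_ge0// sqr_ge0.
rewrite -iE /step_const cst -[_ * dl ^+ 2 * e]mulrA -etaE.
set M := 24 * kk * (1 + K) * (1 + A ^+ 2) in c7 *.
set N := 1 + 4 * c^-1 + _ in c5 c8 *.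
have : (1 + e) * (V2 + K * s * i2) + kappa e D dl * ((1 + K) * s) +
   ((1 + e) * (V3 + K * s ^+ 2 * i2) + kappa e D dl * ((1 + K) * s ^+ 2)) +
   ((1 + e) * (V4 + K * tau ^+ 2 * i2) + kappa e D dl * q3) +
   ((1 + e) * (H + K * tau * i2) + kappa e D dl * q4 + 4 * i2 * (2 + K)) =
   (1 + e) * (V2 + V3 + V4 + H) + (1 + e) * i2 * q1 + kappa e D dl * (q2 + q3 + q4) +
   4 * i2 * (2 + K) by rewrite /q1 /q2; ring.
move=> ->; lra.
Qed.

End energy_mean.

(** * The run over the rows of the design *)

Section run.
Context (R : realType) (p n1 : nat) (t : 'cV[R]_p) (dl : R).
Implicit Types (x : nat -> 'cV[R]_p) (k : nat).

Fixpoint runS x k : 'M[R]_p := if k is k'.+1 then runS x k' + outer (x k') (x k') else 0.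

Fixpoint runPi x k : 'M[R]_p := if k is k'.+1 then upd_Pi (runPi x k') (x k') else 1%:M.

Fixpoint runG x k : 'M[R]_p :=
  if k is k'.+1 then upd_G (runPi x k') (runG x k') (x k') else 0.

Fixpoint runy x k : 'cV[R]_p :=
  if k is k'.+1 then upd_y (runPi x k') (runy x k') (x k') (target R n1 k' * dotv (x k') t)
  else 0.

(** The only denominator in the updates; its mean given the earlier rows is [p - k]. *)
Definition gap x k : R := dotv (x k) (runPi x k *m x k).

Definition gap_ok x k : bool := `|gap x k - (p%:R - k%:R)| <= dl * (p%:R - k%:R).

Fixpoint good x k : bool := if k is k'.+1 then good x k' && gap_ok x k' else true.

Hypotheses (dl0 : 0 <= dl) (dl1 : dl <= 2^-1).

Lemma gap_ok_gt0 x k : (k < p)%N -> gap_ok x k -> 0 < gap x k.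
Proof.
move=> kp ck; have D0 : (0 : R) < p%:R - k%:R by rewrite subr_gt0 ltr_nat.
by have [] := inv_gap D0 dl0 dl1 ck.
Qed.

(** The orthogonality relations [x_i^T G x_j = (i == j)] are the entries of
    [Z (Z^T Z)^+ Z^T = 1] for the matrix [Z] of the rows; they hold since no [gap] vanishes. *)
Lemma good_state x k : (n1 < p)%N -> (k <= p)%N -> good x k ->
  [/\ state_ok n1 t k (runS x k) (runPi x k) (runG x k) (runy x k),
      \tr (runPi x k) = p%:R - k%:R,
      forall i, (i < k)%N -> runPi x k *m x i = 0 &
      forall i j, (i < k)%N -> (j < k)%N -> dotv (x i) (runG x k *m x j) = (i == j)%:R].
Proof.
move=> n1p; elim: k => [_ _|k ih kp /= /andP[gk ck]].
  split=> //=; last by rewrite mxtrace1 subr0.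
  split; [exact: projection_state0|by rewrite mulmx0|by rewrite mul1mx subrr].
have [[PS Piy yE] trPi Pix xGx] := ih (ltnW kp) gk.
have gn0 := lt0r_neq0 (gap_ok_gt0 kp ck); rewrite /gap in gn0.
have GT := G_sym PS; have PiT := Pi_sym PS.
set z := x k in gn0 *; set Pi := runPi x k in PS Piy yE trPi Pix gn0 *.
set G := runG x k in PS xGx GT *.
have xc i : (i < k)%N -> dotv (x i) (Pi *m z) = 0.
  by move=> ik; rewrite dotv_mull PiT Pix// dotv0l.
have cx i : (i < k)%N -> dotv (Pi *m z) (x i) = 0 by rewrite dotvC; exact: xc.
have Piz' : upd_Pi Pi z *m z = 0.
  rewrite /upd_Pi mulmxBl -scalemxAl outerv (dotvC _ z) scalerA mulVf//.
  by rewrite scale1r subrr.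
have cm : dotv (Pi *m z) (G *m z) = 0.
  by rewrite dotv_mull GT mulmxA (G_Pi PS) mul0mx dotv0l.
have Gz' : upd_G Pi G z *m z = (dotv z (Pi *m z))^-1 *: (Pi *m z).
  rewrite /upd_G mulmxDl mulmxBl -!scalemxAl mulmxDl !outerv (dotvC (Pi *m z) z).
  rewrite (dotvC (G *m z) z); set d := dotv z (Pi *m z) in gn0 *.
  by apply/matrixP => i j; rewrite !mxE; field.
have x'G' i : (i < k)%N -> dotv (x i) (upd_G Pi G z *m z) = 0.
  by move=> ik; rewrite Gz' dotvZr xc// mulr0.
have PS' := projection_state_step PS gn0.
split.
- split=> //; first by apply: (upd_y_ker PS).
  move=> kn1; rewrite /target kn1 mul1r.
  by apply: (upd_y_full z PS); exact: yE (ltnW kn1).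
- by rewrite (upd_Pi_trace PS gn0) trPi -natr1; ring.
- move=> i; rewrite ltnS leq_eqVlt => /orP[/eqP ->|ik]; first exact: Piz'.
  rewrite /upd_Pi mulmxBl -scalemxAl outerv Pix// cx//.
  by rewrite scale0r scaler0 subr0.
- move=> i j; rewrite !ltnS [(i <= k)%N]leq_eqVlt [(j <= k)%N]leq_eqVlt.
  move=> /orP[/eqP ->|ik] /orP[/eqP ->|jk].
  + by rewrite -/z Gz' dotvZr mulVf// eqxx.
  + by rewrite dotv_mull (G_sym PS') dotvC x'G'// gtn_eqF.
  + by rewrite -/z x'G'// ltn_eqF.
  + rewrite /upd_G mulmxDl mulmxBl -!scalemxAl mulmxDl !outerv !cx//.
    rewrite !scale0r add0r scaler0 addr0 dotvBr !dotvZr (xc i)// !mulr0 subr0.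
    exact: xGx.
Qed.

Lemma good_prefix x i k : (i <= k)%N -> good x k -> good x i.
Proof.
elim: k => [|k ih]; first by rewrite leqn0 => /eqP ->.
by rewrite leq_eqVlt => /orP[/eqP ->//|]; rewrite ltnS => ik /= /andP[/(ih ik)].
Qed.

(** The response part: [y] is the projection of [t] up to [n1], which is [G S t], and then
    solves normal equations of constant right-hand side. *)
Lemma good_solution x k : (n1 < p)%N -> (n1 <= k <= p)%N -> good x k ->
  runS x n1 *m runPi x k = 0 /\ runy x k = runG x k *m (runS x n1 *m t).
Proof.
move=> n1p /andP[]; elim: k => [|k ih].
  by rewrite leqn0 => /eqP -> _ _; rewrite /= !mul0mx.
rewrite leq_eqVlt => /orP[/eqP n1E kp gk|].
  have [[PS _ yE] _ _ _] := good_state n1p kp gk.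
  rewrite n1E; split; first exact: S_Pi PS.
  have GS : runG x k.+1 *m runS x k.+1 = 1%:M - runPi x k.+1.
    have := congr1 trmx (S_G PS).
    by rewrite trmx_mul (G_sym PS) (S_sym PS) linearB/= trmx1 (Pi_sym PS).
  have GSt : runG x k.+1 *m (runS x k.+1 *m t) = t - runPi x k.+1 *m t.
    by rewrite mulmxA GS; move: (runPi x k.+1) => Q; rewrite mulmxBl mul1mx.
  by rewrite GSt; apply: yE; rewrite n1E.
rewrite ltnS => nk kp gk; have /= /andP[gk' ck] := gk.
have [[PS Piy _] _ _ _] := good_state n1p (ltnW kp) gk'.
have [SPi yE] := ih nk (ltnW kp) gk'.
have gn0 := lt0r_neq0 (gap_ok_gt0 kp ck).
have [[PS1 _ _] _ _ _] := good_state n1p (ltnW n1p) (good_prefix nk gk').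
have -> : target R n1 k * dotv (x k) t = 0 by rewrite /target ltnNge nk mul0r.
exact: (upd_y_solve PS gn0 (S_sym PS1) SPi yE).
Qed.

End run.

Section measurable_run.
Context d (T : measurableType d) (R : realType) (p n1 : nat) (u t : 'cV[R]_p) (dl : R).
Variable x : T -> nat -> 'cV[R]_p.

Lemma mx_meas_upd_Pi (Pi : T -> 'M[R]_p) (z : T -> 'cV[R]_p) :
  mx_meas Pi -> mx_meas z -> mx_meas (fun w => upd_Pi (Pi w) (z w)).
Proof.
move=> mP mz; have mc := mx_measM mP mz.
by apply: mx_measB => //; apply: mx_measZ (mx_meas_outer mc mc); exact/meas_inv/meas_dotv.
Qed.

Lemma mx_meas_upd_G (Pi G : T -> 'M[R]_p) (z : T -> 'cV[R]_p) :
  mx_meas Pi -> mx_meas G -> mx_meas z -> mx_meas (fun w => upd_G (Pi w) (G w) (z w)).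
Proof.
move=> mP mG mz; have mc := mx_measM mP mz; have mm := mx_measM mG mz.
have md := meas_dotv mz mc.
apply: mx_measD; first apply: mx_measB => //.
  by apply: mx_measZ; [exact: meas_inv|apply: mx_measD; exact: mx_meas_outer].
apply: mx_measZ (mx_meas_outer mc mc); apply: measurable_funM.
  by apply: measurable_funD => //; exact: meas_dotv.
by apply: meas_inv; exact: measurable_funX.
Qed.

Lemma mx_meas_upd_y (Pi : T -> 'M[R]_p) (y z : T -> 'cV[R]_p) l :
  mx_meas Pi -> mx_meas y -> mx_meas z -> measurable_fun setT l ->
  mx_meas (fun w => upd_y (Pi w) (y w) (z w) (l w)).
Proof.
move=> mP my mz ml; have mc := mx_measM mP mz.
apply: mx_measD => //; apply: mx_measZ => //; apply: measurable_funM.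
  by apply: measurable_funB => //; exact: meas_dotv.
by apply: meas_inv; exact: meas_dotv.
Qed.

Lemma meas_bool (b : T -> bool) : measurable_fun setT b ->
  measurable_fun setT (fun w => (b w)%:R : R).
Proof.
by move=> mb; exact: (@measurableT_comp _ _ _ _ _ _ (fun c : bool => c%:R : R)).
Qed.

Lemma meas_run k : (forall i, (i < k)%N -> mx_meas (fun w => x w i)) ->
  [/\ mx_meas (fun w => runPi (x w) k), mx_meas (fun w => runG (x w) k),
      mx_meas (fun w => runy n1 t (x w) k) &
      measurable_fun setT (fun w => good dl (x w) k)].
Proof.
elim: k => [_|k ih mx].
  by split; [exact: mx_meas_cst..|exact: measurable_cst].
have [mP mG my mg] := ih (fun i ik => mx i (ltnW ik)).
have mz := mx k (ltnSn k).
split; [exact: mx_meas_upd_Pi|exact: mx_meas_upd_G|apply: mx_meas_upd_y => //|].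
  by apply: measurable_funM => //; apply: meas_dotv => //; exact: mx_meas_cst.
apply: measurable_and => //; apply: measurable_fun_ler => //.
apply: measurableT_comp => //; apply: measurable_funB => //.
by apply: meas_dotv => //; exact: mx_measM.
Qed.

Lemma meas_energy k (G : T -> 'M[R]_p) (y : T -> 'cV[R]_p) : mx_meas G -> mx_meas y ->
  measurable_fun setT (fun w => energy n1 u t k (G w) (y w)).
Proof.
move=> mG my; have mu : mx_meas (fun _ : T => u) by exact: mx_meas_cst.
apply: measurable_funD; first apply: measurable_funD; first apply: measurable_funD.
- by apply: measurable_funX; apply: measurable_funB => //; exact: meas_dotv.
- by apply: measurable_funX; apply: measurable_funB => //; exact: meas_dotv.
- by apply: measurable_funX; apply: measurable_funB => //; exact: meas_mxtrace.
- by apply: meas_dotv => //; exact: mx_measM.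
Qed.

Lemma meas_energy_bound e D kap k (Pi G : T -> 'M[R]_p) (y z : T -> 'cV[R]_p) :
  mx_meas Pi -> mx_meas G -> mx_meas y -> mx_meas z ->
  measurable_fun setT (fun w => energy_bound n1 u t e D kap k (Pi w) (G w) (y w) (z w)).
Proof.
move=> mP mG my mz; have mu : mx_meas (fun _ : T => u) by exact: mx_meas_cst.
have mr : mx_meas (fun w => residual n1 t k (y w)) by apply: mx_measB => //; exact: mx_meas_cst.
have mc := meas_dotv (mx_measM mP mz) mu; have mzr := meas_dotv mz mr.
have mzG := meas_dotv mz (mx_measM mG mz).
have m1 : measurable_fun setT (fun w => dotv (Pi w *m z w) u * dotv (z w) (residual n1 t k (y w))).
  exact: measurable_funM.
have mi : measurable_fun [set: T] (fun=> D^-1) by exact: measurable_cst.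
have m2 : measurable_fun setT (fun w => 1 + dotv (z w) (G w *m z w)).
  exact: measurable_funD.
have mv : mx_meas (fun w => u - (dotv (Pi w *m z w) u / D) *: z w).
  by apply: mx_measB => //; apply: mx_measZ => //; exact: measurable_funM.
rewrite /energy_bound /step_dot /step_norm /step_trace /step_form.
have comb (f N : T -> R) c a b : measurable_fun setT f -> measurable_fun setT N ->
    measurable_fun setT (fun w => a * (f w - c + N w / D) ^+ 2 + b * N w ^+ 2).
  move=> mf mN; apply: measurable_funD; apply: measurable_funM => //; apply: measurable_funX => //.
  by apply: measurable_funD; [exact: measurable_funB|exact: measurable_funM].
apply: measurable_funD; first apply: measurable_funD; first apply: measurable_funD.
- by apply: comb => //; exact: meas_dotv.
- by apply: comb; [exact: meas_dotv|exact: measurable_funX].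
- by apply: comb => //; exact: meas_mxtrace.
- apply: measurable_funD; last by apply: measurable_funM => //; exact: measurable_funX.
  apply: measurable_funD; apply: measurable_funM => //.
    by apply: meas_dotv => //; exact: mx_measM.
  by apply: measurable_funM => //; exact: measurable_funX.
Qed.

End measurable_run.

Section energy_bound_sign.
Context (R : realType) (p n1 : nat) (u t : 'cV[R]_p).

Lemma energy_ge0 k m (Q : 'M[R]_(m, p)) y : 0 <= energy n1 u t k (Q^T *m Q) y.
Proof. by rewrite /energy dotv_gram !addr_ge0 ?sqr_ge0 ?dotv_ge0. Qed.

Lemma energy_bound_ge0 (e D kap : R) k Pi m (Q : 'M[R]_(m, p)) y z : 0 <= e -> 0 <= kap ->
  0 <= energy_bound n1 u t e D kap k Pi (Q^T *m Q) y z.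
Proof.
move=> e0 k0; have e1 : 0 <= 1 + e by rewrite addr_ge0.
have sq (a b : R) : 0 <= (1 + e) * a ^+ 2 + kap * b ^+ 2.
  by rewrite addr_ge0// mulr_ge0// sqr_ge0.
rewrite /energy_bound; apply: addr_ge0; first by apply: addr_ge0; [apply: addr_ge0|]; exact: sq.
rewrite /step_form !dotv_gram; apply: addr_ge0; last by rewrite mulr_ge0 ?sqr_ge0// divr_ge0 ?sqr_ge0.
by rewrite addr_ge0// mulr_ge0 ?dotv_ge0// mulr_ge0 ?dotv_ge0// sqr_ge0.
Qed.

End energy_bound_sign.

Section limits_bounded.
Context (R : realType) (p n1 : nat) (t : 'cV[R]_p) (c : R).
Hypotheses (c0 : 0 < c) (n1p : (n1 < p)%N) (t1 : dotv t t <= 1).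

Lemma traj_norm_bound k : c * p%:R <= p%:R - k%:R -> 0 <= traj_norm n1 t k <= 2 / c.
Proof.
move=> cD; have p0 : 0 < p%:R :> R by rewrite ltr0n (leq_ltn_trans _ n1p).
have n0 : 0 <= n1%:R :> R by []. have k0 : 0 <= k%:R :> R by [].
have np : n1%:R <= p%:R :> R by rewrite ler_nat ltnW.
have cp : 0 < c * p%:R by rewrite mulr_gt0.
have c1 : 1 <= 2 / c.
  rewrite ler_pdivlMr// mul1r; have : c * p%:R <= 1 * p%:R by lra.
  by rewrite ler_pM2r//; lra.
have tt := dotv_ge0 t.
suff h : forall q : R, 0 <= q <= 2 / c -> 0 <= q * dotv t t <= 2 / c.
  rewrite /traj_norm; case: ifP => kn; apply: h.
    have kp : k%:R <= p%:R :> R by rewrite ler_nat (leq_trans kn)// ltnW.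
    rewrite divr_ge0//= (le_trans _ c1)// ler_pdivrMr// mul1r//.
  have D1 : 0 < p%:R - k%:R + 1 :> R by lra.
  rewrite mulr_ge0 ?divr_ge0//=; [|by rewrite addr_ge0 ?subr_ge0|exact: ltW].
  rewrite mulrA ler_pdivrMr//; apply: (@le_trans _ _ (1 * (2 * p%:R))).
    case: n1 n1p np n0 => [|m] mp np _; first by rewrite !mul0r mul1r mulr_ge0.
    have m1 : 1 <= m.+1%:R :> R by rewrite ler1n.
    move: (m.+1%:R : R) np m1 => a np m1.
    have a0 : 0 <= a / p%:R by rewrite divr_ge0 ?(ltW p0)// (le_trans _ m1).
    have a1 : a / p%:R <= 1 by rewrite ler_pdivrMr// mul1r.
    have h0 : 0 <= p%:R - a + 1 by rewrite addr_ge0// subr_ge0.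
    have h1 : p%:R - a + 1 <= 2 * p%:R by nra.
    exact: ler_pM.
  rewrite mul1r -[2 * p%:R]/(2 * p%:R) -mulrA ler_wpM2l// mulrC ler_pdivlMr//; lra.
move=> q /andP[q0 qc]; rewrite mulr_ge0//= (le_trans _ qc)// -[leRHS]mulr1 ler_wpM2l//.
Qed.

Lemma traj_trace_bound k : c * p%:R <= p%:R - k%:R -> 0 <= traj_trace R p k <= 2 / c.
Proof.
move=> cD; have p0 : 0 < p%:R :> R by rewrite ltr0n (leq_ltn_trans _ n1p).
have cp : 0 < c * p%:R by rewrite mulr_gt0.
have k0 : 0 <= k%:R :> R by [].
have D1 : 0 < p%:R - k%:R + 1 :> R by lra.
rewrite /traj_trace divr_ge0//= ?(ltW D1)// ler_pdivrMr// mulrAC ler_pdivlMr//.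
nra.
Qed.

End limits_bounded.

Lemma step_const_ge0 (R : realType) (K c A : R) : 0 <= K -> 0 < c -> 0 <= step_const K c A.
Proof.
move=> K0 c0; have c'0 : 0 <= c^-1 by rewrite invr_ge0 ltW.
apply: addr_ge0; first by rewrite !addr_ge0// mulr_ge0// sqr_ge0.
have k0 : 0 <= 8 / c ^+ 2 by rewrite divr_ge0 ?sqr_ge0.
have k1 : 0 <= 24 * (8 / c ^+ 2) by rewrite mulr_ge0.
have k2 : 0 <= 24 * (8 / c ^+ 2) * (1 + K) by apply: mulr_ge0 => //; exact: addr_ge0.
by apply: mulr_ge0 => //; rewrite addr_ge0 ?sqr_ge0.
Qed.

Section process.
Context d (T : measurableType d) (R : realType) (P : probability T R).
Variables (n p : nat) (X : 'I_n * 'I_p -> {RV P >-> R}) (C : R).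
Hypothesis C0 : 0 <= C.
Hypothesis iX : independent_vars X.
Hypothesis X2 : forall j (a b c : R),
  (\int[P]_w ((a + b * X j w + c * (X j w ^+ 2 - 1)) ^+ 2)%:E <=
     (a ^+ 2 + C * (b ^+ 2 + c ^+ 2))%:E)%E.
Hypothesis X4 : forall j (a b c : R),
  (\int[P]_w ((a + b * X j w + c * (X j w ^+ 2 - 1)) ^+ 4)%:E <=
     (a ^+ 4 + C * a ^+ 2 * (b ^+ 2 + c ^+ 2) + C * (b ^+ 2 + c ^+ 2) ^+ 2)%:E)%E.

(** Indexed by [nat] to match the recursion; the value beyond [n] is never reached. *)
Definition rows w (k : nat) : 'cV[R]_p :=
  if insub k is Some i then row_vec X (fun j : 'I_p => (i, j)) w else 0.

Lemma rowsE w (i : 'I_n) : rows w i = row_vec X (fun j : 'I_p => (i, j)) w.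
Proof. by rewrite /rows valK. Qed.

Let before k : {set 'I_n * 'I_p} := [set ij : 'I_n * 'I_p | (ij.1 < k)%N]%SET.
Let at_row (k : nat) : {set 'I_n * 'I_p} := [set ij : 'I_n * 'I_p | ij.1 == k :> nat]%SET.

Let before_at k : before k :&: at_row k = finset.set0.
Proof. by apply/setP => ij; rewrite !inE; case: ltngtP. Qed.

Let meas_rows (J : {set 'I_n * 'I_p}) (i : nat) : at_row i \subset J ->
  @mx_meas _ (sub_space X J) R p 1 (fun w => rows w i).
Proof.
move=> /fintype.subsetP iJ a b; rewrite /rows; case: insubP => [i0 _ ii|_]; last first.
  by under eq_fun do rewrite mxE; exact: measurable_cst.
under eq_fun do rewrite mxE.
by apply: meas_onX; apply: iJ; rewrite inE /= ii.
Qed.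

Let meas_before k i : (i < k)%N -> @mx_meas _ (sub_space X (before k)) R p 1 (fun w => rows w i).
Proof.
by move=> ik; apply: meas_rows; apply/fintype.subsetP => ij; rewrite !inE => /eqP ->.
Qed.

Let mx_rows i : mx_meas (fun w => rows w i).
Proof.
by move=> a b; apply: meas_on_measurable; exact: (meas_rows (fintype.subxx (at_row i)) a b).
Qed.

Variables (n1 : nat) (u t : 'cV[R]_p) (dl c : R).
Hypotheses (c0 : 0 < c) (n1p : (n1 < p)%N) (cn : c * p%:R <= p%:R - n%:R).
Hypotheses (u1 : dotv u u <= 1) (t1 : dotv t t <= 1).
Hypotheses (dl0 : 0 < dl) (dl1 : dl <= 2^-1) (pdl : p%:R^-1 <= dl ^+ 2).

Let K := Kquad C.
Let A := 2 / c.
Let Cs := step_const K c A.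
Let g k w : R := (good dl (rows w) k)%:R.
Let en k w := energy n1 u t k (runG (rows w) k) (runy n1 t (rows w) k).

Let p0 : 0 < p%:R :> R. Proof. by rewrite ltr0n (leq_ltn_trans _ n1p). Qed.

Let np : (n < p)%N.
Proof. by rewrite -(ltr_nat R) -subr_gt0 (lt_le_trans _ cn)// mulr_gt0. Qed.

Let ck k : (k < n)%N -> c * p%:R <= p%:R - k%:R.
Proof. by move=> kn; rewrite (le_trans cn)// lerD2l lerN2 ler_nat ltnW. Qed.

Let A1 : 1 <= A.
Proof.
rewrite /A ler_pdivlMr// mul1r.
have : c * p%:R <= 1 * p%:R by rewrite (le_trans cn)// mul1r gerBl.
by rewrite ler_pM2r// => h; rewrite (le_trans h)// ler1n.
Qed.

Let K0 : 0 <= K. Proof. exact: Kquad_ge0. Qed.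
Let dl0' : 0 <= dl. Proof. exact: ltW. Qed.

Let Cs0 : 0 <= Cs.
Proof. exact: step_const_ge0. Qed.

Let state k w : (k <= p)%N -> good dl (rows w) k ->
  state_ok n1 t k (runS (rows w) k) (runPi (rows w) k) (runG (rows w) k) (runy n1 t (rows w) k).
Proof. by move=> kp gk; have [] := good_state t dl0' dl1 n1p kp gk. Qed.

Let meas_T k : [/\ mx_meas (fun w => runPi (rows w) k), mx_meas (fun w => runG (rows w) k),
      mx_meas (fun w => runy n1 t (rows w) k) &
      measurable_fun setT (fun w => good dl (rows w) k)].
Proof. by apply: meas_run => i _; exact: mx_rows. Qed.

Let meas_g k : measurable_fun setT (g k).
Proof. by apply: meas_bool; have [] := meas_T k. Qed.

Let meas_en k : measurable_fun setT (en k).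
Proof. by have [_ mG my _] := meas_T k; exact: meas_energy. Qed.

Let gram k w : (k <= p)%N -> good dl (rows w) k ->
  exists m (Q : 'M[R]_(m, p)), runG (rows w) k = Q^T *m Q.
Proof. by move=> kp gk; have [PS _ _] := state kp gk; exact: G_gram PS. Qed.

Let en0 k w : (k <= p)%N -> 0 <= g k w * en k w.
Proof.
move=> kp; rewrite /g; case gk : (good _ _ _); last by rewrite mul0r.
by have [m [Q GQ]] := gram kp gk; rewrite mul1r /en GQ energy_ge0.
Qed.

Let D k : R := p%:R - k%:R.
Let bound k w z := energy_bound n1 u t p%:R^-1 (D k) (kappa p%:R^-1 (D k) dl) k
  (runPi (rows w) k) (runG (rows w) k) (runy n1 t (rows w) k) z.

Let D0 k : (k < p)%N -> 0 < D k. Proof. by move=> kp; rewrite subr_gt0 ltr_nat. Qed.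

Let bound0 k w z : (k < p)%N -> 0 <= g k w * bound k w z.
Proof.
move=> kp; rewrite /g; case gk : (good _ _ _); last by rewrite mul0r.
have [m [Q GQ]] := gram (ltnW kp) gk; rewrite mul1r /bound GQ; apply: energy_bound_ge0.
  by rewrite invr_ge0 ltW.
rewrite /kappa mulr_ge0 ?addr_ge0// ?invr_ge0 ?invr_ge0 ?(ltW p0)//.
by rewrite divr_ge0 ?sqr_ge0// mulr_ge0 ?sqr_ge0.
Qed.

Let mean2_row k : (k < n)%N -> forall (M : 'M[R]_p) (a : R),
  mean_le P (fun w => (a + (dotv (rows w k) (M *m rows w k) - \tr M)) ^+ 2)
    (a ^+ 2 + K * frob2 M).
Proof.
move=> kn M a; pose i := Ordinal kn.
have inj : injective (fun j : 'I_p => (i, j)) by move=> j1 j2 [].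
have := quad_form_mean2 inj C0 iX X2 M a.
congr (mean_le _ _ _); apply/funext => w.
by rewrite -(rowsE w i).
Qed.

Let mean4_row k : (k < n)%N -> forall (M : 'M[R]_p),
  mean_le P (fun w => (dotv (rows w k) (M *m rows w k) - \tr M) ^+ 4)
    (K * (frob2 M + 1) ^+ 2).
Proof.
move=> kn M; pose i := Ordinal kn.
have inj : injective (fun j : 'I_p => (i, j)) by move=> j1 j2 [].
have := quad_form_mean4 inj C0 iX X2 X4 M.
congr (mean_le _ _ _); apply/funext => w.
by rewrite -(rowsE w i).
Qed.

Let pair_space k := (sub_space X (before k) * sub_space X (at_row k))%type.

(* The state depends on the earlier rows of the first point, the new row on the second. *)
Let meas_joint k : [/\ mx_meas (fun z : pair_space k => runPi (rows z.1) k),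
  mx_meas (fun z : pair_space k => runG (rows z.1) k),
  mx_meas (fun z : pair_space k => runy n1 t (rows z.1) k) &
   measurable_fun setT (fun z : pair_space k =>
     good dl (rows z.1) k)].
Proof.
have [mP mG my mg] := @meas_run _ (sub_space X (before k)) R p n1 t dl rows k (@meas_before k).
by split; [move=> i j; exact: (measurableT_comp (mP i j) measurable_fst)
  |move=> i j; exact: (measurableT_comp (mG i j) measurable_fst)
  |move=> i j; exact: (measurableT_comp (my i j) measurable_fst)
  |exact: (measurableT_comp mg measurable_fst)].
Qed.

Let meas_joint_row k :
  mx_meas (fun z : pair_space k => rows z.2 k).
Proof.
move=> i j.
exact: (measurableT_comp (meas_rows (fintype.subxx (at_row k)) i j) measurable_snd).
Qed.

(** The state after [k] rows is frozen and the row [k] integrated; the indicator of the good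
    event at [k.+1] is bounded by the one at [k], which does not involve that row. *)
Let energy_step k b : (k < n)%N -> mean_le P (fun w => g k w * en k w) b ->
  mean_le P (fun w => g k.+1 w * en k.+1 w)
    ((1 + Cs / p%:R) * b + Cs * dl ^+ 2 / p%:R).
Proof.
move=> kn IH; have kp := ltn_trans kn np.
pose F w w' := g k w * bound k w (rows w' k).
have Cp : 0 <= Cs / p%:R by rewrite divr_ge0// ltW.
have Cd : 0 <= Cs * dl ^+ 2 / p%:R by rewrite divr_ge0 ?(ltW p0)// mulr_ge0 ?sqr_ge0.
have key : mean_le P (fun w => F w w) ((1 + Cs / p%:R) * b + Cs * dl ^+ 2 / p%:R).
  apply: (@mean_le_copy _ _ _ P _ X (before k) (at_row k) F
    (fun w => (1 + Cs / p%:R) * (g k w * en k w) + Cs * dl ^+ 2 / p%:R)) => //.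
  - have [mP mG my mg] := meas_joint k.
    apply: measurable_funM; first exact: meas_bool.
    by apply: meas_energy_bound => //; exact: meas_joint_row.
  - by move=> w w'; exact: bound0.
  - move=> w; rewrite /F /g; case gk : (good _ _ _); last first.
      under eq_integral do rewrite mul0r.
      by rewrite integral0 lee_fin mul0r mulr0 add0r.
    under eq_integral do rewrite mul1r.
    have dl2 : dl ^+ 2 <= 1 by rewrite expr_le1// (le_trans dl1)// invf_le1// ler1n.
    have [_ _] := energy_step_mean K0 (mx_rows k) (mean2_row kn) u1 t1 n1p c0 A1 pdl dl2 kp (ck kn)
      (traj_norm_bound c0 n1p t1 (ck kn)) (traj_trace_bound c0 n1p (ck kn)) (state (ltnW kp) gk).
    by rewrite mul1r.
  - apply: mean_leD; last exact: mean_le_cst.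
    by apply: mean_leZ => //; rewrite addr_ge0.
apply: mean_le_mono key.
- exact: measurable_funM (meas_g _) (meas_en _).
- by move=> w; exact: en0.
- move=> w; rewrite {1}/g; case gk : (good _ _ _); last by rewrite mul0r; exact: bound0.
  have /= /andP[gk' cl] := gk.
  rewrite mul1r /F /g gk' mul1r /en /bound /=.
  have Dk := D0 kp.
  by apply: (energy_step_pointwise _ _ Dk dl0' dl1 (state (ltnW kp) gk')); rewrite ?invr_gt0.
Qed.

(** Iteration from the state without rows, of energy 0. *)
Let energy_mean k : (k <= n)%N -> mean_le P (fun w => g k w * en k w)
  (k%:R * (Cs * dl ^+ 2 / p%:R) * (1 + Cs / p%:R) ^+ k).
Proof.
have Cp : 0 <= Cs / p%:R by rewrite divr_ge0// ltW.
have Cd : 0 <= Cs * dl ^+ 2 / p%:R by rewrite divr_ge0 ?(ltW p0)// mulr_ge0 ?sqr_ge0.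
elim: k => [_|k ih kn].
  rewrite !mul0r; have := mean_le_cst P (lexx (0 : R)).
  congr (mean_le _ _ _); apply/funext => w; rewrite /g /en /= mul1r /energy.
  rewrite /traj_dot /traj_norm /traj_trace min0n leq0n !mul0r dotv0r mxtrace0 mul0mx.
  by rewrite !dotv0r subrr expr0n !addr0.
apply: mean_le_weak (energy_step kn (ih (ltnW kn))).
set q := 1 + Cs / p%:R; set e := Cs * dl ^+ 2 / p%:R.
have q1 : 1 <= q by rewrite lerDl.
have q1n : e <= e * q ^+ k.+1 by rewrite ler_peMr// exprn_ege1.
have -> : k.+1%:R * e * q ^+ k.+1 = q * (k%:R * e * q ^+ k) + e * q ^+ k.+1.
  by rewrite -natr1 exprS; ring.
by rewrite lerD2l.
Qed.

(** Chebyshev's inequality with fourth powers: a projection of rank [D] has squared Frobenius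
    norm [D], so that the relative deviation of the gap exceeds [dl] with probability
    [O(dl^-4 D^-2)], and there are at most [p] rows. *)
Let bad_mean k : (k <= n)%N -> mean_le P (fun w => 1 - g k w)
  (k%:R * (4 * K / (dl ^+ 4 * (c * p%:R) ^+ 2))).
Proof.
elim: k => [_|k ih kn].
  rewrite mul0r; have := mean_le_cst P (lexx (0 : R)).
  by congr (mean_le _ _ _); apply/funext => w; rewrite /g /= subrr.
have kp := ltn_trans kn np.
pose e := (dl * D k) ^- 4.
have B0 : 0 <= 4 * K / (dl ^+ 4 * (c * p%:R) ^+ 2).
  by rewrite divr_ge0//; apply: mulr_ge0; rewrite ?sqr_ge0// exprn_ge0.
have Dk := D0 kp.
have e0 : 0 <= e by rewrite invr_ge0 exprn_ge0// mulr_ge0// ltW.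
pose F w w' := g k w * (e * (dotv (rows w' k) (runPi (rows w) k *m rows w' k) - D k) ^+ 4).
have F0 w w' : 0 <= F w w' by rewrite mulr_ge0// mulr_ge0// exprn_even_ge0.
have key : mean_le P (fun w => F w w) (4 * K / (dl ^+ 4 * (c * p%:R) ^+ 2)).
  apply: (@mean_le_copy _ _ _ P _ X (before k) (at_row k) F
    (fun w => 4 * K / (dl ^+ 4 * (c * p%:R) ^+ 2))) => //.
  - have [mP mG my mg] := meas_joint k; have mr := @meas_joint_row k.
    apply: measurable_funM; first exact: meas_bool.
    apply: measurable_funM => //; apply: measurable_funX; apply: measurable_funB => //.
    by apply: meas_dotv => //; exact: mx_measM.
  - move=> w; rewrite /F /g; case gk : (good _ _ _); last first.
      under eq_integral do rewrite mul0r.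
      by rewrite integral0 lee_fin.
    under eq_integral do rewrite mul1r.
    have [PS _ _] := state (ltnW kp) gk.
    have [_ trPi _ _] := good_state t dl0' dl1 n1p (ltnW kp) gk.
    have [_ _] := mean_leZ e0 (mean4_row kn (runPi (rows w) k)).
    rewrite (frob2_proj (Pi_sym PS) (Pi_idem PS)) trPi -/(D k) => /le_trans; apply.
    rewrite lee_fin /e.
    have D1 : 1 <= D k by rewrite /D lerBrDr nat1r ler_nat.
    have h : (D k + 1) ^+ 2 <= (2 * D k) ^+ 2.
      have D2 : D k + 1 <= 2 * D k by rewrite mulr_natl mulr2n lerD2l.
      have D3 : 0 <= D k + 1 by rewrite addr_ge0// ltW.
      by rewrite lerXn2r ?nnegrE// (le_trans D3).
    apply: (@le_trans _ _ ((dl * D k) ^- 4 * (K * (2 * D k) ^+ 2))).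
      by rewrite ler_wpM2l// ler_wpM2l.
    have -> : (dl * D k) ^- 4 * (K * (2 * D k) ^+ 2) = 4 * K / (dl ^+ 4 * D k ^+ 2).
      by field; rewrite !gt_eqF.
    have cp : 0 < c * p%:R by rewrite mulr_gt0.
    rewrite ler_wpM2l ?mulr_ge0// lef_pV2 ?posrE ?mulr_gt0 ?exprn_gt0//.
    rewrite ler_wpM2l ?exprn_ge0// lerXn2r ?nnegrE ?(ltW cp) ?(ltW Dk)//; exact: ck.
  - exact: mean_le_cst.
rewrite -[k.+1%:R]natr1 [(_ + 1) * _]mulrDl mul1r.
have := mean_leD (ih (ltnW kn)) key.
apply: mean_le_mono.
- exact: measurable_funB.
- by move=> w; rewrite /g subr_ge0 lern1 leq_b1.
- move=> w; rewrite /F /g /=; case gk : (good _ _ _) => /=; last first.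
    by rewrite subr0 mul0r addr0.
  rewrite subrr add0r mul1r; case cl : (gap_ok _ _ _).
    by rewrite subrr mulr_ge0// exprn_even_ge0.
  rewrite subr0 /e mulrC ler_pdivlMr ?exprn_gt0 ?mulr_gt0// mul1r.
  move/negbT: cl; rewrite /gap_ok -ltNge -/(D k) => /ltW cl.
  have -> : (dotv (rows w k) (runPi (rows w) k *m rows w k) - D k) ^+ 4 =
     `|gap (rows w) k - D k| ^+ 4.
    by rewrite -normrX ger0_norm// exprn_even_ge0.
  by rewrite lerXn2r ?nnegrE// mulr_ge0// ltW.
Qed.

(** Markov's inequality for [1 - g + g * en / dl], which is at least 1 unless the run is good
    and its energy is below [dl]. *)
Lemma run_concentrates r : dl = r ^+ 2 -> p%:R^-1 = r ^+ 12 ->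
  exists2 E : set T, measurable E /\
    (P (~` E) <= ((4 * K / c ^+ 2 + Cs * expR Cs) * r ^+ 2)%:E)%E &
  forall w, E w -> good dl (rows w) n /\ en n w <= r ^+ 2.
Proof.
move=> dlr pr; have r2 : 0 < r ^+ 2 by rewrite -dlr.
have rn0 : r != 0 by rewrite -sqrf_eq0 gt_eqF.
have hn := energy_mean (leqnn n); have hb := bad_mean (leqnn n).
have nle : n%:R <= p%:R :> R by rewrite ler_nat ltnW.
have n0 : 0 <= n%:R :> R by [].
have pn0 : p%:R != 0 :> R by rewrite gt_eqF.
have i0 : 0 <= (r ^+ 2)^-1 by rewrite invr_ge0 ltW.
pose f w := (1 - g n w) + (r ^+ 2)^-1 * (g n w * en n w).
have fE : mean_le P f ((4 * K / c ^+ 2 + Cs * expR Cs) * r ^+ 2).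
  apply: mean_le_weak (mean_leD hb (mean_leZ i0 hn)).
  rewrite [leRHS]mulrDl; apply: lerD.
    have -> : 4 * K / c ^+ 2 * r ^+ 2 = p%:R * (4 * K / c ^+ 2 * r ^+ 2 * r ^+ 12).
      by rewrite -pr; field; rewrite pn0 gt_eqF.
    have r1 : r ^+ 2 <= 1.
      by rewrite -dlr (le_trans dl1)// invf_le1// ler1n.
    have -> : 4 * K / (dl ^+ 4 * (c * p%:R) ^+ 2) = 4 * K / c ^+ 2 * r ^+ 16.
      have -> : r ^+ 16 = (p%:R^-1) ^+ 2 / dl ^+ 4.
        by rewrite pr dlr; field; rewrite rn0.
      by field; rewrite pn0 !gt_eqF.
    have -> : r ^+ 16 = r ^+ 2 * r ^+ 2 * r ^+ 12 by ring.
    have r12 : 0 <= r ^+ 12 by rewrite -pr invr_ge0 ltW.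
    have B0 : 0 <= 4 * K / c ^+ 2 by rewrite divr_ge0 ?sqr_ge0// mulr_ge0.
    have r2' := ltW r2.
    apply: ler_pM => //; first by apply: mulr_ge0 => //; apply: mulr_ge0 => //; apply: mulr_ge0.
    rewrite -[leRHS]mulrA ler_wpM2l// ler_wpM2r// ler_piMr//.
  have e1 : (1 + Cs / p%:R) ^+ n <= expR Cs.
    apply: (@le_trans _ _ (expR (n%:R * (Cs / p%:R)))).
      rewrite expRM_natl lerXn2r ?nnegrE ?expR_ge0 ?expR_ge1Dx//.
      by rewrite addr_ge0// divr_ge0// ltW.
    by rewrite ler_expR mulrCA ler_piMr// ler_pdivrMr// mul1r.
  have -> : Cs * expR Cs * r ^+ 2 = (r ^+ 2)^-1 * (p%:R * (Cs * dl ^+ 2 / p%:R) * expR Cs).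
    by rewrite dlr; field; rewrite pn0 rn0.
  have Cd : 0 <= Cs * dl ^+ 2 / p%:R by rewrite divr_ge0 ?(ltW p0)// mulr_ge0 ?sqr_ge0.
  rewrite ler_wpM2l//; apply: ler_pM => //; first exact: mulr_ge0.
    by rewrite exprn_ge0// addr_ge0// divr_ge0// ltW.
  by rewrite ler_wpM2r.
have [mf f0 If] := fE.
have mE : measurable [set w | f w < 1].
  have := measurable_fun_ltr mf (measurable_cst (1 : R)).
  by move=> /(_ measurableT [set true] I); rewrite setTI.
exists [set w | f w < 1].
  split => //; apply: le_trans If.
  rewrite -[X in (P X <= _)%E]setIT -integral_indic//; last exact: measurableC.
  apply: ge0_le_integral => //.
  - by apply/measurable_EFinP; apply: measurable_indic; exact: measurableC.
  - exact/measurable_EFinP.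
  - move=> w _; rewrite lee_fin indicE; case: (boolP (w \in _)) => //=.
    by rewrite inE /= => /negP; rewrite -leNgt.
move=> w /=; rewrite /f /g; case: (good _ _ _) => /=; last first.
  by rewrite subr0 mul0r mulr0 addr0 ltxx.
by rewrite subrr add0r mul1r mulrC ltr_pdivrMr// mul1r => /ltW.
Qed.

End process.

(** * Concentration for an isotropic Gaussian design *)

Section design_matrix.
Context (R : realType) (n p n1 : nat) (t : 'cV[R]_p) (dl : R).
Variables (Z : 'M[R]_(n, p)) (x : nat -> 'cV[R]_p).
Hypothesis Zx : forall i : 'I_n, row i Z = (x i)^T.
Hypotheses (dl0 : 0 <= dl) (dl1 : dl <= 2^-1) (n1p : (n1 < p)%N) (n1n : (n1 <= n)%N).
Hypothesis np : (n <= p)%N.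

(** Between [X^T] and [X], it gives the Gram matrix of the source rows. *)
Definition head_mx : 'M[R]_n := diag_mx (\row_j (j < n1)%:R).

Let ZE i j : Z i j = x i j 0.
Proof. by have /rowP/(_ j) := Zx i; rewrite !mxE. Qed.

Let runSE k : (k <= n)%N ->
  runS x k = Z^T *m diag_mx (\row_j (j < k)%:R) *m Z.
Proof.
elim: k => [_|k ih kn].
  rewrite (_ : \row_j _ = 0); first by rewrite linear0 mulmx0 mul0mx.
  by apply/rowP => j; rewrite !mxE.
rewrite /= (ih (ltnW kn)); pose o := Ordinal kn.
rewrite [in RHS](_ : \row_j _ = \row_j (j < k)%:R + delta_mx 0 o); last first.
  apply/rowP => j; rewrite !mxE eqxx /= -natrD ltnS leq_eqVlt addnC.
  by rewrite -(inj_eq val_inj)/=; case: ltngtP.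
rewrite linearD/= mulmxDr mulmxDl; congr (_ + _).
apply/matrixP => i j; rewrite !mxE big_ord1 mxE (bigD1 o)//= big1 ?addr0.
  rewrite !mxE (bigD1 o)//= big1 ?addr0.
    by rewrite !mxE !eqxx mulr1n mulr1 !ZE.
  by move=> l lo; rewrite !mxE (negbTE lo) mulr0n mulr0.
move=> l lo; rewrite !mxE big1 ?mul0r// => l' _; rewrite !mxE.
by case: (eqVneq l' l) => [->|]; rewrite ?mulr0n ?mulr0// (negbTE lo) andbF mul0rn mulr0.
Qed.

Let SE : runS x n = Z^T *m Z.
Proof.
rewrite runSE// (_ : diag_mx _ = 1%:M) ?mulmx1//.
by apply/matrixP => i j; rewrite !mxE ltn_ord.
Qed.

(** The recursion never mentions an inverse; [Z G G Z^T] is seen to be the inverse of the Gram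
    matrix from [Z G Z^T = 1] and [Z^T Z G = 1 - Pi]. *)
Lemma good_design : good dl x n ->
  let K0 := invmx (Z *m Z^T) in let y := Z^T *m K0 *m head_mx *m Z *m t in
  [/\ Z *m Z^T \in unitmx, \tr K0 = \tr (runG x n), Z^T *m K0 *m K0 *m Z = runG x n &
      y = runy n1 t x n].
Proof.
move=> gn; have [[PS _ _] _ Pix xGx] := good_state t dl0 dl1 n1p np gn.
have [_ yE] := good_solution t dl0 dl1 n1p (introT andP (conj n1n np)) gn.
set Pi := runPi x n in PS Pix; set G := runG x n in PS xGx yE *.
have GT := G_sym PS; have SG := S_G PS; rewrite SE in SG.
have GS : G *m (Z^T *m Z) = 1%:M - Pi.
  have := congr1 trmx SG.
  by rewrite trmx_mul GT trmx_mul trmxK linearB/= trmx1 (Pi_sym PS).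
have ZPi : Z *m Pi = 0.
  apply/matrixP => i j; have := Pix i (ltn_ord i) => /(congr1 (fun A : 'cV[R]_p => A j 0)).
  rewrite !mxE => P0; rewrite -[RHS]P0; apply: eq_bigr => l _; rewrite ZE mulrC.
  by congr (_ * _); rewrite -{1}(Pi_sym PS) mxE.
have PiG : Pi *m G = 0.
  by have := congr1 trmx (G_Pi PS); rewrite trmx_mul GT (Pi_sym PS) trmx0.
have ZGZ : Z *m G *m Z^T = 1%:M.
  apply/matrixP => i j; rewrite mxE [RHS]mxE -(inj_eq val_inj)/=.
  rewrite -[RHS](xGx i j (ltn_ord i) (ltn_ord j)) /dotv mulmxA [RHS]mxE.
  apply: eq_bigr => l _; rewrite [Z^T _ _]mxE ZE; congr (_ * _).
  by rewrite !mxE; apply: eq_bigr => l' _; rewrite ZE mxE.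
(* The factor [Z^T Z G = 1 - Pi] in the middle is absorbed by [Z], which kills [Pi]. *)
have inv : Z *m Z^T *m (Z *m G *m (G *m Z^T)) = 1%:M.
  rewrite -!mulmxA [Z^T *m (Z *m _)]mulmxA [Z^T *m Z *m (G *m _)]mulmxA SG.
  by rewrite mulmxBl mul1mx mulmxBr [Z *m (Pi *m _)]mulmxA ZPi mul0mx subr0 mulmxA.
have [uZ _] := mulmx1_unit inv.
have K0E : invmx (Z *m Z^T) = Z *m G *m (G *m Z^T).
  by rewrite -[LHS]mulmx1 -inv mulKmx.
have ZK : Z^T *m invmx (Z *m Z^T) = G *m Z^T.
  rewrite K0E !mulmxA SG -!mulmxA mulmxBl mul1mx.
  by rewrite [Pi *m _]mulmxA PiG mul0mx subr0.
have KZ : invmx (Z *m Z^T) *m Z = Z *m G.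
  rewrite K0E -!mulmxA GS mulmxBr mulmx1 (G_Pi PS) subr0 //.
split => //.
- by rewrite K0E mxtrace_mulC -!mulmxA [Z^T *m _]mulmxA mulmxA GS mulmxBl PiG subr0 mul1mx.
- by rewrite ZK -[LHS]mulmxA KZ mulmxA -[G *m Z^T *m Z]mulmxA GS mulmxBl PiG subr0 mul1mx.
- by rewrite yE runSE// ZK !mulmxA.
Qed.

End design_matrix.

Lemma l2norm_ge0 (R : rcfType) p (u : 'cV[R]_p) : 0 <= l2norm u.
Proof. exact: sqrtr_ge0. Qed.

Lemma l2norm_sqr (R : rcfType) p (u : 'cV[R]_p) : l2norm u ^+ 2 = dotv u u.
Proof. by rewrite sqr_sqrtr// dotv_ge0. Qed.

Lemma unit_direction (R : rcfType) p (u : 'cV[R]_p) :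
  exists2 v : 'cV[R]_p, u = l2norm u *: v & dotv v v <= 1.
Proof.
exists ((l2norm u)^-1 *: u); have [u0|u0] := eqVneq (l2norm u) 0.
- by rewrite u0 scale0r; apply: dotvv_eq0; rewrite -l2norm_sqr u0 expr0n.
- by rewrite scalerA divff// scale1r.
- by rewrite u0 invr0 scale0r dotv0r.
- by rewrite dotvZl dotvZr mulrA -expr2 -l2norm_sqr -exprMn mulVf// expr1n.
Qed.

Lemma sqr_le_abs (R : realDomainType) (a r : R) : 0 <= r -> a ^+ 2 <= r ^+ 2 -> `|a| <= r.
Proof. by move=> r0; rewrite -[a ^+ 2]real_normK ?num_real// ler_sqr ?nnegrE. Qed.

Section gaussian_matrix.
Context (R : realType) (c : R).
Hypothesis c0 : 0 < c.

(** The interpolator of minimal norm of the responses [L Z t], when the rows of [Z] are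
    independent. *)
Definition ridgeless n p n1 (Z : 'M[R]_(n, p)) (t : 'cV[R]_p) : 'cV[R]_p :=
  Z^T *m invmx (Z *m Z^T) *m head_mx R n n1 *m Z *m t.

Definition iso_close n p n1 (Z : 'M[R]_(n, p)) (u t : 'cV[R]_p) (r : R) : Prop :=
  let K0 := invmx (Z *m Z^T) in let y := ridgeless n1 Z t in
  [/\ Z *m Z^T \in unitmx,
      `|dotv u y - n1%:R / p%:R * dotv u t| <= r * (l2norm u * l2norm t),
      `|dotv y y - traj_norm n1 t n| <= r * l2norm t ^+ 2,
      `|\tr K0 - n%:R / (p%:R - n%:R + 1)| <= r &
      dotv u (Z^T *m K0 *m K0 *m Z *m u) <= r * l2norm u ^+ 2].

(** The general case follows from unit vectors by homogeneity, which also makes the error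
    proportional to the norms. *)
Lemma gaussian_concentration : exists2 Kc : R, 0 <= Kc &
  forall d (T : measurableType d) (P : probability T R) n p (X : 'I_n * 'I_p -> {RV P >-> R}),
  independent_vars X -> (forall ij, standard_normal (X ij)) ->
  forall n1 (u t : 'cV[R]_p) (r : R), (n1 <= n)%N -> c * p%:R <= p%:R - n%:R ->
  0 < r -> r ^+ 2 <= 2^-1 -> p%:R^-1 = r ^+ 12 ->
  exists2 E : set T, measurable E /\ (P (~` E) <= (Kc * r ^+ 2)%:E)%E &
  forall w, E w -> iso_close n1 (\matrix_(i, j) X (i, j) w) u t r.
Proof.
have [C C0 mom] := std_normal_poly_bounds R.
set K := Kquad C; set Cs := step_const K c (2 / c).
have K0 : 0 <= K by exact: Kquad_ge0.
exists (4 * K / c ^+ 2 + Cs * expR Cs).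
  have Cs0 : 0 <= Cs by exact: step_const_ge0.
  by rewrite addr_ge0// ?divr_ge0 ?sqr_ge0 ?mulr_ge0 ?expR_ge0.
move=> d T P n p X iX sX n1 u t r n1n cp r0 r2 pr.
have [u' uE u1] := unit_direction u; have [t' tE t1] := unit_direction t.
have p0 : 0 < p%:R :> R by rewrite -invr_gt0 pr exprn_gt0.
have np : (n < p)%N by rewrite -(ltr_nat R) -subr_gt0 (lt_le_trans _ cp)// mulr_gt0.
have n1p := leq_ltn_trans n1n np.
have r1 : r <= 1.
  by rewrite leNgt; apply/negP => r1; nra.
have pdl : p%:R^-1 <= (r ^+ 2) ^+ 2.
  rewrite pr -exprM; apply: ler_wiXn2l => //; exact: ltW.
have [E [mE PE] EE] := @run_concentrates _ _ _ P n p X C C0 iX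
  (fun j a b e => (mom _ _ _ _ (sX j) a b e).1) (fun j a b e => (mom _ _ _ _ (sX j) a b e).2)
  n1 u' t' (r ^+ 2) c c0 n1p cp u1 t1
  (exprn_gt0 2 r0) r2 pdl r erefl pr.
exists E => // w /EE[gd en].
pose Z : 'M[R]_(n, p) := \matrix_(i, j) X (i, j) w.
have Zx i : row i Z = (rows X w i)^T.
  by apply/rowP => j; rewrite rowsE !mxE.
have [uZ trE GE yE] := good_design t' Zx (ltW (exprn_gt0 2 r0)) r2 n1p n1n (ltnW np) gd.
have y_ : ridgeless n1 Z t = l2norm t *: runy n1 t' (rows X w) n.
  by rewrite -yE {1}tE /ridgeless -scalemxAr.
have [[PS _ _] _ _ _] := good_state t' (ltW (exprn_gt0 2 r0)) r2 n1p (ltnW np) gd.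
have [m [Q GQ]] := G_gram PS.
move: en; rewrite /energy; set a1 := _ - traj_dot _ _ _ _; set a2 := _ - traj_norm _ _ _.
set a3 := _ - _; set H := dotv _ _ => en.
have H0 : 0 <= H by rewrite /H GQ dotv_gram dotv_ge0.
have [s1 s2 s3] := And3 (sqr_ge0 a1) (sqr_ge0 a2) (sqr_ge0 a3).
have h1 : `|a1| <= r by apply: sqr_le_abs; [exact: ltW|lra].
have h2 : `|a2| <= r by apply: sqr_le_abs; [exact: ltW|lra].
have h3 : `|a3| <= r by apply: sqr_le_abs; [exact: ltW|lra].
have h4 : H <= r.
  have : r ^+ 2 <= r by rewrite expr2 ler_piMr// ltW.
  lra.
have nu := l2norm_ge0 u; have nt := l2norm_ge0 t.
rewrite -/Z; split => //.
- rewrite y_ [in X in dotv X _]uE [in X in _ * X]tE [in X in _ * X]uE.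
  rewrite !dotvZr !dotvZl.
  rewrite (_ : _ - _ = l2norm u * l2norm t * a1); last first.
    by rewrite /a1 /traj_dot (minn_idPr n1n); ring.
  by rewrite normrM ger0_norm ?mulr_ge0// mulrC ler_wpM2r// mulr_ge0.
- rewrite y_ dotvZr dotvZl.
  rewrite (_ : _ - _ = l2norm t ^+ 2 * a2).
    by rewrite normrM ger0_norm ?sqr_ge0// mulrC ler_wpM2r// sqr_ge0.
  rewrite /a2 /traj_norm [in X in _ - X = _]tE dotvZr dotvZl; ring.
- by rewrite trE.
- rewrite GE [in X in X <= _]uE -scalemxAr dotvZr dotvZl -/H mulrA -expr2.
  by rewrite mulrC ler_wpM2r// sqr_ge0.
Qed.

End gaussian_matrix.

(** * Agreement up to a rate *)

Section approximation.
Context (R : realFieldType) (I : Type) (r : I -> R).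
Hypothesis r01 : forall i, 0 <= r i <= 1.
Implicit Types (S a b : I -> R).

(** A big-O relation over an arbitrary family [I], so that the constants are uniform while
    never being written: [S] is the scale of [a], the relative error is of order [r]. *)
Definition agree S a a0 := exists A e : R, forall i,
  [/\ `|a i| <= A * S i, `|a0 i| <= A * S i & `|a i - a0 i| <= e * r i * S i].

Lemma agree_exact S a A : (forall i, `|a i| <= A * S i) -> agree S a a.
Proof. by move=> h; exists A, 0 => i; rewrite subrr normr0 !mul0r. Qed.

Lemma agree_cst (k : R) : agree (fun=> 1) (fun=> k) (fun=> k).
Proof. by apply: (@agree_exact _ _ `|k|) => i; rewrite mulr1. Qed.

Lemma agree_input S a a0 A e : (forall i, 0 <= S i) -> 0 <= e ->
  (forall i, `|a0 i| <= A * S i) -> (forall i, `|a i - a0 i| <= e * r i * S i) ->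
  agree S a a0.
Proof.
move=> S0 e0 hA he; exists (A + e), e => i; have /andP[ri0 ri1] := r01 i.
have h : e * r i * S i <= e * S i by rewrite ler_wpM2r// ler_piMr.
split=> //.
- have -> : a i = a0 i + (a i - a0 i) by ring.
  by rewrite mulrDl (le_trans (ler_normD _ _))// lerD// (le_trans (he i)).
- by rewrite mulrDl (le_trans (hA i))// lerDl mulr_ge0.
Qed.

Lemma agreeD S a a0 b b0 : agree S a a0 -> agree S b b0 ->
  agree S (fun i => a i + b i) (fun i => a0 i + b0 i).
Proof.
move=> [A [e h]] [A' [e' h']]; exists (A + A'), (e + e') => i.
have [h1 h2 h3] := h i; have [h1' h2' h3'] := h' i; split.
- by rewrite mulrDl (le_trans (ler_normD _ _))// lerD.
- by rewrite mulrDl (le_trans (ler_normD _ _))// lerD.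
- have -> : a i + b i - (a0 i + b0 i) = (a i - a0 i) + (b i - b0 i) by ring.
  by rewrite !mulrDl (le_trans (ler_normD _ _))// lerD.
Qed.

Lemma agreeN S a a0 : agree S a a0 -> agree S (fun i => - a i) (fun i => - a0 i).
Proof.
move=> [A [e h]]; exists A, e => i; have [h1 h2 h3] := h i.
by rewrite !normrN -opprD normrN.
Qed.

Lemma agreeB S a a0 b b0 : agree S a a0 -> agree S b b0 ->
  agree S (fun i => a i - b i) (fun i => a0 i - b0 i).
Proof. by move=> ha hb; apply: agreeD => //; exact: agreeN. Qed.

Lemma agreeM S S' a a0 b b0 : agree S a a0 -> agree S' b b0 ->
  agree (fun i => S i * S' i) (fun i => a i * b i) (fun i => a0 i * b0 i).
Proof.
move=> [A [e h]] [A' [e' h']]; exists (A * A'), (A * e' + e * A') => i.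
have [h1 h2 h3] := h i; have [h1' h2' h3'] := h' i; split.
- by rewrite mulrACA normrM ler_pM.
- by rewrite mulrACA normrM ler_pM.
- have -> : a i * b i - a0 i * b0 i = a i * (b i - b0 i) + (a i - a0 i) * b0 i by ring.
  have -> : (A * e' + e * A') * r i * (S i * S' i) =
    (A * S i) * (e' * r i * S' i) + (e * r i * S i) * (A' * S' i) by ring.
  by rewrite (le_trans (ler_normD _ _))// !normrM lerD// ler_pM.
Qed.

Lemma agreeZ S a a0 b b0 : agree (fun=> 1) a a0 -> agree S b b0 ->
  agree S (fun i => a i * b i) (fun i => a0 i * b0 i).
Proof.
move=> ha hb; have := agreeM ha hb.
by congr (agree _ _ _); apply/funext => i; rewrite mul1r.
Qed.

Lemma agreeV a a0 : agree (fun=> 1) a a0 -> (forall i, 1 <= a i) ->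
  (forall i, 1 <= a0 i) -> agree (fun=> 1) (fun i => (a i)^-1) (fun i => (a0 i)^-1).
Proof.
move=> [A [e h]] ha ha0; exists 1, e => i; have [_ _ h3] := h i.
have p1 := lt_le_trans ltr01 (ha i); have p2 := lt_le_trans ltr01 (ha0 i).
have v (x : R) : 1 <= x -> `|x^-1| <= 1.
  move=> x1; have x0 := lt_le_trans ltr01 x1.
  by rewrite ger0_norm ?invr_ge0 ?(ltW x0)// invf_le1.
split; rewrite ?mulr1 ?v//.
have -> : (a i)^-1 - (a0 i)^-1 = - (a i - a0 i) * ((a i)^-1 * (a0 i)^-1).
  by field; rewrite !gt_eqF.
rewrite normrM normrN normrM -[leRHS]mulr1; apply: ler_pM => //.
  by rewrite mulr1 in h3.
by rewrite -[leRHS]mulr1; apply: ler_pM => //; apply: v.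
Qed.

End approximation.

(** * The risk as a rational function *)

Section risk_functionals.
Context (R : realFieldType) (alpha s : R).

(** [g] stands for [v^T Pi v], [x] for [v^T b], [h] and [k] for [v^T Pi Rt b] and
    [(Rt b)^T Pi (Rt b)], [m] and [N] for [v^T y] and [y^T y], [tau] for the trace of
    [(Z Z^T)^-1] and [H] for [v^T G v]; [s ^+ 2 = 1 + alpha]. *)
Definition spike_den (g : R) := 1 + alpha * (1 - g).
Definition var_of g tau H :=
  tau + H * (alpha * (1 + alpha) * (spike_den g)^-1 ^+ 2 - alpha * (spike_den g)^-1).
Definition spike_bias x g h := (s * h - alpha * g * x) * (spike_den g)^-1.
Definition bias1_of x g h k :=
  k - alpha * x ^+ 2 + alpha * (spike_den g)^-1 * (s * x - h) ^+ 2 +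
  alpha * spike_bias x g h ^+ 2.
Definition bias2_of g m N :=
  N + m ^+ 2 * (alpha * (1 + alpha) * (spike_den g)^-1 ^+ 2 - alpha * (spike_den g)^-1).
Definition bias3_of x g h m :=
  - (2 * alpha * spike_bias x g h * (s * m * (spike_den g)^-1)).

Variables (c K : R).

(** The index type of the big-O calculus: all the values that the isotropic quantities may
    take on the good event, at any dimension. The limits are those of a projection of rank
    [p - n]: [sd_eta = (p - n) / p], [sd_rho = n1 / p]. *)
Record spiked_data := SpikedData {
  sd_rate : R; sd_eta : R; sd_rho : R; sd_nu : R; sd_tau0 : R; sd_B : R; sd_Bt : R; sd_x : R; sd_xt : R;
  sd_g : R; sd_h : R; sd_k : R; sd_m : R; sd_N : R; sd_tau : R; sd_H : R;
  rate01 : 0 <= sd_rate <= 1; eta01 : 0 <= sd_eta <= 1; rho01 : 0 <= sd_rho <= 1;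
  nu_le : 0 <= sd_nu <= c; tau0_le : 0 <= sd_tau0 <= c;
  B_ge0 : 0 <= sd_B; Bt_ge0 : 0 <= sd_Bt; x_le : `|sd_x| <= sd_B; xt_le : `|sd_xt| <= sd_Bt;
  g_le1 : sd_g <= 1; g_eta : `|sd_g - sd_eta| <= sd_rate;
  h_eta : `|sd_h - sd_eta * (s * sd_x)| <= sd_rate * (s * sd_B);
  k_eta : `|sd_k - sd_eta * (sd_B ^+ 2 + alpha * sd_x ^+ 2)| <= sd_rate * (s * sd_B) ^+ 2;
  m_rho : `|sd_m - sd_rho * (s * sd_xt)| <= sd_rate * (s * sd_Bt);
  N_nu : `|sd_N - sd_nu * (sd_Bt ^+ 2 + alpha * sd_xt ^+ 2)| <= K * sd_rate * (s * sd_Bt) ^+ 2;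
  tau_le : `|sd_tau - sd_tau0| <= K * sd_rate;
  H_le : 0 <= sd_H <= sd_rate }.

Hypotheses (alpha0 : 0 <= alpha) (s0 : 0 <= s) (K0 : 0 <= K).

Let one (_ : spiked_data) : R := 1.
Let B2 i := sd_B i * sd_B i.
Let Bt2 i := sd_Bt i * sd_Bt i.
Let agree := agree sd_rate.

Let a_cst (q : R) : agree one (fun=> q) (fun=> q). Proof. exact: agree_cst. Qed.

Let a_x : agree sd_B sd_x sd_x.
Proof. by apply: (@agree_exact _ _ _ _ _ 1) => i; rewrite mul1r; exact: x_le. Qed.

Let unit_abs (q : R) : 0 <= q <= 1 -> `|q| <= 1.
Proof. by case/andP => q0 q1; rewrite ger0_norm. Qed.

Let a_g : agree one sd_g sd_eta.
Proof.
apply: (@agree_input _ _ _ rate01 _ _ _ 1 1) => // i.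
  by rewrite mulr1 unit_abs// eta01.
by rewrite mul1r mulr1; exact: g_eta.
Qed.

Let a_h : agree sd_B sd_h (fun i => sd_eta i * (s * sd_x i)).
Proof.
apply: (@agree_input _ _ _ rate01 _ _ _ s s) => // i; first exact: B_ge0.
- rewrite !normrM (ger0_norm s0) -[leRHS]mul1r; apply: ler_pM => //; rewrite ?mulr_ge0//.
    by rewrite unit_abs// eta01.
  by rewrite ler_wpM2l// x_le.
have -> : s * sd_rate i * sd_B i = sd_rate i * (s * sd_B i) by ring.
exact: h_eta.
Qed.

Let sqr_bound (b y A : R) : `|y| <= b -> `|A + alpha * y ^+ 2| <= `|A| + alpha * b ^+ 2.
Proof.
move=> yb; rewrite (le_trans (ler_normD _ _))// lerD2l normrM ger0_norm// normrX.
by rewrite ler_wpM2l// lerXn2r ?nnegrE// (le_trans _ yb).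
Qed.

Let a_k : agree B2 sd_k (fun i => sd_eta i * (sd_B i ^+ 2 + alpha * sd_x i ^+ 2)).
Proof.
apply: (@agree_input _ _ _ rate01 _ _ _ (1 + alpha) (s ^+ 2)) => [i||i|i].
- by rewrite mulr_ge0// B_ge0.
- exact: sqr_ge0.
- rewrite normrM -[leRHS]mul1r; apply: ler_pM => //; first by rewrite unit_abs// eta01.
  rewrite (le_trans (sqr_bound _ (x_le i)))// ger0_norm ?sqr_ge0//.
  by rewrite mulrDl mul1r expr2.
- have -> : s ^+ 2 * sd_rate i * B2 i = sd_rate i * (s * sd_B i) ^+ 2 by rewrite /B2; ring.
  exact: k_eta.
Qed.

Let a_m : agree sd_Bt sd_m (fun i => sd_rho i * (s * sd_xt i)).
Proof.
apply: (@agree_input _ _ _ rate01 _ _ _ s s) => // i; first exact: Bt_ge0.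
- rewrite !normrM (ger0_norm s0) -[leRHS]mul1r; apply: ler_pM => //; rewrite ?mulr_ge0//.
    by rewrite unit_abs// rho01.
  by rewrite ler_wpM2l// xt_le.
have -> : s * sd_rate i * sd_Bt i = sd_rate i * (s * sd_Bt i) by ring.
exact: m_rho.
Qed.

Let a_N : agree Bt2 sd_N (fun i => sd_nu i * (sd_Bt i ^+ 2 + alpha * sd_xt i ^+ 2)).
Proof.
apply: (@agree_input _ _ _ rate01 _ _ _ (c * (1 + alpha)) (K * s ^+ 2)) => [i||i|i].
- by rewrite mulr_ge0// Bt_ge0.
- by rewrite mulr_ge0// sqr_ge0.
- have /andP[n0 nc] := nu_le i.
  rewrite normrM -mulrA; apply: ler_pM => //; first by rewrite ger0_norm.
  rewrite (le_trans (sqr_bound _ (xt_le i)))// ger0_norm ?sqr_ge0//.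
  by rewrite mulrDl mul1r expr2.
- have -> : K * s ^+ 2 * sd_rate i * Bt2 i = K * sd_rate i * (s * sd_Bt i) ^+ 2 by rewrite /Bt2; ring.
  exact: N_nu.
Qed.

Let a_tau : agree one sd_tau sd_tau0.
Proof.
apply: (@agree_input _ _ _ rate01 _ _ _ c K) => // i; rewrite mulr1.
  by have /andP[n0 nc] := tau0_le i; rewrite ger0_norm.
exact: tau_le.
Qed.

Let a_H : agree one sd_H (fun=> 0).
Proof.
apply: (@agree_input _ _ _ rate01 _ _ _ 0 1) => // i; rewrite mulr1 ?normr0//.
by have /andP[n0 nc] := H_le i; rewrite subr0 ger0_norm// mul1r.
Qed.

Let a_den : agree one (fun i => (spike_den (sd_g i))^-1) (fun i => (spike_den (sd_eta i))^-1).
Proof.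
apply: agreeV.
- exact: (agreeD (a_cst 1) (agreeZ (a_cst alpha) (agreeB (a_cst 1) a_g))).
- by move=> i; rewrite /spike_den lerDl mulr_ge0// subr_ge0 g_le1.
- by move=> i; have /andP[_ h1] := eta01 i; rewrite /spike_den lerDl mulr_ge0// subr_ge0.
Qed.

Let agreeX S a a0 : agree S a a0 ->
  agree (fun i => S i * S i) (fun i => a i ^+ 2) (fun i => a0 i ^+ 2).
Proof. by move=> ha; have := agreeM ha ha. Qed.

Let agreeX1 a a0 : agree one a a0 -> agree one (fun i => a i ^+ 2) (fun i => a0 i ^+ 2).
Proof. by move=> ha; have := agreeZ ha ha. Qed.

Let a_factor : agree one
  (fun i => alpha * (1 + alpha) * (spike_den (sd_g i))^-1 ^+ 2 - alpha * (spike_den (sd_g i))^-1)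
  (fun i => alpha * (1 + alpha) * (spike_den (sd_eta i))^-1 ^+ 2 - alpha * (spike_den (sd_eta i))^-1).
Proof.
exact: (agreeB (agreeZ (a_cst _) (agreeX1 a_den)) (agreeZ (a_cst _) a_den)).
Qed.

Let a_bias : agree sd_B (fun i => spike_bias (sd_x i) (sd_g i) (sd_h i))
  (fun i => spike_bias (sd_x i) (sd_eta i) (sd_eta i * (s * sd_x i))).
Proof.
have := agreeZ a_den (agreeB (agreeZ (a_cst s) a_h) (agreeZ (agreeZ (a_cst alpha) a_g) a_x)).
by congr (agree _ _ _); apply/funext => i; exact: mulrC.
Qed.

Lemma agree_var : agree one (fun i => var_of (sd_g i) (sd_tau i) (sd_H i)) sd_tau0.
Proof.
have := agreeD a_tau (agreeZ a_H a_factor).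
by congr (agree _ _ _); apply/funext => i; rewrite mul0r addr0.
Qed.

Lemma agree_bias1 : agree B2 (fun i => bias1_of (sd_x i) (sd_g i) (sd_h i) (sd_k i))
  (fun i => bias1_of (sd_x i) (sd_eta i) (sd_eta i * (s * sd_x i))
     (sd_eta i * (sd_B i ^+ 2 + alpha * sd_x i ^+ 2))).
Proof.
have a_res := agreeB (agreeZ (a_cst s) a_x) a_h.
have a1 := agreeB a_k (agreeZ (a_cst alpha) (agreeX a_x)).
have a2 := agreeZ (agreeZ (a_cst alpha) a_den) (agreeX a_res).
exact: (agreeD (agreeD a1 a2) (agreeZ (a_cst alpha) (agreeX a_bias))).
Qed.

Lemma agree_bias2 : agree Bt2 (fun i => bias2_of (sd_g i) (sd_m i) (sd_N i))
  (fun i => bias2_of (sd_eta i) (sd_rho i * (s * sd_xt i))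
     (sd_nu i * (sd_Bt i ^+ 2 + alpha * sd_xt i ^+ 2))).
Proof.
have := agreeD a_N (agreeZ a_factor (agreeX a_m)).
by congr (agree _ _ _); apply/funext => i; congr (_ + _); exact: mulrC.
Qed.

Lemma agree_bias3 : agree (fun i => sd_B i * sd_Bt i)
  (fun i => bias3_of (sd_x i) (sd_g i) (sd_h i) (sd_m i))
  (fun i => bias3_of (sd_x i) (sd_eta i) (sd_eta i * (s * sd_x i)) (sd_rho i * (s * sd_xt i))).
Proof.
have a_vy := agreeZ a_den (agreeZ (a_cst s) a_m).
have := agreeN (agreeM (agreeZ (a_cst (2 * alpha)) a_bias) a_vy).
by congr (agree _ _ _); apply/funext => i; congr (- (_ * _)); exact: mulrC.
Qed.

End risk_functionals.

(** The values of the functionals at the limits are the announced ones. *)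
Section limits.
Context (R : realFieldType) (alpha s n q m1 : R).
Hypotheses (alpha0 : 0 <= alpha) (s2 : s ^+ 2 = 1 + alpha) (n0 : 0 < n) (nq : n < q).

Let q0 : q != 0. Proof. by rewrite gt_eqF// (lt_trans n0). Qed.
Let n_neq0 : n != 0. Proof. by rewrite gt_eqF. Qed.
Let qn : q - n != 0. Proof. by rewrite gt_eqF// subr_gt0. Qed.
Let den : q + alpha * n != 0.
Proof. by rewrite gt_eqF// ltr_wpDr// ?mulr_ge0 ?(ltW n0)// (lt_trans n0). Qed.

Let bias_lim x : spike_bias alpha s x ((q - n) / q) ((q - n) / q * (s * x)) =
  (q - n) * x / (q + alpha * n).
Proof.
rewrite /spike_bias /spike_den.
have -> : s * ((q - n) / q * (s * x)) = s ^+ 2 * ((q - n) / q * x) by ring.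
by rewrite s2; field; rewrite den q0.
Qed.

Lemma bias1_limit x B : let gamma := q / n in
  bias1_of alpha s x ((q - n) / q) ((q - n) / q * (s * x)) ((q - n) / q * (B ^+ 2 + alpha * x ^+ 2)) =
  x ^+ 2 * (gamma * (gamma - 1) * (1 + alpha) / (gamma + alpha) ^+ 2 - (q - n) / q) +
  (q - n) / q * B ^+ 2.
Proof.
move=> gamma; rewrite /bias1_of bias_lim /spike_den /gamma.
have -> : (s * x - (q - n) / q * (s * x)) ^+ 2 = s ^+ 2 * (n / q * x) ^+ 2 by field.
by rewrite s2; field; rewrite q0 n_neq0 den.
Qed.

Lemma bias2_limit x B : let gamma := q / n in
  bias2_of alpha ((q - n) / q) (m1 / q * (s * x))
    (m1 / q * ((q - m1) / (q - n)) * (B ^+ 2 + alpha * x ^+ 2)) =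
  x ^+ 2 * ((m1 / n) ^+ 2 * ((1 + alpha) * (1 + (1 + alpha) ^+ 2 / (gamma - 1)) /
      ((gamma - 1) * (1 + (1 + alpha) / (gamma - 1)) ^+ 2) - 1 / gamma) +
      m1 / n * (1 - m1 / n) * (alpha / (gamma - 1))) +
  m1 * (q - m1) / (q * (q - n)) * B ^+ 2.
Proof.
move=> gamma; rewrite /bias2_of /spike_den /gamma.
have -> : (m1 / q * (s * x)) ^+ 2 = s ^+ 2 * (m1 / q * x) ^+ 2 by ring.
rewrite s2; field; rewrite qn q0 n_neq0 (_ : _ + _ + _ = q + alpha * n)//; ring.
Qed.

Lemma bias3_limit x xt : let gamma := q / n in
  bias3_of alpha s x ((q - n) / q) ((q - n) / q * (s * x)) (m1 / q * (s * xt)) =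
  - (2 * m1 / n * x * xt * ((gamma - 1) * (1 + alpha) * alpha / (gamma + alpha) ^+ 2)).
Proof.
move=> gamma; rewrite /bias3_of bias_lim /spike_den /gamma.
have -> : s * (m1 / q * (s * xt)) = s ^+ 2 * (m1 / q * xt) by ring.
by rewrite s2; field; rewrite n_neq0 den q0.
Qed.

End limits.

(** * Sherman-Morrison for a spiked covariance *)

Section spiked_root.
Context (R : rcfType) (p : nat) (alpha : R) (v : 'cV[R]_p).
Hypotheses (alpha0 : 0 <= alpha) (vv : dotv v v = 1).

Definition spike_mx : 'M[R]_p := 1%:M + alpha *: outer v v.
Definition spike_root : R := Num.sqrt (1 + alpha).
(** The square root of [spike_mx]: it acts as [spike_root] on [v] and as 1 on its
    orthogonal. *)
Definition root_mx : 'M[R]_p := 1%:M + (spike_root - 1) *: outer v v.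

Let s := spike_root.

Lemma spike_root2 : s ^+ 2 = 1 + alpha.
Proof. by rewrite sqr_sqrtr// addr_ge0. Qed.

Lemma spike_root_ge1 : 1 <= s.
Proof. by rewrite -sqrtr1 ler_sqrt ?lerDl// addr_ge0. Qed.

Lemma root_mxv (w : 'cV[R]_p) : root_mx *m w = w + ((s - 1) * dotv v w) *: v.
Proof. by rewrite /root_mx mulmxDl mul1mx -scalemxAl outerv scalerA. Qed.

Lemma spike_mxv (w : 'cV[R]_p) : spike_mx *m w = w + (alpha * dotv v w) *: v.
Proof. by rewrite /spike_mx mulmxDl mul1mx -scalemxAl outerv scalerA. Qed.

Lemma root_mxT : root_mx^T = root_mx.
Proof. by rewrite /root_mx linearD/= linearZ/= trmx1 outerT. Qed.

Lemma root_mx_sqr : root_mx *m root_mx = spike_mx.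
Proof.
rewrite /root_mx /spike_mx mulmxDl mul1mx -scalemxAl mulmxDr mulmx1 -scalemxAr.
rewrite outer_outer vv scale1r -/s.
have -> : alpha = s ^+ 2 - 1 by rewrite spike_root2; ring.
by move: (outer v v) => O; apply/matrixP => i j; rewrite !mxE; ring.
Qed.

Lemma sqrt_spike_mx : sqrt_mx spike_mx = root_mx.
Proof.
apply: sqrt_mx_eq; split; last exact: root_mx_sqr.
split=> [|w]; first exact: root_mxT.
rewrite root_mxv dotvDr dotvZr (dotvC w v) addr_ge0 ?dotv_ge0//.
by rewrite -mulrA mulr_ge0 -?expr2 ?sqr_ge0// subr_ge0 spike_root_ge1.
Qed.

Lemma dotv_root (w : 'cV[R]_p) : dotv v (root_mx *m w) = s * dotv v w.
Proof. by rewrite root_mxv dotvDr dotvZr vv; ring. Qed.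

Lemma normv_root (w : 'cV[R]_p) : dotv (root_mx *m w) (root_mx *m w) =
  dotv w w + alpha * dotv v w ^+ 2.
Proof.
have -> : alpha = s ^+ 2 - 1 by rewrite spike_root2; ring.
by rewrite root_mxv !dotvE vv (dotvC w v); ring.
Qed.

Lemma dotv_spike (a b : 'cV[R]_p) :
  dotv a (spike_mx *m b) = dotv a b + alpha * dotv v a * dotv v b.
Proof. by rewrite spike_mxv dotvDr dotvZr (dotvC a v); ring. Qed.

Section design.
Context (n : nat) (Z : 'M[R]_(n, p)) (L : 'M[R]_n).
Hypothesis uZ : Z *m Z^T \in unitmx.

Variables (K0 K : 'M[R]_n) (zeta : 'cV[R]_n) (X : 'M[R]_(n, p)).
Hypotheses (K0E : K0 = invmx (Z *m Z^T)) (zetaE : zeta = Z *m v) (XE : X = Z *m root_mx).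
Let W := dotv zeta (K0 *m zeta).
Let g := 1 - W.
Let q := spike_den alpha g.
Hypothesis KE : K = K0 - (alpha / q) *: outer (K0 *m zeta) (K0 *m zeta).

(* [K] is the Sherman-Morrison inverse of [X *m X^T]. *)
Let K0T : K0^T = K0.
Proof. by rewrite K0E trmx_inv trmx_mul trmxK. Qed.

Let K0M : K0 *m (Z *m Z^T) = 1%:M. Proof. by rewrite K0E mulVmx. Qed.

Let dotvK0 a b : dotv (K0 *m a) b = dotv a (K0 *m b).
Proof. by rewrite [RHS]dotv_mull K0T. Qed.

Let dotvZ a b : dotv a (Z^T *m b) = dotv (Z *m a) b.
Proof. by rewrite dotv_mull trmxK. Qed.

Let W_E : W = dotv (Z^T *m (K0 *m zeta)) (Z^T *m (K0 *m zeta)).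
Proof.
rewrite dotvZ dotvC dotvK0 [Z *m (Z^T *m _)]mulmxA [K0 *m (_ *m _)]mulmxA.
by rewrite K0M mul1mx /W -dotvK0 dotvC.
Qed.

Lemma spike_mass_ge0 : 0 <= W. Proof. by rewrite W_E dotv_ge0. Qed.

Let qE : q = 1 + alpha * W.
Proof. by rewrite /q /spike_den /g; ring. Qed.

Let q0 : q != 0.
Proof. by rewrite gt_eqF// qE ltr_wpDr// mulr_ge0// spike_mass_ge0. Qed.

Let XT : X^T = root_mx *m Z^T. Proof. by rewrite XE trmx_mul root_mxT. Qed.

Let XXT : X *m X^T = Z *m Z^T + alpha *: outer zeta zeta.
Proof.
rewrite XT XE -mulmxA [root_mx *m (_ *m _)]mulmxA root_mx_sqr /spike_mx.
rewrite mulmxDl mul1mx mulmxDr -scalemxAl -scalemxAr outerMr outerMl trmxK zetaE.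
by [].
Qed.

Let XXK : X *m X^T *m K = 1%:M.
Proof.
rewrite XXT KE mulmxDl !mulmxBr -!scalemxAr -!scalemxAl outerMl outerMr outer_outer.
rewrite K0T -/W [Z *m Z^T *m (K0 *m _)]mulmxA K0E !mulmxV// mul1mx -K0E.
have := q0; rewrite qE => q1; move: (outer zeta _) => O; apply/matrixP => i j.
by rewrite !mxE; field.
Qed.

Let uX : X *m X^T \in unitmx.
Proof. by have [] := mulmx1_unit XXK. Qed.

Let XXTV : invmx (X *m X^T) = K.
Proof. by rewrite -[LHS]mulmx1 -XXK mulKmx. Qed.

Let KXX : K *m (X *m X^T) = 1%:M.
Proof. by rewrite -XXTV mulVmx. Qed.

Let KT : K^T = K.
Proof. by rewrite -XXTV trmx_inv trmx_mul trmxK. Qed.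

(** [X] has independent rows, hence [X^T X] is a full-rank factorization. *)
Lemma pinv_gram (c : R) : c != 0 -> Defs.pinv (c *: (X^T *m X)) = c^-1 *: (X^T *m K *m K *m X).
Proof.
move=> c0; apply: pinv_eq.
have cT : (c *: X^T)^T = c *: X by rewrite linearZ/= trmxK.
have cc : (c *: X^T)^T *m (c *: X^T) = (c * c) *: (X *m X^T).
  by rewrite cT -scalemxAl -scalemxAr scalerA.
have cu : c * c != 0 by rewrite mulf_neq0.
have u2 : (c *: X^T)^T *m (c *: X^T) \in unitmx by rewrite cc unitmxZ ?unitfE.
have := is_pinv_full_rank uX u2; rewrite cc invmxZ ?unitmxZ ?unitfE// XXTV cT -scalemxAl.
congr is_pinv; rewrite -!scalemxAl -!scalemxAr scalerA -!mulmxA; congr (_ *: _).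
by field.
Qed.

Let Pi := 1%:M - X^T *m K *m X.

Let PiXT : Pi *m X^T = 0.
Proof.
by rewrite mulmxBl mul1mx -!mulmxA [K *m _]KXX mulmx1 subrr.
Qed.

Let Kv (w : 'cV[R]_n) : K *m w = K0 *m w - (alpha / q * dotv (K0 *m zeta) w) *: (K0 *m zeta).
Proof. by rewrite KE mulmxBl -scalemxAl outerv scalerA. Qed.

Let Kzeta : K *m zeta = q^-1 *: (K0 *m zeta).
Proof.
rewrite Kv dotvK0 -/W -[in LHS](scale1r (K0 *m zeta)) scalerA -scalerBl mulr1.
by congr (_ *: _); have := q0; rewrite qE => q1; field.
Qed.

Let Xv : X *m v = s *: zeta.
Proof.
rewrite XE zetaE -mulmxA root_mxv vv mulr1 -[X in X + _]scale1r -scalerDl -scalemxAr.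
by congr (_ *: _); ring.
Qed.

Let dotKX w : dotv v (X^T *m (K *m w)) = s / q * dotv (K0 *m zeta) w.
Proof. by rewrite dotv_mull trmxK Xv dotvZl dotv_mull KT Kzeta dotvZl mulrA. Qed.

Let trace_spike : \tr (X^T *m K *m K *m X *m spike_mx) =
  var_of alpha g (\tr K0) (dotv v (Z^T *m K0 *m K0 *m Z *m v)).
Proof.
have E : dotv v (Z^T *m K0 *m K0 *m Z *m v) = dotv (K0 *m zeta) (K0 *m zeta).
  by rewrite -!mulmxA dotvZ -zetaE dotvK0.
rewrite E /spike_mx mulmxDr mulmx1 -scalemxAr mxtraceD mxtraceZ.
have -> : \tr (X^T *m K *m K *m X) = \tr K.
  by rewrite -!mulmxA mxtrace_mulC -!mulmxA KXX mulmx1.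
rewrite outerMl mxtrace_outer -!mulmxA dotKX Xv -scalemxAr dotvZr Kzeta dotvZr.
rewrite KE linearB/= mxtraceZ mxtrace_outer /var_of -/q.
set H := dotv _ _; have -> : 1 + alpha = s ^+ 2 by rewrite spike_root2.
by field.
Qed.

Lemma spiked_var c : c != 0 -> \tr (Defs.pinv (c *: (X^T *m X)) *m spike_mx) =
  c^-1 * var_of alpha g (\tr K0) (dotv v (Z^T *m K0 *m K0 *m Z *m v)).
Proof. by move=> c0; rewrite pinv_gram// -scalemxAl mxtraceZ trace_spike. Qed.

Let pinv_Sh c : c != 0 -> Defs.pinv (c *: (X^T *m X)) *m (c *: (X^T *m X)) - 1%:M = - Pi.
Proof.
move=> c0; rewrite pinv_gram// -scalemxAl -scalemxAr scalerA mulVf// scale1r /Pi opprB.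
by rewrite -!mulmxA [X *m (X^T *m _)]mulmxA [K *m (X *m X^T *m X)]mulmxA KXX mul1mx.
Qed.

Let pinv_S1 c : c != 0 ->
  Defs.pinv (c *: (X^T *m X)) *m (c *: (X^T *m L *m X)) = X^T *m K *m L *m X.
Proof.
move=> c0; rewrite pinv_gram// -scalemxAl -scalemxAr scalerA mulVf// scale1r.
by rewrite -!mulmxA [X *m (X^T *m _)]mulmxA [K *m (X *m X^T *m _)]mulmxA KXX mul1mx.
Qed.

Let PiT : Pi^T = Pi.
Proof. by rewrite /Pi linearB/= trmx1 !trmx_mul KT trmxK mulmxA. Qed.

Let PiPi : Pi *m Pi = Pi.
Proof. by rewrite {2}/Pi mulmxBr mulmx1 !mulmxA PiXT !mul0mx subr0. Qed.

Variable b : 'cV[R]_p.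
Let b' := root_mx *m b.
Let x := dotv v b.
Let h := dotv v b' - dotv v (Z^T *m K0 *m Z *m b').
Let k := dotv b' b' - dotv b' (Z^T *m K0 *m Z *m b').

Let Kb : dotv (K0 *m zeta) (Z *m b') = s * x - h.
Proof. by rewrite /h dotv_root -/x -!mulmxA dotvZ -zetaE dotvK0; ring. Qed.

Let vPib : dotv v (Pi *m b) = spike_bias alpha s x g h.
Proof.
rewrite /Pi mulmxBl mul1mx dotvBr -!mulmxA dotKX XE -mulmxA Kb -/x /spike_bias -/q.
have := q0; rewrite qE => q1; have -> : g = 1 - W by [].
have -> : s / (1 + alpha * W) * (s * x - h) = (s ^+ 2 * x - s * h) / (1 + alpha * W) by ring.
by rewrite spike_root2; field.
Qed.

Let bPib : dotv (Pi *m b) (Pi *m b) = k - alpha * x ^+ 2 + alpha / q * (s * x - h) ^+ 2.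
Proof.
rewrite dotv_mull PiT mulmxA PiPi dotvC /Pi mulmxBl mul1mx dotvBr -!mulmxA.
have -> : dotv b (X^T *m (K *m (X *m b))) =
    dotv b' (Z^T *m K0 *m Z *m b') - alpha / q * (s * x - h) ^+ 2.
  rewrite dotv_mull trmxK XE -mulmxA Kv dotvBr dotvZr (dotvC _ (K0 *m zeta)) Kb.
  by rewrite -!mulmxA dotvZ; ring.
by rewrite /k normv_root -/x; ring.
Qed.

(** [Q] is minus the projection on the kernel of [X], hence the term is [|Pi b|^2] plus the
    contribution of the spike along [v]. *)
Lemma spiked_bias1 c : c != 0 ->
  let Sh := c *: (X^T *m X) in let Q := Defs.pinv Sh *m Sh - 1%:M in
  (b^T *m Q *m spike_mx *m Q *m b) 0 0 = bias1_of alpha s x g h k.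
Proof.
move=> c0 Sh Q; rewrite /Q pinv_Sh//.
have -> : (b^T *m - Pi *m spike_mx *m - Pi *m b) 0 0 = dotv (Pi *m b) (spike_mx *m (Pi *m b)).
  by rewrite /dotv trmx_mul PiT !(mulmxN, mulNmx) opprK -!mulmxA.
by rewrite dotv_spike vPib bPib /bias1_of -/q; ring.
Qed.

Hypothesis LT : L^T = L.
Variable t : 'cV[R]_p.
Let t' := root_mx *m t.
Let y0 := Z^T *m K0 *m L *m Z *m t'.
Let m := dotv v y0.
Let N := dotv y0 y0.
Let e := Z^T *m (K0 *m zeta).
Let yZ := y0 - (alpha / q * m) *: e.

Let mE : dotv (K0 *m zeta) (L *m (Z *m t')) = m.
Proof. by rewrite /m /y0 -!mulmxA dotvZ -zetaE dotvK0. Qed.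

Let yE : X^T *m K *m L *m X *m t = root_mx *m yZ.
Proof.
rewrite XT -!mulmxA; congr (_ *m _).
rewrite XE -mulmxA Kv mulmxBr -scalemxAr mE /yZ /e /y0.
by rewrite -!mulmxA.
Qed.

Let vyZ : dotv v yZ = m / q.
Proof.
rewrite /yZ dotvBr dotvZr -/m /e dotvZ -zetaE -/W.
by have := q0; rewrite qE => q1; field.
Qed.

Let ey0 : dotv e y0 = m.
Proof.
have K0M' u : Z *m (Z^T *m (K0 *m u)) = u.
  by rewrite mulmxA mulmxA K0E mulmxV// mul1mx.
by rewrite dotvC /e dotvZ /y0 -!mulmxA K0M' dotvC mE.
Qed.

Let yZyZ : dotv yZ yZ = N - 2 * (alpha / q) * m ^+ 2 + (alpha / q * m) ^+ 2 * W.
Proof. by rewrite /yZ !dotvE (dotvC y0 e) ey0 -W_E -/N; ring. Qed.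

Lemma spiked_bias2 c : c != 0 ->
  let A := Defs.pinv (c *: (X^T *m X)) in let S1 := c *: (X^T *m L *m X) in
  (t^T *m S1 *m A *m spike_mx *m A *m S1 *m t) 0 0 = bias2_of alpha g m N.
Proof.
move=> c0 A S1; have AS : A *m S1 *m t = root_mx *m yZ by rewrite /A /S1 pinv_S1.
have -> : (t^T *m S1 *m A *m spike_mx *m A *m S1 *m t) 0 0 =
    dotv (A *m S1 *m t) (spike_mx *m (A *m S1 *m t)).
  have S1T : S1^T = S1 by rewrite /S1 linearZ/= !trmx_mul trmxK LT mulmxA.
  have AT : A^T = A by rewrite /A pinv_gram// linearZ/= !trmx_mul trmxK !KT !mulmxA.
  by rewrite /dotv !trmx_mul AT S1T -!mulmxA.
rewrite AS dotv_spike dotv_root vyZ normv_root vyZ yZyZ.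
have -> : alpha * (s * (m / q)) * (s * (m / q)) = alpha * s ^+ 2 * (m / q) ^+ 2 by ring.
rewrite spike_root2 /bias2_of -/q.
by have := q0; rewrite qE => q1; field.
Qed.

(** Only the spike contributes, since [Pi b] is orthogonal to the row space of [X]. *)
Lemma spiked_bias3 c : c != 0 ->
  let Sh := c *: (X^T *m X) in let A := Defs.pinv Sh in let S1 := c *: (X^T *m L *m X) in
  2 * (b^T *m (A *m Sh - 1%:M) *m spike_mx *m A *m S1 *m t) 0 0 = bias3_of alpha s x g h m.
Proof.
move=> c0 Sh A S1; have AS : A *m S1 *m t = root_mx *m yZ by rewrite /A /S1 pinv_S1.
rewrite [A *m Sh - _]pinv_Sh//.
have -> : (b^T *m - Pi *m spike_mx *m A *m S1 *m t) 0 0 =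
    - dotv (Pi *m b) (spike_mx *m (A *m S1 *m t)).
  by rewrite /dotv trmx_mul PiT !(mulmxN, mulNmx) mxE -!mulmxA.
rewrite dotv_spike vPib.
have -> : dotv (Pi *m b) (A *m S1 *m t) = 0.
  rewrite dotvC dotv_mull PiT /A /S1 pinv_S1// -!mulmxA mulmxA PiXT mul0mx dotv0l//.
rewrite AS dotv_root vyZ /bias3_of -/q; ring.
Qed.

End design.
End spiked_root.

(** * From the isotropic design to the risk *)

Lemma independent_vars_inj d (T : measurableType d) (R : realType) (P : probability T R)
    (I J : finType) (X : I -> {RV P >-> R}) (f : J -> I) :
  injective f -> independent_vars X -> independent_vars (X \o f).
Proof.
move=> f_inj iX A E AE.
have [E' E'E] : exists E' : I -> set T, forall j, E' (f j) = E j.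
  exists (fun i => if [pick j | f j == i] is Some j then E j else setT) => j.
  by case: pickP => [j' /eqP/f_inj -> //|/(_ j)]; rewrite eqxx.
have := iX (f @: A)%SET E'.
rewrite (big_imset _ (in2W f_inj))/= => iA.
have -> : \bigcap_(j in [set` A]) E j = \bigcap_(i in [set` (f @: A)%SET]) E' i.
  apply/seteqP; split => w Aw.
    by move=> i /= /imsetP[j jA ->]; rewrite E'E; exact: Aw.
  by move=> j jA; rewrite -E'E; apply: Aw; rewrite /=; exact: imset_f.
rewrite iA; first by apply: eq_bigr => j _; rewrite E'E.
by move=> i /imsetP[j jA ->]; rewrite E'E; exact: AE.
Qed.

Lemma head_mxT (R : realType) n n1 : (head_mx R n n1)^T = head_mx R n n1.
Proof. exact: tr_diag_mx. Qed.

Lemma head_mx_full (R : realType) n : head_mx R n n = 1%:M.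
Proof. by apply/matrixP => i j; rewrite !mxE ltn_ord. Qed.

Lemma head_mx_gram (R : realType) n1 n2 p (A : 'M[R]_(n1, p)) (A' : 'M[R]_(n2, p)) :
  (col_mx A A')^T *m head_mx R (n1 + n2) n1 *m col_mx A A' = A^T *m A.
Proof.
have -> : head_mx R (n1 + n2) n1 = block_mx 1%:M 0 0 0.
  rewrite /head_mx (_ : \row_j _ = row_mx (const_mx 1) 0).
    by rewrite diag_mx_row linear0 diag_const_mx.
  by apply/rowP => j; rewrite !mxE; case: splitP => j' _; rewrite mxE.
by rewrite tr_col_mx mul_row_block mul_row_col !mulmx0 !addr0 mulmx1 mul0mx addr0.
Qed.

Definition risks_within (R : realFieldType) (alpha q n m1 x B xt Bt V0 V B1 B2 B3 rate : R) :=
  let gamma := q / n in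
  [/\ `|V - V0| <= rate,
      `|B1 - (x ^+ 2 * (gamma * (gamma - 1) * (1 + alpha) / (gamma + alpha) ^+ 2 - (q - n) / q) +
        (q - n) / q * B ^+ 2)| <= rate * B ^+ 2,
      `|B2 - (xt ^+ 2 * ((m1 / n) ^+ 2 * ((1 + alpha) * (1 + (1 + alpha) ^+ 2 / (gamma - 1)) /
          ((gamma - 1) * (1 + (1 + alpha) / (gamma - 1)) ^+ 2) - 1 / gamma) +
          m1 / n * (1 - m1 / n) * (alpha / (gamma - 1))) +
        m1 * (q - m1) / (q * (q - n)) * Bt ^+ 2)| <= rate * Bt ^+ 2 &
      `|B3 - - (2 * m1 / n * x * xt * ((gamma - 1) * (1 + alpha) * alpha /
        (gamma + alpha) ^+ 2))| <= rate * (B * Bt)].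

Section risk_close.
Context (R : realType) (alpha c : R).
Hypotheses (alpha0 : 0 <= alpha) (c0 : 0 < c).

Let s := spike_root alpha.
Let K := 1 + c^-1 ^+ 2.

Let s0 : 0 <= s. Proof. exact: sqrtr_ge0. Qed.
Let K0 : 0 <= K. Proof. by rewrite addr_ge0// sqr_ge0. Qed.
Let c'0 : 0 <= c^-1. Proof. by rewrite invr_ge0 ltW. Qed.

Let l2norm_root p (v b : 'cV[R]_p) : dotv v v = 1 ->
  l2norm (root_mx alpha v *m b) <= s * l2norm b.
Proof.
move=> vv; rewrite -[leRHS]ger0_norm ?mulr_ge0 ?l2norm_ge0// -sqrtr_sqr.
rewrite ler_wsqrtr// normv_root// exprMn spike_root2// l2norm_sqr mulrDl mul1r lerD2l.
by rewrite ler_wpM2l// (le_trans (dotv_CS _ _))// vv mul1r.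
Qed.

Let dotv_le_norm p (v b : 'cV[R]_p) : dotv v v = 1 -> `|dotv v b| <= l2norm b.
Proof.
move=> vv; apply: sqr_le_abs; first exact: l2norm_ge0.
by rewrite l2norm_sqr (le_trans (dotv_CS _ _))// vv mul1r.
Qed.

Let dims p n : (0 < n)%N -> c * p%:R <= p%:R - n%:R -> 0 < p%:R :> R /\ n%:R < p%:R :> R.
Proof.
move=> n0 cp; have n0' : 0 < n%:R :> R by rewrite ltr0n.
have cp0 : 0 <= c * p%:R by rewrite mulr_ge0// ltW.
have p0 : 0 < p%:R :> R by rewrite (lt_le_trans n0')// -subr_ge0 (le_trans cp0).
by split=> //; rewrite -subr_gt0 (lt_le_trans _ cp)// mulr_gt0.
Qed.

Section one_design.
Context (p n n1 : nat) (Z : 'M[R]_(n, p)) (v b t : 'cV[R]_p) (r : R).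
Hypotheses (vv : dotv v v = 1) (n1n : (n1 <= n)%N) (n0 : (0 < n)%N).
Hypotheses (cp : c * p%:R <= p%:R - n%:R) (r01 : 0 <= r <= 1) (pr : p%:R^-1 <= r).

Let Rt := root_mx alpha v.
Hypotheses (Hvv : iso_close n Z v v r) (Hvb : iso_close n Z v (Rt *m b) r)
  (Hbb : iso_close n Z (Rt *m b) (Rt *m b) r) (Hvt : iso_close n1 Z v (Rt *m t) r).

Let K0i := invmx (Z *m Z^T).
Let W := dotv (Z *m v) (K0i *m (Z *m v)).
Let y0 := ridgeless n1 Z (Rt *m t).

Let r0 : 0 <= r. Proof. by case/andP: r01. Qed.
Let p0 : 0 < p%:R :> R. Proof. by have [] := dims n0 cp. Qed.
Let np : n%:R < p%:R :> R. Proof. by have [] := dims n0 cp. Qed.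
Let cp0 : 0 < c * p%:R. Proof. exact: mulr_gt0. Qed.
Let D0 : 0 < p%:R - n%:R :> R. Proof. by rewrite subr_gt0. Qed.
Let D1 : 0 < p%:R - n%:R + 1 :> R. Proof. exact: addr_gt0. Qed.
Let n1p : n1%:R <= p%:R :> R.
Proof. by rewrite (le_trans _ (ltW np))// ler_nat. Qed.
Let pn0 : p%:R != 0 :> R. Proof. by rewrite gt_eqF. Qed.

Let frac_le (a e : R) : 0 <= a -> a <= e -> 0 < e -> 0 <= a / e <= 1.
Proof. by move=> a0 ae e0; rewrite divr_ge0 ?(ltW e0)//= ler_pdivrMr// mul1r. Qed.

Let norm_v : l2norm v = 1. Proof. by rewrite /l2norm vv sqrtr1. Qed.

Let full_ridgeless (u w : 'cV[R]_p) : dotv u (ridgeless n Z w) =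
  dotv u (Z^T *m K0i *m Z *m w).
Proof. by rewrite /ridgeless head_mx_full mulmx1. Qed.

(** The limits of the recursions have the denominator [p - n + 1] instead of [p - n]. *)
Let shift (a : R) : 0 <= a -> a <= p%:R ->
  `|a / (p%:R - n%:R + 1) - a / (p%:R - n%:R)| <= c^-1 ^+ 2 * r.
Proof.
move=> a0 ap.
have -> : a / (p%:R - n%:R + 1) - a / (p%:R - n%:R) =
    - (a * ((p%:R - n%:R + 1)^-1 * (p%:R - n%:R)^-1)).
  by field; rewrite !gt_eqF.
have i0 : 0 <= (p%:R - n%:R)^-1 :> R by rewrite invr_ge0 ltW.
have i1 : 0 <= (p%:R - n%:R + 1)^-1 :> R by rewrite invr_ge0 ltW.
have b0 : (p%:R - n%:R)^-1 <= (c * p%:R)^-1 by rewrite lef_pV2.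
have b1 : (p%:R - n%:R + 1)^-1 <= (c * p%:R)^-1.
  by rewrite (le_trans _ b0)// lef_pV2 ?posrE// lerDl.
rewrite normrN ger0_norm ?mulr_ge0//.
apply: (@le_trans _ _ (p%:R * ((c * p%:R)^-1 * (c * p%:R)^-1))).
  by apply: ler_pM => //; [exact: mulr_ge0|exact: ler_pM].
have -> : p%:R * ((c * p%:R)^-1 * (c * p%:R)^-1) = c^-1 ^+ 2 * p%:R^-1.
  by field; rewrite pn0 gt_eqF.
by rewrite ler_wpM2l// sqr_ge0.
Qed.

Let etaE : (p%:R - n%:R) / p%:R = 1 - n%:R / p%:R :> R.
Proof. by rewrite mulrBl divff. Qed.

Let K0T : K0i^T = K0i.
Proof. by rewrite /K0i trmx_inv trmx_mul trmxK. Qed.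

Let uZ : Z *m Z^T \in unitmx. Proof. by case: Hvv. Qed.

Let W0 : 0 <= W. Proof. exact: (spike_mass_ge0 uZ (Z *m v) erefl). Qed.

Let W_close : `|W - n%:R / p%:R| <= r.
Proof.
case: Hvv => _ + _ _ _; rewrite full_ridgeless vv norm_v !mulr1.
by rewrite -!mulmxA dotv_mull trmxK.
Qed.

Let norm_t : l2norm t ^+ 2 + alpha * dotv v t ^+ 2 = l2norm (Rt *m t) ^+ 2.
Proof. by rewrite !l2norm_sqr normv_root. Qed.

Let norm_b : l2norm b ^+ 2 + alpha * dotv v b ^+ 2 = l2norm (Rt *m b) ^+ 2.
Proof. by rewrite !l2norm_sqr normv_root. Qed.

Let sqr_root (w : 'cV[R]_p) : l2norm (Rt *m w) ^+ 2 <= (s * l2norm w) ^+ 2.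
Proof.
by rewrite lerXn2r ?nnegrE ?mulr_ge0 ?l2norm_ge0// l2norm_root.
Qed.

Let g_close : `|1 - W - (p%:R - n%:R) / p%:R| <= r.
Proof. by rewrite etaE (_ : _ - _ = - (W - n%:R / p%:R)) ?normrN//; ring. Qed.

Let h_close : `|dotv v (Rt *m b) - dotv v (Z^T *m K0i *m Z *m (Rt *m b)) -
  (p%:R - n%:R) / p%:R * (s * dotv v b)| <= r * (s * l2norm b).
Proof.
case: Hvb => _ + _ _ _; rewrite full_ridgeless norm_v mul1r dotv_root// => h.
apply: (@le_trans _ _ (r * l2norm (Rt *m b))); last by rewrite ler_wpM2l// l2norm_root.
apply: le_trans h; rewrite etaE -normrN le_eqVlt; apply/orP; left; apply/eqP.
by congr (`|_|); rewrite /s; ring.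
Qed.

Let k_close : `|dotv (Rt *m b) (Rt *m b) - dotv (Rt *m b) (Z^T *m K0i *m Z *m (Rt *m b)) -
  (p%:R - n%:R) / p%:R * (l2norm b ^+ 2 + alpha * dotv v b ^+ 2)| <= r * (s * l2norm b) ^+ 2.
Proof.
case: Hbb => _ + _ _ _; rewrite full_ridgeless => h.
apply: (@le_trans _ _ (r * l2norm (Rt *m b) ^+ 2)); last by rewrite ler_wpM2l// sqr_root.
rewrite norm_b -expr2 in h *; apply: le_trans h; rewrite etaE -normrN l2norm_sqr.
by rewrite le_eqVlt; apply/orP; left; apply/eqP; congr (`|_|); ring.
Qed.

Let m_close : `|dotv v y0 - n1%:R / p%:R * (s * dotv v t)| <= r * (s * l2norm t).
Proof.
case: Hvt => _ + _ _ _; rewrite norm_v mul1r dotv_root// => h.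
by rewrite (le_trans h)// ler_wpM2l// l2norm_root.
Qed.

Let N_close : `|dotv y0 y0 - n1%:R / p%:R * ((p%:R - n1%:R) / (p%:R - n%:R)) *
  (l2norm t ^+ 2 + alpha * dotv v t ^+ 2)| <= K * r * (s * l2norm t) ^+ 2.
Proof.
case: Hvt => _ _ + _ _; rewrite -/y0 norm_t => h.
set B2 := l2norm (Rt *m t) ^+ 2 in h *.
have B20 : 0 <= B2 by exact: sqr_ge0.
have trajE : traj_norm n1 (Rt *m t) n =
    n1%:R / p%:R * ((p%:R - n1%:R + 1) / (p%:R - n%:R + 1)) * B2.
  rewrite /traj_norm /B2 l2norm_sqr; case: ifP => // nn1.
  have -> : n1 = n by apply/eqP; rewrite eqn_leq n1n.
  by rewrite divff ?mulr1// gt_eqF.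
apply: (@le_trans _ _ (K * r * B2)); last by rewrite ler_wpM2l ?sqr_root// mulr_ge0.
have -> : dotv y0 y0 - n1%:R / p%:R * ((p%:R - n1%:R) / (p%:R - n%:R)) * B2 =
    (dotv y0 y0 - traj_norm n1 (Rt *m t) n) +
    n1%:R / p%:R * ((n%:R - n1%:R) / (p%:R - n%:R + 1) - (n%:R - n1%:R) / (p%:R - n%:R)) * B2.
  by rewrite trajE; field; rewrite pn0 !gt_eqF.
have -> : K * r * B2 = r * B2 + c^-1 ^+ 2 * r * B2 by rewrite /K; ring.
rewrite (le_trans (ler_normD _ _))//; apply: lerD => //.
rewrite normrM (ger0_norm B20) ler_wpM2r// normrM -[leRHS]mul1r.
have /andP[f0 f1] := frac_le (ler0n R n1) n1p p0.
apply: ler_pM => //; first by rewrite ger0_norm.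
apply: shift; first by rewrite subr_ge0 ler_nat.
by rewrite (le_trans _ (ltW np))// gerBl.
Qed.

Let tau_close : `|\tr K0i - n%:R / (p%:R - n%:R)| <= K * r.
Proof.
case: Hvv => _ _ _ h _; have -> : \tr K0i - n%:R / (p%:R - n%:R) =
  (\tr K0i - n%:R / (p%:R - n%:R + 1)) +
  (n%:R / (p%:R - n%:R + 1) - n%:R / (p%:R - n%:R)) by ring.
rewrite (le_trans (ler_normD _ _))// /K mulrDl mul1r lerD//.
by apply: shift => //; exact: ltW.
Qed.

Let H_close : 0 <= dotv v (Z^T *m K0i *m K0i *m Z *m v) <= r.
Proof.
case: Hvv => _ _ _ _; rewrite norm_v expr1n mulr1 -/K0i => ->; rewrite andbT.
by rewrite -!mulmxA dotv_mull trmxK dotv_mull K0T dotv_ge0.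
Qed.

Let tau0_bound : 0 <= (n%:R / (p%:R - n%:R) : R) <= c^-1.
Proof.
rewrite divr_ge0 ?(ltW D0)//= ler_pdivrMr// mulrC ler_pdivlMr// mulrC.
by rewrite (le_trans _ cp)// ler_wpM2l ?(ltW c0)// ltW.
Qed.

Let nu_bound : 0 <= (n1%:R / p%:R * ((p%:R - n1%:R) / (p%:R - n%:R)) : R) <= c^-1.
Proof.
have /andP[f0 f1] := frac_le (ler0n R n1) n1p p0.
have h0 : 0 <= (p%:R - n1%:R) / (p%:R - n%:R) :> R by rewrite divr_ge0 ?(ltW D0)// subr_ge0.
rewrite mulr_ge0//= -[leRHS]mul1r; apply: ler_pM => //.
rewrite ler_pdivrMr// mulrC ler_pdivlMr// mulrC.
by rewrite (le_trans _ cp)// ler_wpM2l ?(ltW c0)// gerBl.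
Qed.

Let eta_bound : 0 <= ((p%:R - n%:R) / p%:R : R) <= 1.
Proof. by apply: frac_le; rewrite ?(ltW D0)// gerBl. Qed.

Definition spiked_data_of : spiked_data alpha s c^-1 K :=
  SpikedData r01 eta_bound (frac_le (ler0n R n1) n1p p0) nu_bound tau0_bound
    (l2norm_ge0 b) (l2norm_ge0 t) (dotv_le_norm b vv) (dotv_le_norm t vv)
    (ltac:(by rewrite gerBl) : 1 - W <= 1) g_close h_close k_close m_close N_close
    tau_close H_close.

End one_design.

(** Four instances of the isotropic estimate are enough: with all the rows as source rows,
    [u^T Z^T (Z Z^T)^-1 Z t] gives the forms of the projection at [(v, v)], [(v, Rt b)] and
    [(Rt b, Rt b)], and the pair [(v, Rt t)] with the true source rows gives the rest. *)
Lemma spiked_risk_close : exists2 C : R, 0 <= C & forall p n n1 (Z : 'M[R]_(n, p))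
    (v b t : 'cV[R]_p) (r : R),
  dotv v v = 1 -> (n1 <= n)%N -> (0 < n)%N -> c * p%:R <= p%:R - n%:R ->
  0 <= r <= 1 -> p%:R^-1 <= r ->
  let Rt := root_mx alpha v in let L := head_mx R n n1 in
  iso_close n Z v v r -> iso_close n Z v (Rt *m b) r ->
  iso_close n Z (Rt *m b) (Rt *m b) r -> iso_close n1 Z v (Rt *m t) r ->
  let X := Z *m Rt in let Sh := n%:R^-1 *: (X^T *m X) in
  let A := Defs.pinv Sh in let S1 := n%:R^-1 *: (X^T *m L *m X) in
  let Q := A *m Sh - 1%:M in
  risks_within alpha p%:R n%:R n1%:R (dotv v b) (l2norm b) (dotv v t) (l2norm t)
    (n%:R / (p%:R - n%:R)) (n%:R^-1 * \tr (A *m spike_mx alpha v))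
    ((b^T *m Q *m spike_mx alpha v *m Q *m b) 0 0)
    ((t^T *m S1 *m A *m spike_mx alpha v *m A *m S1 *m t) 0 0)
    (2 * (b^T *m Q *m spike_mx alpha v *m A *m S1 *m t) 0 0) (C * r).
Proof.
have [A0 [e0 hV]] := agree_var s c^-1 alpha0 K0.
have [A1 [e1 h1]] := agree_bias1 c^-1 K alpha0 s0.
have [A2 [e2 h2]] := agree_bias2 c^-1 alpha0 s0 K0.
have [A3 [e3 h3]] := agree_bias3 c^-1 K alpha0 s0.
exists (`|e0| + `|e1| + `|e2| + `|e3|); first by rewrite !addr_ge0.
move=> p n n1 Z v b t r vv n1n n0 cp r01 pr Rt L Hvv Hvb Hbb Hvt X Sh A S1 Q.
have r0 : 0 <= r by case/andP: r01.
have [_ np] := dims n0 cp.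
pose D := spiked_data_of vv n1n n0 cp r01 pr Hvv Hvb Hbb Hvt.
have n0' : 0 < n%:R :> R by rewrite ltr0n.
have nn0 : n%:R^-1 != 0 :> R by rewrite invr_neq0// gt_eqF.
have s2 := spike_root2 alpha0.
have [uZ _ _ _ _] := Hvv.
have wk (e S x : R) : 0 <= S -> e <= `|e0| + `|e1| + `|e2| + `|e3| ->
    `|x| <= e * r * S -> `|x| <= (`|e0| + `|e1| + `|e2| + `|e3|) * r * S.
  by move=> S0 ee /le_trans; apply; rewrite ler_wpM2r// ler_wpM2r.
have [a0 a1 a2 a3] := And4 (ler_norm e0) (ler_norm e1) (ler_norm e2) (ler_norm e3).
have [z0 z1 z2 z3] := And4 (normr_ge0 e0) (normr_ge0 e1) (normr_ge0 e2) (normr_ge0 e3).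
split.
- rewrite /A /Sh (spiked_var alpha0 vv uZ erefl erefl erefl erefl nn0).
  rewrite mulrA mulfV// mul1r; have [_ _] := hV D.
  by move=> /wk; rewrite !mulr1; apply => //; lra.
- rewrite /Q /A /Sh (spiked_bias1 alpha0 vv uZ erefl erefl erefl erefl b nn0).
  rewrite -(bias1_limit alpha0 s2 n0' np).
  have [_ _] := h1 D; rewrite -expr2 => /wk; apply; first exact: sqr_ge0.
  lra.
- rewrite /A /Sh /S1 (spiked_bias2 alpha0 vv uZ erefl erefl erefl erefl (head_mxT R n n1) t nn0).
  rewrite -(bias2_limit _ alpha0 s2 n0' np).
  have [_ _] := h2 D; rewrite -expr2 => /wk; apply; first exact: sqr_ge0.
  lra.
- rewrite /Q /A /Sh /S1 (spiked_bias3 alpha0 vv L uZ erefl erefl erefl erefl b t nn0).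
  rewrite -(bias3_limit _ alpha0 s2 n0' np).
  have [_ _] := h3 D => /wk; apply; first by rewrite mulr_ge0// l2norm_ge0.
  lra.
Qed.
End risk_close.

Lemma positive_sample_size (R : realType) (tau : R) p n : 0 < tau ->
  1 + tau <= p%:R / n%:R -> (0 < n)%N.
Proof.
by move=> t0; case: n => //; rewrite invr0 mulr0 => h; have := ltr_wpDl ler01 t0; rewrite ltNge h.
Qed.

Lemma dimension_gap (R : realType) (tau : R) p n : 0 < tau ->
  1 + tau <= p%:R / n%:R -> tau / (1 + tau) * p%:R <= p%:R - n%:R.
Proof.
move=> t0 pn; have n0 : 0 < n%:R :> R by rewrite ltr0n (positive_sample_size t0 pn).
have t1 : 0 < 1 + tau by rewrite addr_gt0.
move: pn; rewrite ler_pdivlMr// => pn.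
rewrite mulrAC ler_pdivrMr//; lra.
Qed.

Section model.
Context (R : realType) (tau sigma alpha : R) (p : nat) (M : transfer_model R p) (v : 'cV[R]_p).

Definition spiked_model := [/\ standing_conditions tau sigma M, gaussian_design M,
  l2norm v = 1, Sigma1 M = 1%:M + alpha *: (v *m v^T) & Sigma2 M = 1%:M + alpha *: (v *m v^T)].

Definition risk_event (rate : R) := [set w : Omega M |
  risks_within alpha p%:R (ntot M)%:R (n1 M)%:R (dotv v (beta2 M)) (l2norm (beta2 M))
    (dotv v (betatilde M)) (l2norm (betatilde M))
    (sigma ^+ 2 * ((ntot M)%:R / (p%:R - (ntot M)%:R)))
    (risk_V sigma w) (risk_B1 w) (risk_B2 w) (risk_B3 w) rate].

(** The run treats the source rows first, hence this order. *)
Definition design_entry (ij : 'I_(n1 M + n2 M) * 'I_p) : {RV (Pr M) >-> R} :=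
  @all_design_entries R p M
    (match fintype.split ij.1 with inl i => inl (i, ij.2) | inr i => inr (i, ij.2) end).

Lemma design_entry_independent : gaussian_design M -> independent_vars design_entry.
Proof.
move=> [iX _]; apply: (independent_vars_inj _ iX) => -[i j] [i' j'] /=.
have := can_inj (@splitK (n1 M) (n2 M)) (x1 := i) (x2 := i').
by case: (fintype.split i) => a; case: (fintype.split i') => a' // h [ea ->]; rewrite h// ea.
Qed.

Lemma design_entry_matrix w : \matrix_(i, j) design_entry (i, j) w =
  col_mx (\matrix_(i, j) Z1 M i j w) (\matrix_(i, j) Z2 M i j w).
Proof.
apply/matrixP => i j; rewrite !mxE /design_entry /=.
by case: (fintype.split i) => i'; rewrite mxE.
Qed.

End model.

Lemma risk_event_probability (R : realType) (tau sigma alpha : R) : 0 < tau -> 0 <= alpha ->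
  exists C Kc : R, forall p (M : transfer_model R p) v (r : R), spiked_model tau sigma alpha M v ->
  0 < r -> r ^+ 2 <= 2^-1 -> p%:R^-1 = r ^+ 12 ->
  exists2 E : set (Omega M), measurable E /\ (Pr M (~` E) <= (Kc * r ^+ 2)%:E)%E &
    E `<=` risk_event sigma alpha v (C * r).
Proof.
move=> t0 alpha0; pose c := tau / (1 + tau).
have c0 : 0 < c by rewrite divr_gt0// addr_gt0.
have [Kc Kc0 conc] := gaussian_concentration c0.
have [C C0 close] := spiked_risk_close alpha0 c0.
exists (sigma ^+ 2 * C + C), (Kc + Kc + (Kc + Kc)) => p M v r.
move=> [[_ _ _ [_ _ /andP[pn _]]] gd v1 S1E S2E] r0 r2 pr.
have n0 := positive_sample_size t0 pn.
have cp := dimension_gap t0 pn; have n1n : (n1 M <= ntot M)%N by exact: leq_addr.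
have vv : dotv v v = 1 by rewrite -l2norm_sqr v1 expr1n.
have iX := design_entry_independent gd.
have sX ij : standard_normal (design_entry (M := M) ij) by have [_] := gd; exact.
have iso m u t := conc _ _ _ _ _ (@design_entry R p M) iX sX m u t r.
pose Rt := root_mx alpha v.
have [E1 [m1 P1] H1] := iso (ntot M) v v (leqnn _) cp r0 r2 pr.
have [E2 [m2 P2] H2] := iso (ntot M) v (Rt *m beta2 M) (leqnn _) cp r0 r2 pr.
have [E3 [m3 P3] H3] := iso (ntot M) (Rt *m beta2 M) (Rt *m beta2 M) (leqnn _) cp r0 r2 pr.
have [E4 [m4 P4] H4] := iso (n1 M) v (Rt *m betatilde M) n1n cp r0 r2 pr.
exists (E1 `&` E2 `&` (E3 `&` E4)).
  have m12 := measurableI _ _ m1 m2; have m34 := measurableI _ _ m3 m4.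
  split; first exact: measurableI.
  rewrite !setCI !mulrDl !EFinD.
  rewrite (le_trans (measureU2 _ _ _))//; [by apply: measurableU; exact: measurableC..|].
  by apply: leeD; rewrite (le_trans (measureU2 _ _ _))//; first [exact: measurableC|exact: leeD].
move=> w [[/H1 h1 /H2 h2] [/H3 h3 /H4 h4]].
have r1 : r <= 1 by rewrite leNgt; apply/negP => r1; nra.
have r01 : 0 <= r <= 1 by rewrite (ltW r0).
have pr' : p%:R^-1 <= r.
  by rewrite pr -[leRHS]expr1; apply: ler_wiXn2l => //; exact: ltW.
have := close p (ntot M) (n1 M) _ v (beta2 M) (betatilde M) r vv n1n n0 cp r01 pr' h1 h2 h3 h4.
have rootE : sqrt_mx (spike_mx alpha v) = Rt by exact: sqrt_spike_mx.
have XE : (\matrix_(i, j) design_entry (M := M) (i, j) w) *m Rt = col_mx (X1 w) (X2 w).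
  by rewrite design_entry_matrix mul_col_mx /X1 /X2 S1E S2E -/(spike_mx alpha v) rootE.
have XLX : (col_mx (X1 w) (X2 w))^T *m head_mx R (ntot M) (n1 M) *m col_mx (X1 w) (X2 w) =
    (X1 w)^T *m X1 w by exact: head_mx_gram.
rewrite /= XE XLX => -[hV hB1 hB2 hB3].
have rate_le : C * r <= (sigma ^+ 2 * C + C) * r.
  by rewrite ler_wpM2r ?(ltW r0)// lerDr mulr_ge0// sqr_ge0.
rewrite /risk_event /=; split.
- rewrite /risk_V S2E -mulrA -mulrBr normrM ger0_norm ?sqr_ge0//.
  rewrite (le_trans (ler_wpM2l (sqr_ge0 sigma) hV))// mulrA ler_wpM2r ?(ltW r0)// lerDl//.
- rewrite /risk_B1 S2E; apply: (le_trans hB1); rewrite ler_wpM2r// sqr_ge0//.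
- rewrite /risk_B2 S2E; apply: (le_trans hB2); rewrite ler_wpM2r// sqr_ge0//.
- rewrite /risk_B3 S2E; apply: (le_trans hB3); rewrite ler_wpM2r// mulr_ge0// l2norm_ge0//.
Qed.

(** * High probability *)

(** The events are only given for large dimensions, hence the choice of one at every
    dimension, empty when there is none. *)
Lemma whp_of_rate (R : realType) (d : nat -> measure_display) (T : forall p, measurableType (d p))
    (P : forall p, probability (T p) R) (A : forall p, set (T p)) (eps : nat -> R) :
  eps @ \oo --> 0 ->
  (\forall p \near \oo, exists2 E, measurable E /\ (P p (~` E) <= (eps p)%:E)%E & E `<=` A p) ->
  with_high_probability P A.
Proof.
move=> eps0 PA.
have ch p : {E : set (T p) | [/\ measurable E, E `<=` A p &
    (exists2 E', measurable E' /\ (P p (~` E') <= (eps p)%:E)%E & E' `<=` A p) ->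
    (P p (~` E) <= (eps p)%:E)%E]}.
  apply: cid; have [[E [mE PE] EA]|nE] := pselect (exists2 E', measurable E' /\
    (P p (~` E') <= (eps p)%:E)%E & E' `<=` A p); first by exists E.
  by exists set0; split.
exists (fun p => sval (ch p)) => [p|]; first by case: (ch p) => E [].
apply: (@squeeze_cvge _ _ _ _ (fun p => (1 - eps p)%:E) _ (cst 1%E)); last exact: cvg_cst.
- near=> p; case: (ch p) => E /= [mE EA PE]; rewrite probability_le1// andbT.
  have {}PE : (P p (~` E) <= (eps p)%:E)%E by apply: PE; near: p.
  rewrite -[E]setCK probability_setC; last exact: measurableC.
  by rewrite EFinB leeB.
- apply: cvg_EFin; first by near=> p.
  have : (fun p => 1 - eps p) @ \oo --> (1 - 0 : R) by apply: cvgB => //; exact: cvg_cst.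
  by rewrite subr0.
Unshelve. all: by end_near. Qed.

Section rate.
Context (R : realType).

Definition rate_of (p : nat) : R := (p%:R : R) `^ (- (1 / 12%:R)).

Lemma rate_pow12 p : (0 < p)%N -> p%:R^-1 = rate_of p ^+ 12.
Proof.
move=> p0; rewrite -powR_mulrn ?powR_ge0// /rate_of -powRrM.
by rewrite mulNr mul1r mulVf ?pnatr_eq0// powR_inv1.
Qed.

Lemma rate_gt0 p : (0 < p)%N -> 0 < rate_of p.
Proof. by move=> p0; rewrite powR_gt0// ltr0n. Qed.

Lemma rate_sqr_cvg0 : (fun p => rate_of p ^+ 2) @ \oo --> (0 : R).
Proof.
apply/cvgrPdist_le => e e0; near=> p.
have p0 : (0 < p)%N by near: p; exact: nbhs_infty_gt.
rewrite sub0r normrN ger0_norm ?sqr_ge0//.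
rewrite -(@ler_pXn2r _ 6)// ?nnegrE ?sqr_ge0 ?(ltW e0)//.
rewrite -exprM -(rate_pow12 p0) invf_ple ?posrE ?exprn_gt0 ?ltr0n//.
by near: p; exact: nbhs_infty_ger.
Unshelve. all: by end_near. Qed.

End rate.

Theorem corollary3p5 (R : realType) (tau sigma alpha : R) :
  0 < tau < 1 -> 0 <= alpha ->
  exists C : R,
  forall (M : forall p, transfer_model R p) (v : forall p, 'cV[R]_p),
  (\forall p \near \oo,
     [/\ standing_conditions tau sigma (M p),
         gaussian_design (M p),
         l2norm (v p) = 1,
         Sigma1 (M p) = 1%:M + alpha *: (v p *m (v p)^T) &
         Sigma2 (M p) = 1%:M + alpha *: (v p *m (v p)^T)]) ->
  with_high_probability (fun p => Pr (M p))
    (fun p => [set w : Omega (M p) |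
      let n : R := (ntot (M p))%:R in
      let m1 : R := (n1 (M p))%:R in
      let q : R := p%:R in
      let gamma : R := aspect_ratio (M p) in
      let b2 := beta2 (M p) in
      let bt := betatilde (M p) in
      let rate : R := C * q `^ (- (1 / 12%:R)) in
      [/\ `|risk_V sigma w - sigma ^+ 2 * (n / (q - n))| <= rate,
          `|risk_B1 w
            - (dotv (v p) b2 ^+ 2
                 * (gamma * (gamma - 1) * (1 + alpha) / (gamma + alpha) ^+ 2
                    - (q - n) / q)
               + (q - n) / q * l2norm b2 ^+ 2)|
            <= rate * l2norm b2 ^+ 2,
          `|risk_B2 w
            - (dotv (v p) bt ^+ 2
                 * ((m1 / n) ^+ 2
                      * ((1 + alpha) * (1 + (1 + alpha) ^+ 2 / (gamma - 1))
                           / ((gamma - 1)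
                                * (1 + (1 + alpha) / (gamma - 1)) ^+ 2)
                         - 1 / gamma)
                    + m1 / n * (1 - m1 / n) * (alpha / (gamma - 1)))
               + m1 * (q - m1) / (q * (q - n)) * l2norm bt ^+ 2)|
            <= rate * l2norm bt ^+ 2 &
          `|risk_B3 w
            - (- (2%:R * m1 / n * dotv (v p) b2 * dotv (v p) bt
                    * ((gamma - 1) * (1 + alpha) * alpha
                         / (gamma + alpha) ^+ 2)))|
            <= rate * (l2norm b2 * l2norm bt)]]).
Proof.
move=> /andP[t0 _] alpha0.
have [C [Kc close]] := risk_event_probability sigma t0 alpha0.
exists C => M v Mv.
apply: (@whp_of_rate R _ _ _ _ (fun p => Kc * rate_of R p ^+ 2)).
  by rewrite -(mulr0 Kc); apply: cvgM; [exact: cvg_cst|exact: rate_sqr_cvg0].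
have half : \forall p \near \oo, rate_of R p ^+ 2 <= 2^-1.
  have h : 0 < (2^-1 : R) by rewrite invr_gt0.
  have /cvgrPdist_le/(_ _ h) := @rate_sqr_cvg0 R.
  by apply: filterS => p; rewrite sub0r normrN ger0_norm ?sqr_ge0.
near=> p; have p0 : (0 < p)%N by near: p; exact: nbhs_infty_gt.
apply: close.
- by near: p.
- exact: rate_gt0.
- by near: p.
- exact: rate_pow12.
Unshelve. all: by end_near. Qed.
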